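(* Let $\Delta_n=\sum_{i=1}^n\partial^2/\partial x_i^2$, let $n=2\nu+3$ with $\nu\in\{0,1,2,\dots\}$, let $a\in\mathbb{R}$ and let $m\ge1$ be an integer. Let $f(x,t)$ and $\varphi_0(x),\dots,\varphi_{2m-1}(x)$ be given smooth functions on $\mathbb{R}^n\times[0,\infty)$ and $\mathbb{R}^n$, respectively. Then the Cauchy problem $$\left(\frac{\partial^2}{\partial t^2}-a^2\Delta_n\right)^m u=f(x,t),\quad x\in\mathbb{R}^n,\ t>0,\qquad \left.\frac{\partial^j u}{\partial t^j}\right|_{t=0}=\varphi_j(x),\quad j=0,1,\dots,2m-1,$$ is solved by $$\begin{aligned}u(x,t)=&\int_0^t d\tau\int_0^{t-\tau}\frac{[(t-\tau)^2-\sigma^2]^{m-2}\sigma^2}{(2m-2)!!\,(2m-4)!!}\;\mathcal I^\nu\Big[(a^2\Delta_n)^\nu A_{\,\cdot}[f(\cdot,\tau)](x)\Big](\sigma)\,d\sigma\\ &+\frac1{(2m-2)!!}\sum_{r=0}^{\nu-1}\int_0^t\frac{(t-\tau)^{2m+2r-1}}{(2m+2r-1)!!\,(2r)!!}(a^2\Delta_n)^rf(x,\tau)\,d\tau\\ &+\sum_{k=0}^{m-1}(-1)^k\binom mk(a^2\Delta_n)^{k+\nu}\sum_{j=0}^{2m-1-2k}\frac{\partial^{2m-1-2k-j}}{\partial t^{2m-1-2k-j}}\int_0^t\frac{(t^2-\tau^2)^{m-2}\tau^2}{(2m-2)!!\,(2m-4)!!}\;\mathcal I^\nu\Big[A_{\,\cdot}[\varphi_j](x)\Big](\tau)\,d\tau\\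 &+\sum_{k=0}^{m-1}(-1)^k\binom mk\sum_{j=0}^{2m-1-2k}\sum_{i=0}^{\nu-1}\binom{m-1+i}{i}\frac{t^{2k+2i+j}}{(2k+2i+j)!}(a^2\Delta_n)^{k+i}\varphi_j(x).\end{aligned}$$
   Context: Notation. For $\sigma\ge0$ and a function $g$ on $\mathbb{R}^n$, $A_\sigma[g](x)=\frac{1}{S_n(\sigma)}\int_{|\xi-x|=|a|\sigma}g(\xi)\,dS(\xi)$ with $S_n(\sigma)=2(2\pi)^{\nu+1}(a\sigma)^{n-1}$ and $dS$ the surface element of the sphere $|\xi-x|^2=(a\sigma)^2$; equivalently $A_\sigma[g](x)=\frac{1}{2(2\pi)^{\nu+1}}\int_{S^{n-1}}g(x+a\sigma\omega)\,d\omega$, which is used when $a\sigma=0$. $\mathcal I$ is the operator $(\mathcal Ih)(\sigma)=\int_0^\sigma h(s)\,s\,ds$ on functions of $\sigma\geq 0$, $\mathcal I^\nu$ its $\nu$-fold iterate, $\mathcal I^0=$ identity; in $\mathcal I^\nu[A_{\cdot}[g](x)](\sigma)$ it acts on $s\mapsto A_s[g](x)$. $\Delta_n$ acts in $x$. Empty sums are $0$. Double factorials: $(2k)!!=2^kk!$, $0!!=1$, $(2k+1)!!=1\cdot3\cdots(2k+1)$. Convention for $m=1$: $\int_0^T\frac{(T^2-\sigma^2)^{m-2}}{(2m-2)!!(2m-4)!!}h(\sigma)\,\sigma\,d\sigma$ (equal for $m\ge2$ to $\frac{1}{(2m-2)!!}(\mathcal I^{m-1}h)(T)$) is read as $h(T)$.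 *)

(* Defs.v *)
From HB Require Import structures.
From Stdlib Require Import Reals.
From mathcomp Require Import all_boot.
From Coquelicot Require Import Coquelicot.

Set Implicit Arguments.
Unset Strict Implicit.
Unset Printing Implicit Defensive.

Open Scope R_scope.

HB.instance Definition _ := Monoid.isComLaw.Build R 0 Rplus
  (fun x y z => esym (Rplus_assoc x y z)) Rplus_comm Rplus_0_l.

Notation "\sum_ ( i < n ) F" := (\big[Rplus/0]_(i < n) F) : R_scope.

(* Coquelicot's uniform structure on ['I_n -> R] is that of the sup norm, so
   [locally] and [continuous] refer to the usual topology of R^n. *)
Notation vec n := ('I_n -> R).

Fixpoint dfact (n : nat) : nat :=
  match n with
  | n'.+2 => n * dfact n'
  | _ => 1
  end.

Definition pderiv n (i : 'I_n) (g : vec n -> R) : vec n -> R :=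
  fun x => Derive (fun s => g [eta x with i |-> s]) (x i).

Definition laplacian n (g : vec n -> R) : vec n -> R :=
  fun x => \sum_(i < n) pderiv i (pderiv i g) x.

Definition a2lap n (a : R) (g : vec n -> R) : vec n -> R :=
  fun x => a ^ 2 * laplacian g x.

(* Derivative relative to [0, +oo): the usual derivative at t > 0, the right
   derivative at t = 0 (same shape as Coquelicot's [is_derive], with the filter
   [locally t] restricted to nonnegative reals). *)
Definition is_derive_ge0 (h : R -> R) (t l : R) : Prop :=
  filterdiff h (within (fun s => 0 <= s) (locally t)) (fun y => scal y l).

Definition derive_ge0 (h : R -> R) (t : R) : R := iota (is_derive_ge0 h t).

Definition derive_n_ge0 (p : nat) (h : R -> R) : R -> R := iter p derive_ge0 h.

Definition box n (a : R) (u : vec n -> R -> R) : vec n -> R -> R :=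
  fun x t => derive_n_ge0 2 (u x) t - a2lap a (fun y => u y t) x.

Fixpoint Ck n (k : nat) (g : vec n -> R) : Prop :=
  (forall x, continuous g x) /\
  match k with
  | 0%N => True
  | k'.+1 => forall i,
      (forall x, ex_derive (fun s => g [eta x with i |-> s]) (x i)) /\
      Ck k' (pderiv i g)
  end.

Definition smooth n (g : vec n -> R) : Prop := forall k, Ck k g.

(* The same on the closed half-space R^n x [0, +oo); the values of [f] at
   negative times are irrelevant. *)
Definition continuous_half n (f : vec n -> R -> R) : Prop :=
  forall (x : vec n) (t : R), 0 <= t ->
    filterlim (fun p : vec n * R => f p.1 p.2)
      (within (fun p : vec n * R => 0 <= p.2) (locally (x, t)))
      (locally (f x t)).

Fixpoint Ck_half n (k : nat) (f : vec n -> R -> R) : Prop :=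
  continuous_half f /\
  match k with
  | 0%N => True
  | k'.+1 =>
      (forall i,
         (forall x t, 0 <= t ->
            ex_derive (fun s => f [eta x with i |-> s] t) (x i)) /\
         Ck_half k' (fun x t => pderiv i (fun y => f y t) x)) /\
      (forall x t, 0 <= t -> exists l, is_derive_ge0 (f x) t l) /\
      Ck_half k' (fun x t => derive_ge0 (f x) t)
  end.

Definition smooth_half n (f : vec n -> R -> R) : Prop :=
  forall k, Ck_half k f.

Definition vcons d (c : R) (w : vec d) : vec d.+1 :=
  fun i => if unlift ord0 i is Some j then w j else c.

(* Integral over the unit sphere S^d of R^(d+1) against its surface element,
   in spherical coordinates: S^0 = {1, -1} carries the counting measure, and
   omega = (cos th, sin th * w), 0 <= th <= PI, w in S^d, has surface element
   (sin th)^d dth dw on S^(d+1). *)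
Fixpoint sphere_int (d : nat) : (vec d.+1 -> R) -> R :=
  match d with
  | 0%N => fun g => g (fun _ => 1) + g (fun _ => - 1)
  | d'.+1 => fun g =>
      RInt (fun th => sin th ^ d' *
              sphere_int (fun w => g (vcons (cos th) (fun j => sin th * w j))))
           0 PI
  end.

(* Integral over the sphere of radius |a| s about x, with surface element
   (a s)^(2 nu + 2) dw, divided by 2 (2 PI)^(nu + 1) (a s)^(2 nu + 2); this form
   also covers a s = 0.  It is the mean value divided by (2 nu + 1)!!. *)
Definition Amean (nu : nat) (a s : R) (g : vec (2 * nu).+3 -> R)
    (x : vec (2 * nu).+3) : R :=
  / (2 * (2 * PI) ^ nu.+1) *
  sphere_int (fun w : vec (2 * nu).+3 => g (fun i => x i + a * s * w i)).

Definition Iop (h : R -> R) : R -> R := fun s => RInt (fun r => h r * r) 0 s.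

(* int_0^T (T^2 - s^2)^(m-2) / ((2m-2)!! (2m-4)!!) h(s) s ds, read as h(T) when
   m = 1; not meaningful when m = 0. *)
Definition kernel_int (m : nat) (h : R -> R) (T : R) : R :=
  if m == 1%N then h T
  else RInt (fun s => (T ^ 2 - s ^ 2) ^ (m - 2)
                / (INR (dfact (2 * m - 2)) * INR (dfact (2 * m - 4)))
                * h s * s) 0 T.

Definition solves_cauchy n (a : R) (m : nat) (f : vec n -> R -> R)
    (phi : nat -> vec n -> R) (u : vec n -> R -> R) : Prop :=
  [/\ Ck_half (2 * m) u,
      forall x t, 0 < t -> iter m (box a) u x t = f x t
    & forall j, (j < 2 * m)%N -> forall x, derive_n_ge0 j (u x) 0 = phi j x].

(* Main.v *)
(* Write L = a^2 Delta, and let E_q[g] (below: impulse q g) be the solution of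
   (d_t^2 - L)^q E = 0 with initial values d_t^j E = 0 for j < 2 q - 1 and d_t^(2 q - 1) E = g.
   The spherical means A_s[g] satisfy Darboux's equation
   s A'' + (2 nu + 2) A' = s A[L g], which is proved by induction on the
   dimension in polar coordinates. Each application of I lowers the coefficient
   2 nu + 2 by 2, so B[g] = s I^nu A_s[g] satisfies
   B[g] = s^(2 nu + 1) / (2 nu + 1)! g + int_0^s int_0^p B[L g] dq dp, and
   adding to B[L^nu g] the missing terms s^(2 i + 1) / (2 i + 1)! L^i g, i < nu,
   gives E_1[g]. Next, 2 q E_(q+1) = int_0^t s E_q ds solves
   (d_t^2 - L) E_(q+1) = E_q, which is the kernel of the theorem. The source
   enters through Duhamel's integral of E_m, and the initial values of the
   remaining part follow from the binomial expansion of (d_t^2 - L)^m E_m = 0. *)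
Require Import Defs.
From Stdlib Require Import Reals Lra Lia ClassicalEpsilon FunctionalExtensionality.
From mathcomp Require Import all_boot zify.
From Coquelicot Require Import Coquelicot.
Open Scope R_scope.

Set Implicit Arguments.
Unset Strict Implicit.

(** * Continuity and integrals depending on a parameter *)

(** The recursion for E_q rests on the commutator of d_t^2 - L with multiplication by t, which is 2
    d_t: the extra derivative is absorbed by 2 q E_(q+1)' = t E_q. The constants come from s = 0:
    the normalisation gives A_0[g] = g / (2 nu + 1)!!, and I^nu turns a constant c into c s^(2 nu) /
    (2 nu)!!, whence the leading term s^(2 nu + 1) / (2 nu + 1)! of B[g]. The integral equation for
    B[g] also yields its smoothness in s, since it trades two time derivatives for one L on g. A
    source that is merely continuous in time can therefore be handled exactly like the data, its
    time being a parameter [tau] that is never differentiated; the price is that the Duhamel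
    integral admits only as many time derivatives as the vanishing of E_m at s = 0 allows, and that
    number is exactly 2 m. Since u and f are given for t >= 0 with one-sided derivatives at 0,
    everything is built on the whole time axis with ordinary derivatives and is compared with u on
    the half-line at the end. *)

Definition contf (U V : UniformSpace) (f : U -> V) := forall x, continuous f x.

Lemma contf_ext (U V : UniformSpace) (f g : U -> V) :
  (forall x, f x = g x) -> contf f -> contf g.
Proof. by move=> /functional_extensionality ->. Qed.

Lemma contf_comp (U V W : UniformSpace) (g : V -> W) (f : U -> V) :
  contf g -> contf f -> contf (fun x => g (f x)).
Proof. by move=> cg cf x; apply: continuous_comp. Qed.

Lemma contf_pair (U V W : UniformSpace) (f : U -> V) (g : U -> W) :
  contf f -> contf g -> contf (fun x => (f x, g x)).
Proof.
move=> cf cg x.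
apply: (@continuous_comp_2 U V W (prod_UniformSpace V W) f g (fun a b => (a, b))) => //.
by apply: (continuous_ext (fun p => p)) (continuous_id _) => p; exact: surjective_pairing.
Qed.

Lemma contf_id (U : UniformSpace) : contf (fun x : U => x).
Proof. by move=> x; exact: continuous_id. Qed.

Lemma contf_fst (U V W : UniformSpace) (f : U -> (V * W)%type) :
  contf f -> contf (fun x => (f x).1).
Proof. by move=> cf; apply: contf_comp cf => x; exact: continuous_fst. Qed.

Lemma contf_snd (U V W : UniformSpace) (f : U -> (V * W)%type) :
  contf f -> contf (fun x => (f x).2).
Proof. by move=> cf; apply: contf_comp cf => x; exact: continuous_snd. Qed.

Lemma contf_const (U V : UniformSpace) (c : V) : contf (fun _ : U => c).
Proof. by move=> x; exact: continuous_const. Qed.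

Lemma contf_plus (U : UniformSpace) (f g : U -> R) :
  contf f -> contf g -> contf (fun x => f x + g x).
Proof. by move=> cf cg x; apply: (@continuous_plus U R_AbsRing R_NormedModule). Qed.

Lemma contf_mult (U : UniformSpace) (f g : U -> R) :
  contf f -> contf g -> contf (fun x => f x * g x).
Proof. by move=> cf cg x; apply: (@continuous_mult U R_AbsRing). Qed.

Lemma contf_opp (U : UniformSpace) (f : U -> R) :
  contf f -> contf (fun x => - f x).
Proof. by move=> cf x; apply: (@continuous_opp U R_AbsRing R_NormedModule). Qed.

Lemma contf_minus (U : UniformSpace) (f g : U -> R) :
  contf f -> contf g -> contf (fun x => f x - g x).
Proof. by move=> cf cg; apply: contf_plus => //; apply: contf_opp. Qed.

Lemma contf_pow (U : UniformSpace) (f : U -> R) p :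
  contf f -> contf (fun x => f x ^ p).
Proof.
move=> cf; elim: p => [|p IH] /=; [exact: contf_const|exact: contf_mult].
Qed.

Lemma contf_sin (U : UniformSpace) (f : U -> R) :
  contf f -> contf (fun x => sin (f x)).
Proof. by move=> cf; apply: (@contf_comp U R_UniformSpace R_UniformSpace sin) => // x; exact: continuous_sin. Qed.

Lemma contf_cos (U : UniformSpace) (f : U -> R) :
  contf f -> contf (fun x => cos (f x)).
Proof. by move=> cf; apply: (@contf_comp U R_UniformSpace R_UniformSpace cos) => // x; exact: continuous_cos. Qed.

Lemma contf_sum (U : UniformSpace) (I : Type) (r : seq I) (P : pred I) (F : I -> U -> R) :
  (forall i, contf (F i)) -> contf (fun x => \big[Rplus/0]_(i <- r | P i) F i x).
Proof.
move=> cF; elim: r => [|i r IH].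
  by apply: contf_ext (@contf_const U R_UniformSpace 0) => x; rewrite big_nil.
case Pi: (P i); last by apply: contf_ext IH => x; rewrite big_cons Pi.
by apply: contf_ext (contf_plus (cF i) IH) => x; rewrite big_cons Pi.
Qed.

(** A finite intersection of filter sets; it reduces the sup-norm topology of [vec n] to its
    coordinates. *)
Lemma filter_forall_ord (T : Type) (F : (T -> Prop) -> Prop) (FF : Filter F) n
  (P : 'I_n -> T -> Prop) : (forall i, F (P i)) -> F (fun x => forall i, P i x).
Proof.
move=> FP.
suff H : forall s : seq 'I_n, F (fun x => forall i, i \in s -> P i x).
  by apply: filter_imp (H (enum 'I_n)) => x Hx i; apply: Hx; rewrite mem_enum.
elim=> [|i s IH]; first by apply: filter_imp filter_true.
apply: filter_imp (filter_and _ _ (FP i) IH) => x [Hi Hs] j.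
by rewrite in_cons => /orP [/eqP -> //|]; exact: Hs.
Qed.

Lemma contf_vec (U : UniformSpace) n (f : U -> vec n) :
  (forall i, contf (fun x => f x i)) -> contf f.
Proof.
move=> cf x; apply/filterlim_locally => eps.
apply: filter_forall_ord => i.
by move: eps; apply/filterlim_locally; exact: cf.
Qed.

Lemma contf_coord (U : UniformSpace) n (f : U -> vec n) i :
  contf f -> contf (fun x => f x i).
Proof.
move=> cf x; apply/filterlim_locally => eps.
move/filterlim_locally: (cf x) => /(_ eps); apply: filter_imp => y; exact.
Qed.

Lemma contf_proj n (i : 'I_n) : contf (fun y : vec n => y i).
Proof. by apply: (@contf_coord _ n (fun y => y)); exact: contf_id. Qed.

Lemma contf_vcons (U : UniformSpace) d (c : U -> R) (w : U -> vec d) :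
  contf c -> contf w -> contf (fun x => vcons (c x) (w x) : vec d.+1).
Proof.
move=> cc cw; apply: contf_vec => i; rewrite /vcons; case: unlift => [j|] //.
exact: contf_coord.
Qed.

Lemma contf_scalv (U : UniformSpace) d (c : U -> R) (w : U -> vec d) :
  contf c -> contf w -> contf (fun x => (fun j => c x * w x j) : vec d).
Proof.
by move=> cc cw; apply: contf_vec => i; apply: contf_mult => //; apply: contf_coord.
Qed.

Lemma contf_upd (U : UniformSpace) n (x : U -> vec n) i (s : U -> R) :
  contf x -> contf s -> contf (fun p => [eta x p with i |-> s p] : vec n).
Proof.
move=> cx cs; apply: contf_vec => j /=; case: (j == i) => //; exact: contf_coord.
Qed.

Lemma contf_ex_RInt (f : R -> R) a b : contf f -> ex_RInt f a b.
Proof. by move=> cf; apply: (@ex_RInt_continuous R_CompleteNormedModule) => z _; exact: cf. Qed.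

Lemma RInt_congr (f g : R -> R) a b : (forall x, f x = g x) -> RInt f a b = RInt g a b.
Proof. by move=> /functional_extensionality ->. Qed.

Lemma RInt_congr_in (f g : R -> R) a b : a <= b ->
  (forall x, a < x -> x < b -> f x = g x) -> RInt f a b = RInt g a b.
Proof.
move=> ab fg; apply: (@RInt_ext R_CompleteNormedModule) => x.
by rewrite Rmin_left // Rmax_right // => -[ax xb]; apply: fg.
Qed.

Lemma RIntD (f g : R -> R) a b : contf f -> contf g ->
  RInt (fun x => f x + g x) a b = RInt f a b + RInt g a b.
Proof. by move=> cf cg; apply: (@RInt_plus R_CompleteNormedModule); apply: contf_ex_RInt. Qed.

Lemma RIntB (f g : R -> R) a b : contf f -> contf g ->
  RInt (fun x => f x - g x) a b = RInt f a b - RInt g a b.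
Proof. by move=> cf cg; apply: (@RInt_minus R_CompleteNormedModule); apply: contf_ex_RInt. Qed.

Lemma RIntZ (f : R -> R) c a b : contf f ->
  RInt (fun x => c * f x) a b = c * RInt f a b.
Proof. by move=> cf; apply: (@RInt_scal R_CompleteNormedModule); apply: contf_ex_RInt. Qed.

Lemma contf_slice (U V W : UniformSpace) (F : U -> V -> W) x :
  contf (fun p : U * V => F p.1 p.2) -> contf (F x).
Proof.
move=> cF; apply: (contf_comp (g := fun p : U * V => F p.1 p.2) (f := fun y => (x, y)) cF).
by apply: contf_pair; [exact: contf_const|exact: contf_id].
Qed.

(* Tube lemma: over the compact interval the modulus of continuity of [F] at
   [x] can be chosen independently of the integration variable. *)
Lemma contf_RInt_fixed (U : UniformSpace) (F : U -> R -> R) a b :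
  contf (fun p : U * R => F p.1 p.2) -> contf (fun x => RInt (F x) a b).
Proof.
move=> cF x.
wlog ab : a b / a <= b => [H|].
  case: (Rle_dec a b) => ab; first exact: H.
  have e : (fun y => RInt (F y) a b) = (fun y => - RInt (F y) b a).
    apply: functional_extensionality => y.
    by rewrite -[RInt (F y) a b](@opp_RInt_swap R_CompleteNormedModule) //; apply: contf_ex_RInt; apply: contf_slice.
  rewrite e; apply: (@continuous_opp U R_AbsRing R_NormedModule); apply: H; lra.
apply/filterlim_locally => eps.
(* The + 1 keeps the denominator nonzero when a = b; the tolerance is halved next because [F y t]
   and [F x t] are both compared with the value at a common centre [t0]. *)
have e2 : 0 < eps / (2 * (b - a + 1)).
  by apply: Rdiv_lt_0_compat; [exact: cond_pos|lra].
have e4 : 0 < eps / (2 * (b - a + 1)) / 2 by lra.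
have Hd : forall t, exists d : posreal, forall y t', ball x d y -> ball t d t' ->
   Rabs (F y t' - F x t) < eps / (2 * (b - a + 1)) / 2.
  move=> t.
  move/filterlim_locally: (cF (x, t)) => /(_ (mkposreal _ e4)) [d Hd].
  exists d => y t' By Bt; apply: (Hd (y, t')); by split.
pose delta t := proj1_sig (constructive_indefinite_description _ (Hd t)).
have Hdelta t := proj2_sig (constructive_indefinite_description _ (Hd t)).
have [d Hu] := compactness_value_1d a b delta.
exists d => y By.
have main t : a <= t <= b -> Rabs (F y t - F x t) <= eps / (2 * (b - a + 1)).
  move=> tab; apply: Rnot_lt_le => bad; apply: (Hu t tab) => -[t0 [_ [Ht Hdt]]].
  have h1 : Rabs (F y t - F x t0) < eps / (2 * (b - a + 1)) / 2.
    by apply: Hdelta; [exact: ball_le By|].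
  have h2 : Rabs (F x t - F x t0) < eps / (2 * (b - a + 1)) / 2.
    by apply: Hdelta; [exact: ball_center|].
  have := Rabs_triang (F y t - F x t0) (- (F x t - F x t0)).
  rewrite Rabs_Ropp (_ : _ + _ = F y t - F x t); [lra|ring].
have c y' : contf (F y') by apply: contf_slice.
have cm : contf (fun t => F y t - F x t) by apply: contf_minus.
change (Rabs (RInt (F y) a b - RInt (F x) a b) < eps).
rewrite -RIntB //.
apply: Rle_lt_trans (_ : (b - a) * (eps / (2 * (b - a + 1))) < _).
  apply: abs_RInt_le_const => //; exact: contf_ex_RInt.
have : 0 < eps by exact: cond_pos.
move=> e0.
have -> : (b - a) * (eps / (2 * (b - a + 1))) = eps * ((b - a) / (2 * (b - a + 1))) by field; lra.
have : (b - a) / (2 * (b - a + 1)) < 1.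
  apply: (Rmult_lt_reg_r (2 * (b - a + 1))); first lra.
  rewrite /Rdiv Rmult_assoc Rinv_l; lra.
nra.
Qed.

(** The substitution r = l s moves the endpoint into the integrand, so that continuity with a
    variable endpoint follows from the fixed interval [0, 1]. *)
Lemma RInt_0_rescale (h : R -> R) s : contf h -> RInt h 0 s = s * RInt (fun l => h (l * s)) 0 1.
Proof.
move=> ch.
have := @RInt_comp_lin R_CompleteNormedModule h s 0 0 1 (contf_ex_RInt _ _ ch).
rewrite (_ : s * 0 + 0 = 0); last ring. rewrite (_ : s * 1 + 0 = s); last ring.
move=> <-.
rewrite (_ : (fun y => _) = (fun y => s * h (y * s))); last first.
  apply: functional_extensionality => y; congr (_ * h _); ring.
apply: RIntZ.
apply: (contf_comp (V := R_UniformSpace) ch); apply: contf_mult; [exact: contf_id|exact: contf_const].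
Qed.

Lemma contf_RInt (U : UniformSpace) (F : U -> R -> R) (b : U -> R) :
  contf (fun p : U * R => F p.1 p.2) -> contf b -> contf (fun x => RInt (F x) 0 (b x)).
Proof.
move=> cF cb.
rewrite (_ : (fun x => _) = (fun x => b x * RInt (fun l => F x (l * b x)) 0 1)); last first.
  by apply: functional_extensionality => x; apply: RInt_0_rescale; apply: contf_slice.
apply: contf_mult => //; apply: (contf_RInt_fixed (F := fun x l => F x (l * b x))).
apply: (contf_comp (g := fun p : U * R => F p.1 p.2) (f := fun p => (p.1, p.2 * b p.1)) cF).
apply: contf_pair; first by apply: contf_fst; exact: contf_id.
apply: contf_mult; first by apply: contf_snd; exact: contf_id.
by apply: contf_comp cb _; apply: contf_fst; exact: contf_id.
Qed.

Lemma contf2_pt (F : R -> R -> R) x y : contf (fun p : R * R => F p.1 p.2) -> continuity_2d_pt F x y.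
Proof. by move=> cF; apply/continuity_2d_pt_filterlim; exact: (cF (x, y)). Qed.

Lemma is_derive_RInt_under (F F' : R -> R -> R) a b s :
  (forall r t, is_derive (fun r => F r t) r (F' r t)) ->
  (forall r, contf (F r)) -> contf (fun p : R * R => F' p.1 p.2) ->
  is_derive (fun r => RInt (F r) a b) s (RInt (F' s) a b).
Proof.
move=> dF cF cF'.
have eF : (fun u v => Derive (fun r => F r v) u) = F'.
  by apply: functional_extensionality => u; apply: functional_extensionality => v; apply: is_derive_unique.
have := @is_derive_RInt_param F a b s.
rewrite (_ : (fun t => Derive (fun r => F r t) s) = F' s); last by rewrite -eF.
apply.
- apply: filter_forall => r t _; exists (F' r t); exact: dF.
- move=> t _; rewrite eF; exact: contf2_pt.
- apply: filter_forall => r; exact: contf_ex_RInt.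
Qed.

Lemma is_deriveD (f g : R -> R) x l k :
  is_derive f x l -> is_derive g x k -> is_derive (fun y => f y + g y) x (l + k).
Proof. by move=> df dg; apply: (@is_derive_plus R_AbsRing R_NormedModule). Qed.

Lemma is_deriveB (f g : R -> R) x l k :
  is_derive f x l -> is_derive g x k -> is_derive (fun y => f y - g y) x (l - k).
Proof. by move=> df dg; apply: (@is_derive_minus R_AbsRing R_NormedModule). Qed.

Lemma is_deriveM (f g : R -> R) x l k :
  is_derive f x l -> is_derive g x k -> is_derive (fun y => f y * g y) x (l * g x + f x * k).
Proof.
move=> df dg; apply: (@is_derive_mult R_AbsRing f g x l k df dg); exact: Rmult_comm.
Qed.

Lemma is_deriveC (c x : R) : is_derive (fun _ : R => c) x 0.
Proof. exact: (@is_derive_const R_AbsRing R_NormedModule). Qed.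

Lemma is_deriveI (x : R) : is_derive (fun y : R => y) x 1.
Proof. exact: (@is_derive_id R_AbsRing). Qed.

Lemma is_derive_eq (f : R -> R) (x l k : R) : is_derive f x l -> l = k -> is_derive f x k.
Proof. by move=> ? <-. Qed.

Lemma is_derive_scal_eq (f : R -> R) (c x l k : R) : is_derive f x l -> c * l = k ->
  is_derive (fun y => c * f y) x k.
Proof. by move=> df <-; exact: is_derive_scal. Qed.

Lemma is_derive_extR (f g : R -> R) (x l : R) :
  (forall y, f y = g y) -> is_derive f x l -> is_derive g x l.
Proof. by move=> /functional_extensionality ->. Qed.

Lemma is_derive_sum (I : Type) (r : seq I) (P : pred I) (F : I -> R -> R) (F' : I -> R) x :
  (forall i, is_derive (F i) x (F' i)) ->
  is_derive (fun y => \big[Rplus/0]_(i <- r | P i) F i y) x (\big[Rplus/0]_(i <- r | P i) F' i).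
Proof.
move=> dF; elim: r => [|i r IH].
  by rewrite big_nil; apply: is_derive_ext (is_deriveC 0 x) => y; rewrite big_nil.
rewrite big_cons; case Pi: (P i); last by apply: is_derive_ext IH => y; rewrite big_cons Pi.
by apply: is_derive_ext (is_deriveD (dF i) IH) => y; rewrite big_cons Pi.
Qed.

Lemma is_derive_RInt0 (h : R -> R) s : contf h -> is_derive (fun s => RInt h 0 s) s (h s).
Proof.
move=> ch; apply: (@is_derive_RInt R_NormedModule h _ 0); last exact: ch.
by apply: filter_forall => b; apply: (@RInt_correct R_CompleteNormedModule); exact: contf_ex_RInt.
Qed.

Lemma is_derive_contf (f f' : R -> R) : (forall x, is_derive f x (f' x)) -> contf f.
Proof. by move=> df x; apply: ex_derive_continuous; eexists; exact: df. Qed.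

(** Standard device of what follows: identities between iterated integrals are checked by
    differentiating and comparing values at 0, which avoids interchanging integrations. *)
Lemma eq_of_is_derive (f g h : R -> R) :
  (forall x, is_derive f x (h x)) -> (forall x, is_derive g x (h x)) -> f 0 = g 0 ->
  forall x, f x = g x.
Proof.
move=> df dg e x.
have dd y : is_derive (fun y => f y - g y) y 0.
  by apply: is_derive_eq (is_deriveB (df y) (dg y)) _; ring.
suff : f x - g x = f 0 - g 0 by lra.
have [x0|[->|x0]] := Rtotal_order x 0.
- exact: (@eq_is_derive R_NormedModule (fun y => f y - g y) x 0 (fun t _ => dd t)).
- by [].
- symmetry; exact: (@eq_is_derive R_NormedModule (fun y => f y - g y) 0 x (fun t _ => dd t)).
Qed.

(** * Integrals over spheres *)

Definition contf2 (U V W : UniformSpace) (g : U -> V -> W) :=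
  contf (fun p : U * V => g p.1 p.2).

Lemma contf2_comp (T U V W : UniformSpace) (g : U -> V -> W) (X : T -> U) (Y : T -> V) :
  contf2 g -> contf X -> contf Y -> contf (fun p => g (X p) (Y p)).
Proof.
move=> cg cX cY.
by apply: (contf_comp (g := fun p : U * V => g p.1 p.2) (f := fun p => (X p, Y p)) cg); apply: contf_pair.
Qed.

Ltac cont :=
  repeat first
  [ assumption
  | apply: contf_id | apply: contf_const
  | apply: contf_plus | apply: contf_minus | apply: contf_mult | apply: contf_opp
  | apply: contf_pow | apply: contf_sin | apply: contf_cos
  | apply: contf_sum => ?
  | apply: contf_vcons | apply: contf_scalv | apply: contf_upd | apply: contf_proj | eapply contf_coord
  | apply: contf_fst | apply: contf_snd | apply: contf_pair ].

(** The parameter space is left arbitrary because the induction on the dimension adds the polar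
    angle to it. *)
Lemma contf_sphere_int d (U : UniformSpace) (H : U -> vec d.+1 -> R) :
  contf2 H -> contf (fun x => sphere_int (H x)).
Proof.
elim: d U H => [|d IH] U H cH /=.
  apply: contf_plus; apply: (contf2_comp cH); cont.
apply: (contf_RInt_fixed (F := fun x th => sin th ^ d * sphere_int
  (fun w => H x (vcons (cos th) (fun j => sin th * w j))))).
apply: contf_mult; first by cont.
apply: (IH _ (fun p w => H p.1 (vcons (cos p.2) (fun j => sin p.2 * w j)))).
apply: (contf2_comp cH); cont.
Qed.

Lemma contf_sphere_int_slice d (H : vec d.+2 -> R) :
  contf H -> contf (fun th => sphere_int (fun w : vec d.+1 => H (vcons (cos th) (fun j => sin th * w j)))).
Proof.
move=> cH; apply: contf_sphere_int; apply: (contf_comp cH); cont.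
Qed.

Lemma sphere_int_D d (f g : vec d.+1 -> R) : contf f -> contf g ->
  sphere_int (fun w => f w + g w) = sphere_int f + sphere_int g.
Proof.
elim: d f g => [|d IH] f g cf cg /=; first ring.
rewrite -RIntD; try by apply: contf_mult; [cont | exact: contf_sphere_int_slice].
apply: RInt_congr => th.
rewrite IH; first ring.
  by apply: (contf_comp cf); cont.
by apply: (contf_comp cg); cont.
Qed.

Lemma sphere_int_Z d (f : vec d.+1 -> R) c : contf f ->
  sphere_int (fun w => c * f w) = c * sphere_int f.
Proof.
elim: d f => [|d IH] f cf /=; first ring.
rewrite -RIntZ; last by apply: contf_mult; [cont | exact: contf_sphere_int_slice].
apply: RInt_congr => th.
rewrite IH; first ring.
by apply: (contf_comp cf); cont.
Qed.

Lemma is_derive_sphere_int d (H H' : R -> vec d.+1 -> R) s :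
  (forall r w, is_derive (fun r => H r w) r (H' r w)) -> contf2 H -> contf2 H' ->
  is_derive (fun r => sphere_int (H r)) s (sphere_int (H' s)).
Proof.
elim: d H H' s => [|d IH] H H' s dH cH cH' /=.
  by apply: is_deriveD; apply: dH.
apply: (is_derive_RInt_under
  (F := fun r th => sin th ^ d * sphere_int (fun w => H r (vcons (cos th) (fun j => sin th * w j))))
  (F' := fun r th => sin th ^ d * sphere_int (fun w => H' r (vcons (cos th) (fun j => sin th * w j))))).
- move=> r th.
  apply: is_derive_scal.
  apply: (IH (fun r w => H r (vcons (cos th) (fun j => sin th * w j)))
    (fun r w => H' r (vcons (cos th) (fun j => sin th * w j)))); first by move=> *; apply: dH.
    by apply: (contf2_comp cH); cont.
  by apply: (contf2_comp cH'); cont.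
- move=> r; apply: contf_mult; first by cont.
  apply: contf_sphere_int_slice; apply: (contf2_comp cH); cont.
- apply: contf_mult; first by cont.
  apply: (contf_sphere_int (H := fun p w => H' p.1 (vcons (cos p.2) (fun j => sin p.2 * w j)))).
  apply: (contf2_comp cH'); cont.
Qed.

(** Relational counterpart of [pderiv]: it includes the existence of the derivative, which the total
    function [Derive] does not record. *)
Definition is_pd n (i : 'I_n) (G G' : vec n -> R) :=
  forall x, is_derive (fun s => G [eta x with i |-> s]) (x i) (G' x).

Lemma is_pd_at n (i : 'I_n) (G G' : vec n -> R) (x : vec n) s : is_pd i G G' ->
  is_derive (fun r => G [eta x with i |-> r]) s (G' [eta x with i |-> s]).
Proof.
move=> /(_ [eta x with i |-> s]) /=; rewrite eqxx.
apply: is_derive_ext => r; congr G; apply: functional_extensionality => j /=.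
by case: (j == i).
Qed.

Lemma is_pd_pderiv n (i : 'I_n) (G G' : vec n -> R) : is_pd i G G' -> pderiv i G = G'.
Proof.
by move=> H; apply: functional_extensionality => x; apply: is_derive_unique; exact: H.
Qed.

Lemma continuous_vec (U : UniformSpace) n (f : U -> vec n) x :
  (forall i, continuous (fun y => f y i) x) -> continuous f x.
Proof.
move=> cf; apply/filterlim_locally => eps.
apply: filter_forall_ord => i.
by move: eps; apply/filterlim_locally; exact: cf.
Qed.

(* The coordinates of the curve are released one at a time, so that each step
   is the chain rule for a function of two real variables. *)
Lemma is_derive_chain n (G : vec n -> R) (DG : 'I_n -> vec n -> R)
    (c : R -> vec n) (c' : 'I_n -> R) s0 :
  (forall i, contf (DG i)) -> (forall i, is_pd i G (DG i)) ->
  (forall i, is_derive (fun s => c s i) s0 (c' i)) ->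
  is_derive (fun s => G (c s)) s0 (\sum_(i < n) (DG i (c s0) * c' i)).
Proof.
move=> cDG dG dc.
pose Phi (k : nat) s : vec n := fun i => if (i < k)%N then c s i else c s0 i.
have Phi0 k : Phi k s0 = c s0.
  by apply: functional_extensionality => i; rewrite /Phi; case: ifP.
suff main k : (k <= n)%N -> is_derive (fun s => G (Phi k s)) s0
    (\big[Rplus/0]_(i < n | (i < k)%N) (DG i (c s0) * c' i)).
  have := main n (leqnn n).
  rewrite (eq_bigl xpredT); last by move=> i; rewrite ltn_ord.
  apply: is_derive_ext => s; congr G; apply: functional_extensionality => i.
  by rewrite /Phi ltn_ord.
elim: k => [_|k IH kn].
  rewrite big_pred0 //.
  apply: (is_derive_ext (fun _ => G (c s0))); last exact: is_derive_const.
  by move=> s; congr G; apply: functional_extensionality.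
pose ik := Ordinal kn.
(* The coordinate being released is the first variable, the earlier ones move with the second;
   [Phi k.+1] is recovered on the diagonal z = c s ik. *)
pose f z s := G [eta (Phi k s) with ik |-> z].
rewrite (bigD1 ik) //=.
rewrite [X in _ + X](_ : _ = \big[Rplus/0]_(i < n | (i < k)%N) (DG i (c s0) * c' i)); last first.
  by apply: eq_bigl => i; rewrite ltnS -(inj_eq val_inj) /= [LHS]andbC -ltn_neqAle.
apply: (is_derive_ext (fun s => f (c s ik) s)).
  move=> s; congr G; apply: functional_extensionality => i; rewrite /Phi /= -(inj_eq val_inj) /= ltnS.
  case: eqP => [e|/eqP ne]; first by rewrite e leqnn; congr (c s); apply: val_inj.
  by rewrite ltn_neqAle ne.
rewrite -[X in _ + X]Rmult_1_r.
apply/is_derive_Reals.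
apply: (@derivable_pt_lim_comp_2d f (fun s => c s ik) (fun s => s)); last first.
  exact: derivable_pt_lim_id.
  by apply/is_derive_Reals; exact: dc.
apply/filterdiff_differentiable_pt_lim.
pose dfx z s := DG ik [eta (Phi k s) with ik |-> z].
have e0 : ([eta (Phi k s0) with ik |-> c s0 ik] : vec n) = c s0.
  by apply: functional_extensionality => i /=; rewrite Phi0; case: eqP => [->|].
have := @is_derive_filterdiff f (c s0 ik) s0 dfx (\big[Rplus/0]_(i < n | (i < k)%N) (DG i (c s0) * c' i)).
rewrite /dfx e0; apply.
- by apply: filter_forall => -[z s] /=; exact: is_pd_at.
- apply: is_derive_ext (IH (ltnW kn)) => s; congr G; apply: functional_extensionality => i /=.
  rewrite /Phi; case: eqP => [->|//].
  by rewrite /= ltnn.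
- apply: continuous_comp (cDG ik _).
  apply: continuous_vec => i /=; case: (i == ik); first exact: continuous_fst.
  rewrite /Phi; case: (i < k)%N; last exact: continuous_const.
  apply: (continuous_comp (fun u : R * R => u.2) (fun s => c s i)); first exact: continuous_snd.
  by apply: ex_derive_continuous; eexists; exact: dc.
Qed.

(** * Darboux's equation *)

Lemma is_derive_chain2 (F Fz Fr : R -> R -> R) (p q : R -> R) p' q' t :
  (forall z r, is_derive (fun z => F z r) z (Fz z r)) ->
  (forall z r, is_derive (fun r => F z r) r (Fr z r)) ->
  contf2 Fz -> is_derive p t p' -> is_derive q t q' ->
  is_derive (fun t => F (p t) (q t)) t (Fz (p t) (q t) * p' + Fr (p t) (q t) * q').
Proof.
move=> dz dr cz dp dq.
apply/is_derive_Reals/derivable_pt_lim_comp_2d; try by apply/is_derive_Reals.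
apply/filterdiff_differentiable_pt_lim.
apply: (@is_derive_filterdiff F (p t) (q t) Fz); first by apply: filter_forall => -[z r] /=.
  exact: dr.
exact: cz.
Qed.

(** The point with axial coordinate [z], at signed distance [r] from the axis in the direction [v].
    With [z] and [r] independent, functions of (s cos th, s sin th) can be differentiated by the
    chain rule. *)
Definition spoint d (z r : R) (v : vec d.+1) : vec d.+2 := vcons z (fun j => r * v j).

Lemma contf_spoint d (U : UniformSpace) (z r : U -> R) (v : U -> vec d.+1) :
  contf z -> contf r -> contf v -> contf (fun p => spoint (z p) (r p) (v p)).
Proof. by move=> cz cr cv; rewrite /spoint; cont. Qed.

Lemma is_derive_spoint_z d (K : vec d.+2 -> R) (DK : 'I_d.+2 -> vec d.+2 -> R) z r v :
  (forall i, is_pd i K (DK i)) ->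
  is_derive (fun z => K (spoint z r v)) z (DK ord0 (spoint z r v)).
Proof.
move=> dK; have := dK ord0 (spoint z r v); rewrite {2}/spoint /vcons unlift_none.
apply: is_derive_ext => s; congr K; apply: functional_extensionality => i /=.
rewrite /spoint /vcons; case: unliftP => [j ->|->]; last by rewrite eqxx.
by rewrite eq_sym (negbTE (neq_lift _ _)).
Qed.

Lemma is_derive_spoint_r d (K : vec d.+2 -> R) (DK : 'I_d.+2 -> vec d.+2 -> R) z r v :
  (forall i, contf (DK i)) -> (forall i, is_pd i K (DK i)) ->
  is_derive (fun r => K (spoint z r v)) r
    (\sum_(j < d.+1) (DK (lift ord0 j) (spoint z r v) * v j)).
Proof.
move=> cDK dK.
have := @is_derive_chain _ K DK (fun r => spoint z r v) (vcons 0 v) r cDK dK.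
rewrite big_ord_recl {2}/vcons unlift_none Rmult_0_r Rplus_0_l.
rewrite (eq_bigr (fun j => DK (lift ord0 j) (spoint z r v) * v j)); last first.
  by move=> j _; rewrite /vcons liftK.
apply=> i; rewrite /spoint /vcons; case: unlift => [j|]; last exact: is_deriveC.
by apply: is_derive_eq (is_deriveM (is_deriveI r) (is_deriveC (v j) r)) _; ring.
Qed.

(** Pointwise identity behind the polar induction, with c = cos th, sg = sin th, A = sin^d, B = d
    sin^(d-1), D = d. On the left is the integrand of the equation in the higher dimension, on the
    right minus the th-derivative of sin^d (- sin F_z + cos F_r); the hypothesis on Y is the
    equation of the lower dimension at r = s sin th. *)
Lemma epd_algebra s c sg A B D Fz Fr Fzz Fzr Frz Frr Y :
  c * c = 1 - sg * sg -> B * sg = D * A -> s * sg * Y = s * sg * Frr + D * Fr -> sg <> 0 ->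
  s * (A * (c * (Fzz * c + Fzr * sg) + sg * (Frz * c + Frr * sg)))
   + ((D + 1) * (A * (c * Fz + sg * Fr)) - s * (A * (Fzz + Y)))
  = - (B * c * (- sg * Fz + c * Fr)
       + A * (- c * Fz - sg * (Fzz * (s * - sg) + Fzr * (s * c))
              + (- sg * Fr + c * (Frz * (s * - sg) + Frr * (s * c))))).
Proof.
(* [hB] and [hY] carry a factor sin, hence the multiplication by [sg] before they are used. *)
move=> hc hB hY sg0; apply: (Rmult_eq_reg_r sg) => //.
have hc' : c ^ 2 = 1 - sg ^ 2 by rewrite /= !Rmult_1_r.
have e1 : B * sg * c * (- sg * Fz + c * Fr) = D * A * (- c * sg * Fz + (c * c) * Fr) by rewrite hB; ring.
apply: Rminus_diag_uniq.
transitivity (A * (s * sg * Frr * (sg ^ 2 + c ^ 2) - s * sg * Y)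
  + A * s * sg * Fzz * (c ^ 2 + sg ^ 2 - 1)
  + (D + 1) * A * sg * (c * Fz + sg * Fr) + B * sg * c * (- sg * Fz + c * Fr)
  - A * sg * (c * Fz + sg * Fr)); first ring.
rewrite e1 hY hc hc'; ring.
Qed.

Lemma contf_spoint_comp d (K : vec d.+2 -> R) (U : UniformSpace) (z r : U -> R) (v : U -> vec d.+1) :
  contf K -> contf z -> contf r -> contf v -> contf (fun p => K (spoint (z p) (r p) (v p))).
Proof. by move=> cK cz cr cv; apply: (contf_comp cK); exact: contf_spoint. Qed.

Ltac conts := try unfold contf2; cont; try (apply: contf_spoint_comp; [by auto|cont|cont|cont]).

(** At r = 0 the two points of S^0 give the same [spoint], and the weight [v j] has opposite signs
    there. This supplies the boundary values of the polar identity when the factor sin^d is 1. *)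
Lemma sphere0_odd d (K : 'I_d.+1 -> vec d.+2 -> R) z : d = 0%N ->
  sphere_int (fun v : vec d.+1 => \sum_(j < d.+1) (K j (spoint z 0 v) * v j)) = 0.
Proof.
move=> d0; subst d; rewrite /= !big_ord_recl !big_ord0.
have -> : spoint z 0 (fun _ : 'I_1 => -1) = spoint z 0 (fun _ => 1).
  by apply: functional_extensionality => i; rewrite /spoint /vcons; case: unlift => [j|//]; ring.
ring.
Qed.

(* Polar coordinates (z, r) = (s cos th, s sin th): by induction the spherical
   mean F of the slices solves F_rr + (d / r) F_r = (mean of the slice Laplacian),
   and the integrand of the identity becomes the derivative in th of
   sin^d (- sin F_z + cos F_r), which vanishes at both ends. *)
Lemma sphere_int_darboux d (G : vec d.+1 -> R) (DG : 'I_d.+1 -> vec d.+1 -> R)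
    (DDG : 'I_d.+1 -> 'I_d.+1 -> vec d.+1 -> R) (S1 S2 : R -> R) s :
  contf G -> (forall i, contf (DG i)) -> (forall i j, contf (DDG i j)) ->
  (forall i, is_pd i G (DG i)) -> (forall i j, is_pd j (DG i) (DDG i j)) ->
  (forall s, is_derive (fun s => sphere_int (fun w => G (fun i => s * w i))) s (S1 s)) ->
  (forall s, is_derive S1 s (S2 s)) ->
  s * S2 s + INR d * S1 s =
  s * sphere_int (fun w => \sum_(i < d.+1) DDG i i (fun k => s * w k)).
Proof.
elim: d G DG DDG S1 S2 s => [|d IH] G DG DDG S1 S2 s cG cDG cDDG dG dDG dS dS1.
  (* On S^0 the integral is a sum over the two points e = 1 and e = -1, and the coefficient [INR 0]
     removes the first-order term. *)
  have ch (e s0 : R) (K : vec 1 -> R) (DK : 'I_1 -> vec 1 -> R) :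
      (forall i, contf (DK i)) -> (forall i, is_pd i K (DK i)) ->
      is_derive (fun s => K (fun i => s * e)) s0 (DK ord0 (fun i => s0 * e) * e).
    move=> cDK dK.
    have := @is_derive_chain _ K DK (fun s => fun i => s * e) (fun _ => e) s0 cDK dK.
    rewrite big_ord_recl big_ord0 Rplus_0_r; apply => i.
    by apply: is_derive_eq (is_deriveM (is_deriveI s0) (is_deriveC e s0)) _; ring.
  have e1 : S1 = fun s => DG ord0 (fun i => s * 1) * 1 + DG ord0 (fun i => s * -1) * -1.
    apply: functional_extensionality => s0; rewrite -(is_derive_unique _ _ _ (dS s0)).
    by apply: is_derive_unique; apply: is_deriveD; apply: ch.
  have e2 : S2 s = DDG ord0 ord0 (fun i => s * 1) + DDG ord0 ord0 (fun i => s * -1).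
    rewrite -(is_derive_unique _ _ _ (dS1 s)) e1; apply: is_derive_unique.
    apply: is_derive_eq; first apply: is_deriveD.
    - apply: is_deriveM (is_deriveC _ _).
      exact: (ch _ _ (DG ord0) (DDG ord0)).
    - apply: is_deriveM (is_deriveC _ _).
      exact: (ch _ _ (DG ord0) (DDG ord0)).
    cbv beta; ring.
  by rewrite e2 /= !big_ord_recl !big_ord0; ring.
pose F z r := sphere_int (fun v => G (@spoint d z r v)).
pose Fz z r := sphere_int (fun v => DG ord0 (@spoint d z r v)).
pose Fr z r := sphere_int (fun v => \sum_(j < d.+1) (DG (lift ord0 j) (@spoint d z r v) * v j)).
pose Fzz z r := sphere_int (fun v => DDG ord0 ord0 (@spoint d z r v)).
pose Fzr z r := sphere_int (fun v => \sum_(j < d.+1) (DDG ord0 (lift ord0 j) (@spoint d z r v) * v j)).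
pose Frz z r := sphere_int (fun v => \sum_(j < d.+1) (DDG (lift ord0 j) ord0 (@spoint d z r v) * v j)).
pose Frr z r := sphere_int (fun v => \sum_(j < d.+1) ((\sum_(k < d.+1) (DDG (lift ord0 j) (lift ord0 k) (@spoint d z r v) * v k)) * v j)).
have cF : contf2 F by apply: (contf_sphere_int (H := fun p v => G (spoint p.1 p.2 v))); conts.
have cFz : contf2 Fz by apply: (contf_sphere_int (H := fun p v => DG ord0 (spoint p.1 p.2 v))); conts.
have cFr : contf2 Fr.
  by apply: (contf_sphere_int (H := fun p v => \sum_(j < d.+1) (DG (lift ord0 j) (@spoint d p.1 p.2 v) * v j))); conts.
have cFzz : contf2 Fzz by apply: (contf_sphere_int (H := fun p v => DDG ord0 ord0 (spoint p.1 p.2 v))); conts.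
have cFzr : contf2 Fzr.
  by apply: (contf_sphere_int (H := fun p v => \sum_(j < d.+1) (DDG ord0 (lift ord0 j) (@spoint d p.1 p.2 v) * v j))); conts.
have cFrz : contf2 Frz.
  by apply: (contf_sphere_int (H := fun p v => \sum_(j < d.+1) (DDG (lift ord0 j) ord0 (@spoint d p.1 p.2 v) * v j))); conts.
have cFrr : contf2 Frr.
  by apply: (contf_sphere_int (H := fun p v => \sum_(j < d.+1) ((\sum_(k < d.+1) (DDG (lift ord0 j) (lift ord0 k) (@spoint d p.1 p.2 v) * v k)) * v j))); conts.
have dF_z z0 r : is_derive (fun z => F z r) z0 (Fz z0 r).
  apply: (is_derive_sphere_int (H := fun z v => G (spoint z r v)) (H' := fun z v => DG ord0 (spoint z r v))); [|by conts|by conts].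
  by move=> *; exact: is_derive_spoint_z.
have dF_r z r0 : is_derive (fun r => F z r) r0 (Fr z r0).
  apply: (is_derive_sphere_int (H := fun r v => G (spoint z r v))
   (H' := fun r v => \sum_(j < d.+1) (DG (lift ord0 j) (@spoint d z r v) * v j))); [|by conts|by conts].
  by move=> *; exact: is_derive_spoint_r.
have dFz_z z0 r : is_derive (fun z => Fz z r) z0 (Fzz z0 r).
  apply: (is_derive_sphere_int (H := fun z v => DG ord0 (spoint z r v)) (H' := fun z v => DDG ord0 ord0 (spoint z r v))); [|by conts|by conts].
  by move=> *; exact: (is_derive_spoint_z (DK := DDG ord0)).
have dFz_r z r0 : is_derive (fun r => Fz z r) r0 (Fzr z r0).
  apply: (is_derive_sphere_int (H := fun r v => DG ord0 (spoint z r v))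
   (H' := fun r v => \sum_(j < d.+1) (DDG ord0 (lift ord0 j) (@spoint d z r v) * v j))); [|by conts|by conts].
  by move=> *; exact: (is_derive_spoint_r (DK := DDG ord0)).
have dFr_z z0 r : is_derive (fun z => Fr z r) z0 (Frz z0 r).
  apply: (is_derive_sphere_int (H := fun z v => \sum_(j < d.+1) (DG (lift ord0 j) (@spoint d z r v) * v j))
   (H' := fun z v => \sum_(j < d.+1) (DDG (lift ord0 j) ord0 (@spoint d z r v) * v j))); [|by conts|by conts].
  move=> t0 v; apply: is_derive_sum => j.
  apply: is_derive_eq (is_deriveM _ (is_deriveC _ _)) _.
    exact: (is_derive_spoint_z (DK := DDG (lift ord0 j))).
  by ring.
have dFr_r z r0 : is_derive (fun r => Fr z r) r0 (Frr z r0).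
  apply: (is_derive_sphere_int (H := fun r v => \sum_(j < d.+1) (DG (lift ord0 j) (@spoint d z r v) * v j))
   (H' := fun r v => \sum_(j < d.+1) ((\sum_(k < d.+1) (DDG (lift ord0 j) (lift ord0 k) (@spoint d z r v) * v k)) * v j))); [|by conts|by conts].
  move=> t0 v; apply: is_derive_sum => j.
  apply: is_derive_eq (is_deriveM _ (is_deriveC _ _)) _.
    exact: (is_derive_spoint_r (DK := DDG (lift ord0 j))).
  by ring.
pose Y z r := sphere_int (fun v => \sum_(j < d.+1) DDG (lift ord0 j) (lift ord0 j) (@spoint d z r v)).
have cY : contf2 Y.
  by apply: (contf_sphere_int (H := fun p v => \sum_(j < d.+1) DDG (lift ord0 j) (lift ord0 j) (@spoint d p.1 p.2 v))); conts.
have slice_pd z j (K K' : vec d.+2 -> R) : is_pd (lift ord0 j) K K' ->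
    is_pd j (fun y : vec d.+1 => K (vcons z y)) (fun y => K' (vcons z y)).
  move=> dK y; have := dK (vcons z y); rewrite {2}/vcons liftK.
  apply: is_derive_ext => t; congr K; apply: functional_extensionality => i /=.
  rewrite /vcons; case: unliftP => [k ->|->]; first by rewrite (inj_eq lift_inj).
  by rewrite (negbTE (neq_lift _ _)).
have FY z r : r * Frr z r + INR d * Fr z r = r * Y z r.
  apply: (IH (fun y => G (vcons z y)) (fun j y => DG (lift ord0 j) (vcons z y))
    (fun j k y => DDG (lift ord0 j) (lift ord0 k) (vcons z y)) (Fr z) (Frr z) r) => //.
  - by apply: (contf_comp cG); cont.
  - by move=> i; apply: (contf_comp (cDG _)); cont.
  - by move=> i j; apply: (contf_comp (cDDG _ _)); cont.
  - by move=> i; apply: slice_pd.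
  - by move=> i j; apply: slice_pd.
  - by move=> r0; exact: dF_r.
have scal_sph t th (v : vec d.+1) :
    (fun i => t * vcons (cos th) (fun j => sin th * v j) i) = spoint (t * cos th) (t * sin th) v.
  apply: functional_extensionality => i; rewrite /spoint /vcons.
  by case: unlift => [j|//]; ring.
have polar_s (K Kz Kr : R -> R -> R) t th : contf2 Kz ->
    (forall z r, is_derive (fun z => K z r) z (Kz z r)) ->
    (forall z r, is_derive (fun r => K z r) r (Kr z r)) ->
    is_derive (fun t => K (t * cos th) (t * sin th)) t
     (Kz (t * cos th) (t * sin th) * cos th + Kr (t * cos th) (t * sin th) * sin th).
  move=> cK dz dr; apply: (is_derive_chain2 dz dr) => //.
    by apply: is_derive_eq (is_deriveM (is_deriveI t) (is_deriveC _ t)) _; ring.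
  by apply: is_derive_eq (is_deriveM (is_deriveI t) (is_deriveC _ t)) _; ring.
have polar_th (K Kz Kr : R -> R -> R) t th : contf2 Kz ->
    (forall z r, is_derive (fun z => K z r) z (Kz z r)) ->
    (forall z r, is_derive (fun r => K z r) r (Kr z r)) ->
    is_derive (fun th => K (t * cos th) (t * sin th)) th
     (Kz (t * cos th) (t * sin th) * (t * - sin th) + Kr (t * cos th) (t * sin th) * (t * cos th)).
  move=> cK dz dr; apply: (is_derive_chain2 dz dr) => //.
    by apply: is_derive_scal; apply: is_derive_cos.
  by apply: is_derive_scal; apply: is_derive_sin.
have cpol (K : R -> R -> R) (U : UniformSpace) (t th : U -> R) : contf2 K -> contf t -> contf th ->
    contf (fun p => K (t p * cos (th p)) (t p * sin (th p))).
  by move=> cK ct cth; apply: (contf2_comp cK); cont.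
pose T1 t th := sin th ^ d * (cos th * Fz (t * cos th) (t * sin th) + sin th * Fr (t * cos th) (t * sin th)).
pose T2 t th := sin th ^ d *
  (cos th * (Fzz (t * cos th) (t * sin th) * cos th + Fzr (t * cos th) (t * sin th) * sin th)
   + sin th * (Frz (t * cos th) (t * sin th) * cos th + Frr (t * cos th) (t * sin th) * sin th)).
have cT1 : contf2 T1 by rewrite /contf2 /T1; cont; apply: cpol; cont.
have cT2 : contf2 T2 by rewrite /contf2 /T2; cont; apply: cpol; cont.
(* [S1] and [S2] are known only as derivatives; uniqueness identifies them with the integrals
   obtained by differentiating under the integral sign in polar coordinates. *)
have e1 : S1 = fun t => RInt (T1 t) 0 PI.
  apply: functional_extensionality => t; rewrite -(is_derive_unique _ _ _ (dS t)).
  apply: is_derive_unique.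
  apply: (is_derive_ext (fun t => RInt (fun th => sin th ^ d * F (t * cos th) (t * sin th)) 0 PI)).
    move=> t0; apply: RInt_congr => th; congr (_ * _); congr sphere_int.
    by apply: functional_extensionality => v; rewrite scal_sph.
  apply: (is_derive_RInt_under (F := fun t th => sin th ^ d * F (t * cos th) (t * sin th))) cT1.
    move=> t0 th; apply: is_derive_scal.
    by apply: is_derive_eq (polar_s _ _ _ _ _ cFz dF_z dF_r) _; ring.
  by move=> t0; apply: contf_mult; [cont|apply: cpol; cont].
have e2 : S2 s = RInt (T2 s) 0 PI.
  rewrite -(is_derive_unique _ _ _ (dS1 s)) e1; apply: is_derive_unique.
  apply: (is_derive_RInt_under (F := T1)) cT2.
    move=> t0 th; apply: is_derive_scal.
    apply: is_deriveD; apply: is_derive_scal.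
      exact: (polar_s _ _ _ _ _ cFzz dFz_z dFz_r).
    exact: (polar_s _ _ _ _ _ cFrz dFr_z dFr_r).
  by move=> t0; apply: (contf_slice (F := T1)).
pose X th := sin th ^ d * (Fzz (s * cos th) (s * sin th) + Y (s * cos th) (s * sin th)).
have cX : contf X by rewrite /X; cont; apply: cpol; cont.
have e3 : sphere_int (fun w => \sum_(i < d.+2) DDG i i (fun k => s * w k)) = RInt X 0 PI.
  apply: RInt_congr => th; congr (_ * _); rewrite -sphere_int_D; last 2 first.
  - by conts.
  - by conts.
  congr sphere_int; apply: functional_extensionality => v.
  by rewrite big_ord_recl /= scal_sph.
pose Psi th := sin th ^ d * (- sin th * Fz (s * cos th) (s * sin th) + cos th * Fr (s * cos th) (s * sin th)).
pose Psi' th := (INR d * cos th * sin th ^ d.-1)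
   * (- sin th * Fz (s * cos th) (s * sin th) + cos th * Fr (s * cos th) (s * sin th))
  + sin th ^ d * (- cos th * Fz (s * cos th) (s * sin th)
     + - sin th * (Fzz (s * cos th) (s * sin th) * (s * - sin th) + Fzr (s * cos th) (s * sin th) * (s * cos th))
     + (- sin th * Fr (s * cos th) (s * sin th)
     + cos th * (Frz (s * cos th) (s * sin th) * (s * - sin th) + Frr (s * cos th) (s * sin th) * (s * cos th)))).
have dPsi th : is_derive Psi th (Psi' th).
  apply: is_deriveM.
    by apply: is_derive_pow; apply: is_derive_sin.
  apply: is_deriveD; apply: is_deriveM.
  - by apply: (@is_derive_opp R_AbsRing R_NormedModule); apply: is_derive_sin.
  - exact: (polar_th _ _ _ _ _ cFzz dFz_z dFz_r).
  - exact: is_derive_cos.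
  - exact: (polar_th _ _ _ _ _ cFrz dFr_z dFr_r).
have cPsi' : contf Psi' by rewrite /Psi'; cont; apply: cpol; cont.
have iPsi : RInt Psi' 0 PI = 0.
  have := @is_RInt_derive R_CompleteNormedModule Psi Psi' 0 PI (fun x _ => dPsi x) (fun x _ => cPsi' x).
  move/(@is_RInt_unique R_CompleteNormedModule) ->.
  change (Psi PI - Psi 0 = 0).
  rewrite /Psi sin_0 sin_PI cos_0 cos_PI.
  (* For d > 0 the factor sin^d vanishes at both poles; for d = 0 it is 1, and [Fr] itself vanishes
     at r = 0 by oddness. *)
  rewrite !Rmult_0_r; case: (posnP d) => [d0|dpos]; last first.
    have d0 : d <> 0%N by move=> e; rewrite e in dpos.
    by rewrite !(pow_ne_zero _ d0); ring.
  have Fr0 z : Fr z 0 = 0 by exact: (@sphere0_odd d (fun j => DG (lift ord0 j))).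
  by rewrite !Fr0; ring.
have INRd : INR d.+1 = INR d + 1 by exact: S_INR.
have key : s * S2 s + (INR d.+1 * S1 s - s * RInt X 0 PI) = 0.
  have -> : s * S2 s + (INR d.+1 * S1 s - s * RInt X 0 PI) = - RInt Psi' 0 PI; last by rewrite iPsi; ring.
  have c1 : contf (T1 s) by apply: contf_slice.
  have c2 : contf (T2 s) by apply: contf_slice.
  have -> : - RInt Psi' 0 PI = -1 * RInt Psi' 0 PI by ring.
  rewrite e2 e1 -!RIntZ // -RIntB; [|by cont|by cont]. rewrite -RIntD; [|by cont|by cont].
  (* The integrands are compared on the open interval, where sin th > 0 and [epd_algebra]
     applies. *)
  apply: RInt_congr_in => [|th th0 thpi]; first by have := PI_RGT_0; lra.
  have sth : 0 < sin th by exact: sin_gt_0.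
  rewrite /T1 /T2 /X INRd.
  have := @epd_algebra s (cos th) (sin th) (sin th ^ d) (INR d * sin th ^ d.-1) (INR d)
    (Fz (s * cos th) (s * sin th)) (Fr (s * cos th) (s * sin th)) (Fzz (s * cos th) (s * sin th))
    (Fzr (s * cos th) (s * sin th)) (Frz (s * cos th) (s * sin th)) (Frr (s * cos th) (s * sin th))
    (Y (s * cos th) (s * sin th)).
  move=> H; rewrite H {H}.
  - by rewrite /Psi'; ring.
  - by have := sin2_cos2 th; rewrite /Rsqr; lra.
  - by case: (d) => [|d'] /=; ring.
  - by rewrite -FY.
  - lra.
by rewrite e3; lra.
Qed.

(** * Spherical means and the operator I *)

Lemma dfactSM n : (dfact n.+1 * dfact n)%N = (n.+1)`!.
Proof.
elim: n => [//|n IH]; rewrite factS -IH.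
by rewrite (_ : dfact n.+2 = n.+2 * dfact n)%N // -mulnA [(dfact n * _)%N]mulnC.
Qed.

Lemma dfact_even k : dfact (2 * k) = (2 ^ k * k`!)%N.
Proof.
elim: k => [//|k IH].
rewrite mulnS (_ : dfact (2 + 2 * k) = (2 + 2 * k) * dfact (2 * k))%N // IH expnS factS -mulnS.
by rewrite -!mulnA; congr muln; rewrite mulnCA.
Qed.

Lemma INR_mul m n : INR (m * n)%N = INR m * INR n. Proof. exact: mult_INR. Qed.
Lemma INR_add m n : INR (m + n)%N = INR m + INR n. Proof. exact: plus_INR. Qed.

Lemma INR_gt0 n : (0 < n)%N -> 0 < INR n.
Proof. by move=> /ltP; exact: lt_0_INR. Qed.

Lemma fact_neq0R n : INR n`! <> 0.
Proof. by have := INR_gt0 (fact_gt0 n); lra. Qed.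

Lemma dfact_neq0R n : INR (dfact n) <> 0.
Proof.
move=> e; apply: (@fact_neq0R n.+1); by rewrite -dfactSM INR_mul e Rmult_0_r.
Qed.

Definition wallis k := RInt (fun th => sin th ^ k) 0 PI.

Lemma contf_sinX k : contf (fun th => sin th ^ k).
Proof. by cont. Qed.

(** Integrate the derivative of sin^(k+1) cos, which vanishes at both ends. *)
Lemma wallisSS k : INR k.+2 * wallis k.+2 = INR k.+1 * wallis k.
Proof.
have i2 : INR k.+2 = INR k.+1 + 1 by exact: S_INR.
pose Psi' th := INR k.+1 * sin th ^ k - INR k.+2 * sin th ^ k.+2.
have dPsi th : is_derive (fun th => sin th ^ k.+1 * cos th) th (Psi' th).
  apply: is_derive_eq; first apply: is_deriveM.
  - by apply: is_derive_pow; apply: is_derive_sin.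
  - exact: is_derive_cos.
  have e : cos th * cos th = 1 - sin th * sin th by have := sin2_cos2 th; rewrite /Rsqr; lra.
  rewrite /Psi' i2 [k.+1.-1]/=.
  transitivity (INR k.+1 * sin th ^ k * (cos th * cos th) - sin th ^ k.+1 * sin th); first ring.
  by rewrite e /=; ring.
have cPsi' : contf Psi' by rewrite /Psi'; cont.
have := @is_RInt_derive R_CompleteNormedModule _ Psi' 0 PI (fun x _ => dPsi x) (fun x _ => cPsi' x).
move/(@is_RInt_unique R_CompleteNormedModule).
have -> : RInt Psi' 0 PI = INR k.+1 * wallis k - INR k.+2 * wallis k.+2.
  by rewrite /Psi' RIntB ?RIntZ //; try exact: contf_sinX; apply: contf_mult; cont.
rewrite (_ : minus _ _ = 0); first lra.
by change (sin PI ^ k.+1 * cos PI - sin 0 ^ k.+1 * cos 0 = 0); rewrite sin_PI sin_0 /=; ring.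
Qed.

(** By [wallisSS] the left side does not depend on k, and for k = 0 it is 2 times PI. *)
Lemma wallisM k : INR k.+1 * (wallis k.+1 * wallis k) = 2 * PI.
Proof.
elim: k => [|k <-]; last first.
  transitivity ((INR k.+2 * wallis k.+2) * wallis k.+1); first ring.
  by rewrite wallisSS; ring.
have -> : wallis 0 = PI.
  rewrite /wallis (RInt_congr (g := fun _ => 1)) // RInt_const /scal /= /mult /=; ring.
have -> : wallis 1 = 2.
  rewrite /wallis (RInt_congr (g := sin)); last by move=> x; rewrite /=; ring.
  have := @is_RInt_derive R_CompleteNormedModule (fun x => - cos x) sin 0 PI.
  move=> /(_ _ _)/is_RInt_unique ->.
  - by change (- cos PI - - cos 0 = 2); rewrite cos_PI cos_0; ring.
  - move=> x _; apply: is_derive_eq; first apply: (@is_derive_opp R_AbsRing R_NormedModule); first exact: is_derive_cos.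
    exact: Ropp_involutive.
  - by move=> x _; exact: continuous_sin.
rewrite /=; ring.
Qed.

Lemma sphere_int_constS d c : sphere_int (fun _ : vec d.+2 => c) = wallis d * sphere_int (fun _ : vec d.+1 => c).
Proof.
rewrite [LHS]/= Rmult_comm -RIntZ; last exact: contf_sinX.
by apply: RInt_congr => th; ring.
Qed.

(** Passing from S^d to S^(d+2) multiplies the area by two consecutive Wallis integrals, that is by
    2 PI / (d + 1); starting from the two points of S^0, the denominators 1, 3, ..., 2 nu + 1
    collect into the double factorial. *)
Lemma sphere_int_const_even nu c :
  sphere_int (fun _ : vec (2 * nu).+3 => c) = 2 * (2 * PI) ^ nu.+1 / INR (dfact (2 * nu).+1) * c.
Proof.
have e d : sphere_int (fun _ : vec d.+3 => c) = 2 * PI / INR d.+1 * sphere_int (fun _ : vec d.+1 => c).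
  rewrite !sphere_int_constS -(wallisM d); field.
  by have := INR_gt0 (ltn0Sn d); lra.
elim: nu => [|nu IH].
  by rewrite (e 0%N) /=; field.
rewrite mulnS add2n e IH.
have -> : dfact (2 * nu).+3 = ((2 * nu).+3 * dfact (2 * nu).+1)%N by [].
rewrite INR_mul -[_ ^ nu.+2]/(2 * PI * (2 * PI) ^ nu.+1); field; split; first exact: dfact_neq0R.
by have := INR_gt0 (ltn0Sn (2 * nu).+2); lra.
Qed.

Definition int0 (h : R -> R) (s : R) := RInt h 0 s.

Lemma contf_int0 h : contf h -> contf (int0 h).
Proof. by move=> ch; apply: is_derive_contf (fun s => is_derive_RInt0 s ch). Qed.

Lemma is_derive_int0 h s : contf h -> is_derive (int0 h) s (h s).
Proof. exact: is_derive_RInt0. Qed.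

Lemma int0_0 h : int0 h 0 = 0. Proof. exact: (@RInt_point R_CompleteNormedModule). Qed.

Lemma contf_Iop h : contf h -> contf (Iop h).
Proof. by move=> ch; apply: contf_int0; cont. Qed.

Lemma contf_iter_Iop k h : contf h -> contf (iter k Iop h).
Proof. by move=> ch; elim: k => [//|k IH] /=; exact: contf_Iop. Qed.

Lemma iter_IopD k f g : contf f -> contf g ->
  iter k Iop (fun s => f s + g s) = fun s => iter k Iop f s + iter k Iop g s.
Proof.
move=> cf cg; elim: k => [//|k IH] /=; rewrite IH.
apply: functional_extensionality => s; rewrite /Iop -RIntD.
- by apply: RInt_congr => r; ring.
- by cont; exact: contf_iter_Iop.
- by cont; exact: contf_iter_Iop.
Qed.

Lemma iter_Iop_const k c s : iter k Iop (fun _ => c) s = c * s ^ (2 * k) / INR (dfact (2 * k)).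
Proof.
elim: k s => [|k IH] s; first by rewrite /=; field.
rewrite /= -/(iter k Iop).
apply: (eq_of_is_derive (f := Iop (iter k Iop (fun _ => c)))
  (h := fun r => iter k Iop (fun _ => c) r * r)
  (g := fun s => c * s ^ (2 * k.+1) / INR (dfact (2 * k.+1)))) => [t|t|].
- by apply: is_derive_int0; cont; apply: contf_iter_Iop; cont.
- rewrite IH; apply: (is_derive_extR (f := fun s => (c / INR (dfact (2 * k.+1))) * s ^ (2 * k.+1))).
    by move=> r; rewrite /Rdiv; ring.
  apply: is_derive_eq; first by apply: is_derive_scal; apply: is_derive_pow; apply: is_deriveI.
  rewrite mulnS add2n (_ : dfact (2 * k).+2 = ((2 * k).+2 * dfact (2 * k)))%N // INR_mul.
  rewrite -pred_Sn; change (t ^ (2 * k).+1) with (t * t ^ (2 * k)); field; split; first exact: dfact_neq0R.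
  by have := INR_gt0 (ltn0Sn (2 * k).+1); lra.
- by rewrite /Iop -/(int0 _ 0) int0_0 mulnS /=; rewrite /Rdiv !Rmult_0_l Rmult_0_r Rmult_0_l.
Qed.

(** The equation h'' + (c / s) h' = r multiplied by s, which keeps it meaningful at s = 0 and for
    negative s. *)
Definition Darboux c h r := exists h1 h2 : R -> R,
  [/\ forall s, is_derive h s (h1 s), forall s, is_derive h1 s (h2 s)
    & forall s : R, s * h2 s + c * h1 s = s * r s].

(** With H = I h one has H' = s h and H'' = s h' + h, while the derivative of s h' + (1 + c) h is s
    h'' + (c + 2) h' = s r. The condition h(0) = 0 makes the integration constant vanish. *)
Lemma Darboux_Iop c h r : contf r -> h 0 = 0 -> Darboux (c + 2) h r -> Darboux c (Iop h) (Iop r).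
Proof.
move=> cr h0 [h1 [h2 [d1 d2 e]]].
have ch : contf h by exact: is_derive_contf d1.
exists (fun s => h s * s), (fun s => h1 s * s + h s); split.
- by move=> s; apply: is_derive_int0; cont.
- by move=> s; apply: is_derive_eq (is_deriveM (d1 s) (is_deriveI s)) _; ring.
have main : forall s, h1 s * s + (1 + c) * h s = Iop r s.
  apply: (eq_of_is_derive (h := fun s => r s * s)).
  - move=> s; apply: is_derive_eq.
      apply: is_deriveD; first exact: is_deriveM (d2 s) (is_deriveI s).
      by apply: is_derive_scal; exact: d1.
    rewrite [r s * s]Rmult_comm -e; ring.
  - by move=> s; apply: is_derive_int0; cont.
  - by rewrite /Iop -/(int0 _ 0) int0_0 h0; ring.
by move=> s; rewrite -main; ring.
Qed.

(** After k applications of [Iop] the coefficient is 2, and s h'' + 2 h' is the second derivative of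
    s h, so the equation can be integrated twice. *)
Lemma Darboux_iter_Iop k h r s : contf r -> h 0 = 0 -> Darboux (2 * INR k + 2) h r ->
  s * iter k Iop h s = int0 (int0 (fun q => q * iter k Iop r q)) s.
Proof.
elim: k h r => [|k IH] h r cr h0 H.
  case: H => h1 [h2 [d1 d2 e]].
  apply: (eq_of_is_derive (h := int0 (fun q => q * r q)) (f := fun s => s * h s)) => [t|t|].
  - apply: is_derive_eq (is_deriveM (is_deriveI t) (d1 t)) _.
    apply: (eq_of_is_derive (h := fun q => q * r q)(f := fun t => 1 * h t + t * h1 t)) => [q|q|].
    + apply: is_derive_eq.
        apply: is_deriveD (is_derive_scal _ _ _ _ (d1 q)) (is_deriveM (is_deriveI q) (d2 q)).
      rewrite -e /=; ring.
    + by apply: is_derive_int0; cont.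
    + by rewrite int0_0 h0; ring.
  - by apply: is_derive_int0; apply: contf_int0; cont.
  - by rewrite int0_0; ring.
rewrite iterSr (IH _ (Iop r)).
- by rewrite -iterSr.
- exact: contf_Iop.
- exact: int0_0.
apply: Darboux_Iop => //.
by move: H; rewrite S_INR; congr Darboux; ring.
Qed.

Section Mean.
Variables (nu : nat) (a : R) (g : vec (2 * nu).+3 -> R) (Dg : 'I_(2 * nu).+3 -> vec (2 * nu).+3 -> R)
  (DDg : 'I_(2 * nu).+3 -> 'I_(2 * nu).+3 -> vec (2 * nu).+3 -> R) (x : vec (2 * nu).+3).
Hypotheses (cg : contf g) (cDg : forall i, contf (Dg i)) (cDDg : forall i j, contf (DDg i j))
  (dg : forall i, is_pd i g (Dg i)) (dDg : forall i j, is_pd j (Dg i) (DDg i j)).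

Let Lg := fun y => a ^ 2 * \sum_(i < (2 * nu).+3) DDg i i y.

Lemma contf_affine (U : UniformSpace) (K : vec (2 * nu).+3 -> R) (b : R) (s : U -> R) (w : U -> vec (2 * nu).+3) :
  contf K -> contf s -> contf w -> contf (fun p => K (fun i => x i + b * s p * w p i)).
Proof.
move=> cK cs cw; apply: (contf_comp cK); apply: contf_vec => i; cont.
Qed.

Lemma is_pd_affine (K : vec (2 * nu).+3 -> R) DK j : (forall i, contf (DK i)) ->
  (forall i, is_pd i K (DK i)) ->
  is_pd j (fun y => K (fun i => x i + a * y i)) (fun y => a * DK j (fun i => x i + a * y i)).
Proof.
move=> cDK dK y.
have := @is_derive_chain _ K DK (fun s => fun i => x i + a * [eta y with j |-> s] i)
   (fun i => a * (if i == j then 1 else 0)) (y j) cDK dK.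
rewrite (bigD1 j) //= big1; last by move=> i /negbTE ->; ring.
rewrite eqxx Rplus_0_r => /(_ _) H.
apply: is_derive_eq; first apply: H.
  move=> i; case: eqP => _ /=.
    apply: is_derive_eq; first apply: is_deriveD (is_deriveC _ _) (is_derive_scal _ _ _ _ (is_deriveI _)).
    by ring.
  by apply: is_derive_eq; first exact: is_deriveC; ring.
rewrite Rmult_1_r Rmult_comm; congr (_ * DK j _).
by apply: functional_extensionality => i; case: eqP => [->|].
Qed.

(** [sphere_int_darboux] in dimension 2 nu + 3, applied to y -> g(x + a y), whose Laplacian is L g
    at x + a y; this covers a of either sign and a = 0. *)
Lemma Darboux_Amean : Darboux (2 * INR nu + 2) (fun s => Amean a s g x) (fun s => Amean a s Lg x).
Proof.
pose G y := g (fun i => x i + a * y i).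
pose DG j y := a * Dg j (fun i => x i + a * y i).
pose DDG i j y := a * (a * DDg i j (fun k => x k + a * y k)).
have caff (K : vec (2 * nu).+3 -> R) : contf K -> contf (fun y : vec (2 * nu).+3 => K (fun i => x i + a * y i)).
  by move=> cK; apply: (contf_comp cK); apply: contf_vec => i; cont.
have cG : contf G by exact: caff.
have cDG i : contf (DG i) by apply: contf_mult; [cont|exact: caff].
have cDDG i j : contf (DDG i j) by apply: contf_mult; [cont|apply: contf_mult; [cont|exact: caff]].
have dG i : is_pd i G (DG i) by apply: is_pd_affine.
have dDG i j : is_pd j (DG i) (DDG i j).
  by move=> y; apply: is_derive_scal; apply: (is_pd_affine (DK := DDg i)).
pose c := / (2 * (2 * PI) ^ nu.+1).
have csph (K : vec (2 * nu).+3 -> R) : contf K ->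
    contf2 (fun (s : R) (w : vec (2 * nu).+3) => K (fun i => s * w i)).
  by move=> cK; apply: (contf_comp cK); cont.
have dsph (K : vec (2 * nu).+3 -> R) DK : contf K -> (forall i, contf (DK i)) -> (forall i, is_pd i K (DK i)) ->
   forall s w, is_derive (fun s => K (fun i => s * w i)) s (\sum_(i < (2 * nu).+3) (DK i (fun i => s * w i) * w i)).
  move=> cK cDK dK s w; apply: (is_derive_chain (c := fun s i => s * w i)) => // i.
  by apply: is_derive_eq (is_deriveM (is_deriveI s) (is_deriveC _ _)) _; ring.
pose S1 s := sphere_int (fun w => \sum_(i < (2 * nu).+3) (DG i (fun i => s * w i) * w i)).
pose S2 s := sphere_int (fun w => \sum_(j < (2 * nu).+3) ((\sum_(i < (2 * nu).+3) (DDG j i (fun i => s * w i) * w i)) * w j)).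
have cS1 : contf2 (fun (s : R) w => \sum_(i < (2 * nu).+3) (DG i (fun i => s * w i) * w i)).
  by apply: contf_sum => i; apply: contf_mult; [exact: csph (cDG i)|cont].
have cS2 : contf2 (fun (s : R) w => \sum_(j < (2 * nu).+3) ((\sum_(i < (2 * nu).+3) (DDG j i (fun i => s * w i) * w i)) * w j)).
  by apply: contf_sum => j; apply: contf_mult; [apply: contf_sum => i; apply: contf_mult; [exact: csph (cDDG j i)|cont]|cont].
have d1 s : is_derive (fun s => sphere_int (fun w => G (fun i => s * w i))) s (S1 s).
  apply: (is_derive_sphere_int (H := fun s w => G (fun i => s * w i))) cS1; last exact: csph.
  by move=> r w; apply: dsph.
have d2 s : is_derive S1 s (S2 s).
  apply: (is_derive_sphere_int (H := fun (s : R) w => \sum_(i < (2 * nu).+3) (DG i (fun i => s * w i) * w i))) cS2 => // r w.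
  apply: is_derive_sum => i.
  apply: is_derive_eq (is_deriveM (dsph _ (DDG i) _ _ _ r w) (is_deriveC _ _)) _ => //.
  by ring.
have e s := sphere_int_darboux s cG cDG cDDG dG dDG d1 d2.
have AG (K : vec (2 * nu).+3 -> R) s : Amean a s K x = c * sphere_int (fun w => K (fun i => x i + a * (s * w i))).
  rewrite /Amean -/c; congr (_ * sphere_int _); apply: functional_extensionality => w; congr K.
  by apply: functional_extensionality => i; ring.
exists (fun s => c * S1 s), (fun s => c * S2 s); split.
- by move=> s; apply: (is_derive_extR (fun s => esym (AG g s))); apply: is_derive_scal.
- by move=> s; apply: is_derive_scal.
move=> s; rewrite AG.
transitivity (c * (s * S2 s + INR (2 * nu).+2 * S1 s)).
  by rewrite !S_INR INR_mul; rewrite [INR 2]/=; ring.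
rewrite e -Rmult_assoc [c * s]Rmult_comm Rmult_assoc; congr (_ * (_ * sphere_int _)).
apply: functional_extensionality => w; rewrite /Lg (big_morph (fun y => a ^ 2 * y) (id1 := 0) (op1 := Rplus)).
- by apply: eq_bigr => i _; rewrite /DDG /=; ring.
- by move=> ? ?; ring.
- by ring.
Qed.

Lemma contf_Amean_s (K : vec (2 * nu).+3 -> R) : contf K -> contf (fun s => Amean a s K x).
Proof.
move=> cK; apply: contf_mult; first by cont.
apply: (contf_sphere_int (H := fun s w => K (fun i => x i + a * s * w i))).
by apply: contf_affine; cont.
Qed.

Lemma Amean0 (K : vec (2 * nu).+3 -> R) : Amean a 0 K x = K x / INR (dfact (2 * nu).+1).
Proof.
rewrite /Amean (_ : (fun w => _) = fun _ => K x); last first.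
  apply: functional_extensionality => w; congr K; apply: functional_extensionality => i; ring.
rewrite sphere_int_const_even; field; split; first exact: dfact_neq0R.
by apply: pow_nonzero; have := PI_RGT_0; lra.
Qed.

(** [Darboux_iter_Iop] asks for a function vanishing at 0, so the constant A_0[g] is split off. This
    leaves the equation unchanged, and s I^nu of that constant is the explicit term because (2 nu +
    1)!! (2 nu)!! = (2 nu + 1)!. *)
Lemma iter_Iop_Amean s :
  s * iter nu Iop (fun s => Amean a s g x) s =
  s ^ (2 * nu).+1 / INR (2 * nu).+1`! * g x
  + int0 (int0 (fun q => q * iter nu Iop (fun s => Amean a s Lg x) q)) s.
Proof.
pose A0 := g x / INR (dfact (2 * nu).+1).
have cL : contf (fun s => Amean a s Lg x) by apply: contf_Amean_s; rewrite /Lg; cont.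
have cA : contf (fun s => Amean a s g x) by exact: contf_Amean_s.
have [h1 [h2 [d1 d2 e]]] := Darboux_Amean.
rewrite -(@Darboux_iter_Iop nu (fun s => Amean a s g x - A0)) //; last first.
- exists h1, h2; split=> // t.
  by apply: is_derive_eq (is_deriveB (d1 t) (is_deriveC A0 t)) _; ring.
- by rewrite Amean0 /A0; ring.
have -> : iter nu Iop (fun s => Amean a s g x) s
    = iter nu Iop (fun s => Amean a s g x - A0) s + iter nu Iop (fun _ => A0) s.
  rewrite -(congr1 (fun h => h s) (iter_IopD nu (f := fun s => Amean a s g x - A0) (g := fun _ => A0) _ _)); [|by cont|by cont].
  by congr (iter nu Iop _ s); apply: functional_extensionality => t; ring.
rewrite iter_Iop_const -dfactSM INR_mul /A0 -[s ^ (2 * nu).+1]/(s * s ^ (2 * nu)).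
by field; split; exact: dfact_neq0R.
Qed.

End Mean.

(** * Differentiability classes *)

Lemma is_derive_leibniz (F F' : R -> R -> R) t :
  contf2 F -> contf2 F' -> (forall s r, is_derive (fun s => F s r) s (F' s r)) ->
  is_derive (fun t => RInt (F t) 0 t) t (F t t + RInt (F' t) 0 t).
Proof.
move=> cF cF' dF.
apply: is_derive_eq.
  apply: (is_derive_chain2 (F := fun z b => RInt (F z) 0 b) (Fz := fun z b => RInt (F' z) 0 b) (Fr := F)
    (p := fun t => t) (q := fun t => t) _ _ _ (is_deriveI t) (is_deriveI t)).
  - move=> z r; apply: (is_derive_RInt_under (F := F)) => // z'; exact: contf_slice.
  - move=> z r; apply: is_derive_RInt0; exact: contf_slice.
  - apply: (contf_RInt (F := fun p r => F' p.1 r) (b := fun p => p.2)); last by cont.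
    by apply: (contf2_comp cF'); cont.
cbv beta; ring.
Qed.

Section Classes.
Variable n : nat.
Implicit Types (g F : vec n -> R -> R) (V : vec n -> R -> R -> R).

Definition cont3 V := contf (fun p : vec n * R * R => V p.1.1 p.1.2 p.2).

Lemma cont3_comp (U : UniformSpace) V (X : U -> vec n) (S T : U -> R) :
  cont3 V -> contf X -> contf S -> contf T -> contf (fun p => V (X p) (S p) (T p)).
Proof.
move=> cV cX cS cT.
apply: (contf_comp (g := fun p : vec n * R * R => V p.1.1 p.1.2 p.2) (f := fun p => (X p, S p, T p)) cV).
by cont.
Qed.

Definition pd3 i V := fun x s tau => pderiv i (fun y => V y s tau) x.
Definition ds V := fun x s tau => Derive (fun s => V x s tau) s.
Definition is_pd3 i V V' := forall s tau, is_pd i (fun y => V y s tau) (fun y => V' y s tau).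
Definition is_ds V V' := forall x s tau, is_derive (fun s => V x s tau) s (V' x s tau).

Lemma ext3 V V' : (forall x s tau, V x s tau = V' x s tau) -> V = V'.
Proof.
by move=> H; do 3! [apply: functional_extensionality => ?]; exact: H.
Qed.

Lemma ext2 F F' : (forall x t, F x t = F' x t) -> F = F'.
Proof. by move=> H; do 2! [apply: functional_extensionality => ?]; exact: H. Qed.

Lemma is_pd3E i V V' : is_pd3 i V V' -> pd3 i V = V'.
Proof. by move=> H; apply: ext3 => x s tau; rewrite /pd3 (is_pd_pderiv (H s tau)). Qed.

Lemma is_dsE V V' : is_ds V V' -> ds V = V'.
Proof. by move=> H; apply: ext3 => x s tau; apply: is_derive_unique; exact: H. Qed.

(* Derivatives of order <= k in (x, s); the parameter tau of V x s tau is never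
   differentiated, so that a source merely continuous in time is allowed. *)
Fixpoint Cks k V : Prop :=
  cont3 V /\
  match k with
  | 0%N => True
  | k'.+1 => (forall i, exists2 V', is_pd3 i V V' & Cks k' V')
             /\ exists2 V', is_ds V V' & Cks k' V'
  end.

Definition Cinf V := forall k, Cks k V.

Lemma Cks_cont k V : Cks k V -> cont3 V. Proof. by case: k => [|k] []. Qed.

Lemma CksW k V : Cks k.+1 V -> Cks k V.
Proof.
elim: k V => [|k IH] V [cV [dV sV]]; split => //; split.
  by move=> i; have [V' d /IH c] := dV i; exists V'.
by have [V' d /IH c] := sV; exists V'.
Qed.

Lemma Cinf_cont V : Cinf V -> cont3 V. Proof. by move=> /(_ 0%N) []. Qed.

Lemma Cinf_pd i V : Cinf V -> is_pd3 i V (pd3 i V) /\ Cinf (pd3 i V).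
Proof.
move=> cV; split; first by have [_ [/(_ i) [V' d _] _]] := cV 1%N; rewrite (is_pd3E d).
by move=> k; have [_ [/(_ i) [V' d c] _]] := cV k.+1; rewrite (is_pd3E d).
Qed.

Lemma Cinf_ds V : Cinf V -> is_ds V (ds V) /\ Cinf (ds V).
Proof.
move=> cV; split; first by have [_ [_ [V' d _]]] := cV 1%N; rewrite (is_dsE d).
by move=> k; have [_ [_ [V' d c]]] := cV k.+1; rewrite (is_dsE d).
Qed.

Lemma CksD k V V' : Cks k V -> Cks k V' -> Cks k (fun x s tau => V x s tau + V' x s tau).
Proof.
elim: k V V' => [|k IH] V V' [c1 d1] [c2 d2]; split => //; try by apply: contf_plus.
case: d1 => p1 [W1 s1 h1]; case: d2 => p2 [W2 s2 h2]; split; last first.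
  by exists (fun x s tau => W1 x s tau + W2 x s tau); [move=> x s tau; exact: is_deriveD|exact: IH].
move=> i; have [X1 q1 r1] := p1 i; have [X2 q2 r2] := p2 i.
by exists (fun x s tau => X1 x s tau + X2 x s tau); [move=> s tau x; exact: (is_deriveD (q1 s tau x) (q2 s tau x))|exact: IH].
Qed.

Lemma Cks0 k : Cks k (fun _ _ _ => 0).
Proof.
elim: k => [|k IH]; split=> //; try exact: contf_const.
split; first by move=> i; exists (fun _ _ _ => 0) => // s tau x; exact: is_deriveC.
by exists (fun _ _ _ => 0) => // x s tau; exact: is_deriveC.
Qed.

Lemma CksZ k c V : Cks k V -> Cks k (fun x s tau => c * V x s tau).
Proof.
elim: k V => [|k IH] V [c1 d1]; split => //; try by apply: contf_mult => //; exact: contf_const.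
case: d1 => p1 [W1 s1 h1]; split; last first.
  by exists (fun x s tau => c * W1 x s tau); [move=> x s tau; exact: is_derive_scal|exact: IH].
move=> i; have [X1 q1 r1] := p1 i.
by exists (fun x s tau => c * X1 x s tau); [move=> s tau x; exact: (is_derive_scal _ _ _ _ (q1 s tau x))|exact: IH].
Qed.

Lemma CksX k p V : Cks k V -> Cks k (fun x s tau => s ^ p * V x s tau).
Proof.
have cX V' p' : cont3 V' -> cont3 (fun x s tau => s ^ p' * V' x s tau).
  by move=> cV; apply: contf_mult => //; cont.
elim: k V p => [|k IH] V p H; first by case: H => c1 _; split=> //; exact: cX.
have hV := CksW H; case: H => c1 [p1 [W1 s1 h1]].
split; first exact: cX.
split.
  move=> i; have [X1 q1 r1] := p1 i.
  by exists (fun x s tau => s ^ p * X1 x s tau); [move=> s tau x; exact: (is_derive_scal _ _ _ _ (q1 s tau x))|exact: IH].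
exists (fun x s tau => INR p * (s ^ p.-1 * V x s tau) + s ^ p * W1 x s tau).
  move=> x s tau; apply: is_derive_eq.
    by apply: is_deriveM; [apply: is_derive_pow; exact: is_deriveI|exact: s1].
  by cbv beta; ring.
by apply: CksD; [apply: CksZ; exact: IH|exact: IH].
Qed.

Definition int0s V := fun x s tau => int0 (fun r => V x r tau) s.

Lemma cont3_slice V x tau : cont3 V -> contf (fun r => V x r tau).
Proof. by move=> cV; apply: (cont3_comp cV); cont. Qed.

Lemma cont3_int0s V : cont3 V -> cont3 (int0s V).
Proof.
move=> cV; apply: (contf_RInt (F := fun p r => V p.1.1 r p.2) (b := fun p => p.1.2)); last by cont.
by apply: (cont3_comp cV); cont.
Qed.

Lemma is_pd3_int0s i V V' : cont3 V -> cont3 V' -> is_pd3 i V V' -> is_pd3 i (int0s V) (int0s V').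
Proof.
move=> cV cV' dV s tau x.
have e : [eta x with i |-> x i] = x :> vec n.
  by apply: functional_extensionality => j /=; case: eqP => [->|].
have := @is_derive_RInt_under (fun r q => V [eta x with i |-> r] q tau)
  (fun r q => V' [eta x with i |-> r] q tau) 0 s (x i).
rewrite e; apply.
- by move=> r q; exact: (is_pd_at (G := fun y => V y q tau) (G' := fun y => V' y q tau) x r (dV q tau)).
- by move=> r; apply: cont3_slice.
- by apply: (cont3_comp cV'); cont.
Qed.

Lemma is_ds_int0s V : cont3 V -> is_ds (int0s V) V.
Proof. by move=> cV x s tau; apply: is_derive_int0; exact: cont3_slice. Qed.

Lemma CksJ k V : Cks k V -> Cks k (int0s V).
Proof.
elim: k V => [|k IH] V H; first by split=> //; apply: cont3_int0s; exact: Cks_cont H.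
have cV := Cks_cont H; have hV := CksW H; case: H => _ [p1 _]; split; first exact: cont3_int0s.
split; last by exists V => //; exact: is_ds_int0s.
move=> i; have [X1 q1 r1] := p1 i.
exists (int0s X1); last exact: IH.
by apply: is_pd3_int0s => //; exact: Cks_cont r1.
Qed.

Lemma Cinf_sum (I : Type) (r : seq I) (P : pred I) (G : I -> vec n -> R -> R -> R) :
  (forall i, Cinf (G i)) -> Cinf (fun x s tau => \big[Rplus/0]_(i <- r | P i) G i x s tau).
Proof.
move=> cG k; elim: r => [|i r IH].
  rewrite (_ : (fun _ => _) = fun _ _ _ => 0); first exact: Cks0.
  by apply: ext3 => *; rewrite big_nil.
case Pi: (P i).
  rewrite (_ : (fun _ => _) = fun x s tau => G i x s tau + \big[Rplus/0]_(i <- r | P i) G i x s tau).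
    by apply: CksD => //; exact: cG.
  by apply: ext3 => *; rewrite big_cons Pi.
rewrite (_ : (fun _ => _) = fun x s tau => \big[Rplus/0]_(i <- r | P i) G i x s tau) //.
by apply: ext3 => *; rewrite big_cons Pi.
Qed.

Lemma CinfD V V' : Cinf V -> Cinf V' -> Cinf (fun x s tau => V x s tau + V' x s tau).
Proof. by move=> c1 c2 k; exact: CksD. Qed.
Lemma CinfZ c V : Cinf V -> Cinf (fun x s tau => c * V x s tau).
Proof. by move=> c1 k; exact: CksZ. Qed.
Lemma CinfX p V : Cinf V -> Cinf (fun x s tau => s ^ p * V x s tau).
Proof. by move=> c1 k; exact: CksX. Qed.
Lemma CinfJ V : Cinf V -> Cinf (int0s V).
Proof. by move=> c1 k; exact: CksJ. Qed.

(* Differentiate V(s) = V(0) + int_0^s (ds V) in x: this gives the symmetry of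
   the mixed derivatives. *)
Lemma pd3_ds i V : Cinf V -> pd3 i (ds V) = ds (pd3 i V).
Proof.
move=> cV; have [dV cdV] := Cinf_ds cV; have [pV cpV] := Cinf_pd i cV.
have [pdV cpdV] := Cinf_pd i cdV.
have e x s tau : V x s tau = V x 0 tau + int0s (ds V) x s tau.
  apply: (eq_of_is_derive (f := fun s => V x s tau) (g := fun s => V x 0 tau + int0s (ds V) x s tau)
    (h := fun s => ds V x s tau)) => [r|r|].
  - exact: dV.
  - apply: is_derive_eq (is_deriveD (is_deriveC _ _) (is_ds_int0s (Cinf_cont cdV) x r tau)) _.
    by ring.
  - by rewrite /int0s int0_0; ring.
have e' : pd3 i V = fun x s tau => pd3 i V x 0 tau + int0s (pd3 i (ds V)) x s tau.
  apply: is_pd3E => s tau x.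
  apply: (is_derive_extR (f := fun r => V [eta x with i |-> r] 0 tau + int0s (ds V) [eta x with i |-> r] s tau)).
    by move=> r; rewrite -e.
  apply: is_deriveD; first exact: pV.
  exact: (is_pd3_int0s (Cinf_cont cdV) (Cinf_cont cpdV) pdV).
symmetry; rewrite e'; apply: is_dsE => x s tau.
apply: is_derive_eq (is_deriveD (is_deriveC _ _) (is_ds_int0s (Cinf_cont cpdV) x s tau)) _.
by ring.
Qed.

(* Derivatives of total order <= k, of which at most p in t. *)
Fixpoint Ckp k p F : Prop :=
  contf2 F /\
  match k with
  | 0%N => True
  | k'.+1 =>
      (forall i, exists2 F', (forall t, is_pd i (fun y => F y t) (fun y => F' y t)) & Ckp k' p F')
      /\ match p with
         | 0%N => True
         | p'.+1 => exists2 F', (forall x t, is_derive (F x) t (F' x t)) & Ckp k' p' F'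
         end
  end.

(** With p = 0 no derivative is taken in the second variable: all x-derivatives exist and are
    jointly continuous in x and time. *)
Definition xsmooth g := forall k, Ckp k 0 g.
Definition pd2 i g := fun x tau => pderiv i (fun y => g y tau) x.

Lemma xsmooth_cont g : xsmooth g -> contf2 g. Proof. by move=> /(_ 0%N) []. Qed.

Lemma xsmooth_pd i g : xsmooth g -> (forall t, is_pd i (fun y => g y t) (fun y => pd2 i g y t)) /\ xsmooth (pd2 i g).
Proof.
have E g' : (forall t, is_pd i (fun y => g y t) (fun y => g' y t)) -> pd2 i g = g'.
  by move=> H; apply: ext2 => x t; rewrite /pd2 (is_pd_pderiv (H t)).
move=> cg; split; first by have [_ [/(_ i) [g' d _] _]] := cg 1%N; rewrite (E _ d).
by move=> k; have [_ [/(_ i) [g' d c] _]] := cg k.+1; rewrite (E _ d).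
Qed.

Lemma Cinf_lift g : xsmooth g -> Cinf (fun x _ tau => g x tau).
Proof.
move=> cg k; elim: k g cg => [|k IH] g cg; split=> //; try by apply: (contf2_comp (xsmooth_cont cg)); cont.
split.
  move=> i; have [d c] := xsmooth_pd i cg; exists (fun x _ tau => pd2 i g x tau); last exact: IH.
  by move=> s tau; exact: d.
exists (fun _ _ _ => 0); last exact: Cks0.
by move=> x s tau; exact: is_deriveC.
Qed.

Lemma CkpD k p F F' : Ckp k p F -> Ckp k p F' -> Ckp k p (fun x t => F x t + F' x t).
Proof.
elim: k p F F' => [|k IH] p F F' [c1 d1] [c2 d2]; split => //; try by apply: contf_plus.
case: d1 => p1 t1; case: d2 => p2 t2; split.
  move=> i; have [X1 q1 r1] := p1 i; have [X2 q2 r2] := p2 i.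
  by exists (fun x t => X1 x t + X2 x t); [move=> t x; exact: (is_deriveD (q1 t x) (q2 t x))|exact: IH].
case: p t1 t2 {p1 p2} => [//|p] [W1 s1 h1] [W2 s2 h2].
by exists (fun x t => W1 x t + W2 x t); [move=> x t; exact: is_deriveD|exact: IH].
Qed.

Lemma Ckp0 k p : Ckp k p (fun _ _ => 0).
Proof.
elim: k p => [|k IH] p; split=> //; try exact: contf_const.
split; first by move=> i; exists (fun _ _ => 0) => // t x; exact: is_deriveC.
case: p => [//|p]; by exists (fun _ _ => 0) => // x t; exact: is_deriveC.
Qed.

Lemma CkpZ k p c F : Ckp k p F -> Ckp k p (fun x t => c * F x t).
Proof.
elim: k p F => [|k IH] p F [c1 d1]; split => //; try by apply: contf_mult => //; exact: contf_const.
case: d1 => p1 t1; split.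
  move=> i; have [X1 q1 r1] := p1 i.
  by exists (fun x t => c * X1 x t); [move=> t x; exact: (is_derive_scal _ _ _ _ (q1 t x))|exact: IH].
case: p t1 {p1} => [//|p] [W1 s1 h1].
by exists (fun x t => c * W1 x t); [move=> x t; exact: is_derive_scal|exact: IH].
Qed.

Lemma Ckp_sum (I : Type) (r : seq I) (P : pred I) (G : I -> vec n -> R -> R) k p :
  (forall i, P i -> Ckp k p (G i)) -> Ckp k p (fun x t => \big[Rplus/0]_(i <- r | P i) G i x t).
Proof.
move=> cG; elim: r => [|i r IH].
  rewrite (_ : (fun _ => _) = fun _ _ => 0); first exact: Ckp0.
  by apply: ext2 => *; rewrite big_nil.
case Pi: (P i).
  rewrite (_ : (fun _ => _) = fun x t => G i x t + \big[Rplus/0]_(i <- r | P i) G i x t).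
    by apply: CkpD => //; exact: cG.
  by apply: ext2 => *; rewrite big_cons Pi.
rewrite (_ : (fun _ => _) = fun x t => \big[Rplus/0]_(i <- r | P i) G i x t) //.
by apply: ext2 => *; rewrite big_cons Pi.
Qed.

Lemma Cinf_slice k p V tau : Cinf V -> Ckp k p (fun x t => V x t tau).
Proof.
elim: k p V => [|k IH] p V cV; split=> //; try by apply: (cont3_comp (Cinf_cont cV)); cont.
split.
  move=> i; have [d c] := Cinf_pd i cV; exists (fun x t => pd3 i V x t tau); last exact: IH.
  by move=> t; exact: d.
case: p => [//|p]; have [d c] := Cinf_ds cV.
by exists (fun x t => ds V x t tau); [move=> x t; exact: d|exact: IH].
Qed.

(** Freezing [s] leaves [tau] as the time variable, in which V is only continuous; hence the class
    without time derivatives, in contrast to [Cinf_slice]. *)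
Lemma Cinf_slice0 k V s : Cinf V -> Ckp k 0 (fun x tau => V x s tau).
Proof.
elim: k V => [|k IH] V cV; split=> //; try by apply: (cont3_comp (Cinf_cont cV)); cont.
split=> // i; have [d c] := Cinf_pd i cV; exists (fun x t => pd3 i V x s t); last exact: IH.
by move=> t; exact: d.
Qed.

Definition Dn p V := iter p ds V.

Lemma Cinf_Dn p V : Cinf V -> Cinf (Dn p V).
Proof. by move=> cV; elim: p => [//|p IH] /=; have [] := Cinf_ds IH. Qed.

Lemma pd3_Dn i p V : Cinf V -> pd3 i (Dn p V) = Dn p (pd3 i V).
Proof.
by move=> cV; elim: p => [//|p IH] /=; rewrite pd3_ds ?IH //; exact: Cinf_Dn.
Qed.

Lemma pd3_at0 i V s tau : (forall x, V x s tau = 0) -> forall x, pd3 i V x s tau = 0.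
Proof.
move=> H x; rewrite /pd3 /pderiv (Derive_ext _ (fun _ => 0)) ?Derive_const //.
Qed.

Definition duhamel V := fun x t => RInt (fun tau => V x (t - tau) tau) 0 t.

Lemma contf2_duhamel V : cont3 V -> contf2 (duhamel V).
Proof.
move=> cV; apply: (contf_RInt (F := fun p tau => V p.1 (p.2 - tau) tau) (b := fun p => p.2)); last by cont.
by apply: (cont3_comp cV); cont.
Qed.

Lemma is_pd_duhamel i V V' : cont3 V -> cont3 V' -> is_pd3 i V V' ->
  forall t, is_pd i (fun y => duhamel V y t) (fun y => duhamel V' y t).
Proof.
move=> cV cV' dV t x.
have e : [eta x with i |-> x i] = x :> vec n.
  by apply: functional_extensionality => j /=; case: eqP => [->|].
have := @is_derive_RInt_under (fun r q => V [eta x with i |-> r] (t - q) q)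
  (fun r q => V' [eta x with i |-> r] (t - q) q) 0 t (x i).
rewrite e; apply.
- by move=> r q; exact: (is_pd_at (G := fun y => V y (t - q) q) (G' := fun y => V' y (t - q) q) x r (dV _ _)).
- by move=> r; apply: (cont3_comp cV); cont.
- by apply: (cont3_comp cV'); cont.
Qed.

Lemma is_derive_duhamel V V' x t : cont3 V -> cont3 V' -> is_ds V V' ->
  is_derive (duhamel V x) t (V x 0 t + duhamel V' x t).
Proof.
move=> cV cV' dV; rewrite -(Rminus_diag_eq t t) //.
apply: (is_derive_leibniz (F := fun t q => V x (t - q) q) (F' := fun t q => V' x (t - q) q)).
- by apply: (cont3_comp cV); cont.
- by apply: (cont3_comp cV'); cont.
move=> s r.
apply: is_derive_eq.
  apply: (@is_derive_comp R_AbsRing R_NormedModule (fun s => V x s r) (fun s => s - r)); first exact: dV.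
  exact: is_deriveB (is_deriveI _) (is_deriveC _ _).
by rewrite /scal /= /mult /=; ring.
Qed.

(** Each t-derivative produces a boundary term (d_s^q V)(x, 0, t), in which t occupies the [tau]
    slot and which is only continuous in t. The hypothesis removes all of these except the one from
    the p-th differentiation, after which no further t-derivative is asked for. *)
Lemma Ckp_duhamel k p V : Cinf V ->
  (forall q, (q.+1 < p)%N -> forall x tau, Dn q V x 0 tau = 0) -> Ckp k p (duhamel V).
Proof.
elim: k p V => [|k IH] p V cV V0; split=> //; try exact: contf2_duhamel (Cinf_cont cV).
split.
  move=> i; have [d c] := Cinf_pd i cV; exists (duhamel (pd3 i V)).
    by apply: is_pd_duhamel => //; exact: Cinf_cont.
  apply: IH => // q qp x tau; rewrite -pd3_Dn //; apply: pd3_at0 => y; exact: V0.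
case: p V0 => [//|p] V0; have [d c] := Cinf_ds cV.
exists (fun x t => V x 0 t + duhamel (ds V) x t).
  by move=> x t; apply: is_derive_duhamel => //; exact: Cinf_cont.
apply: CkpD.
  case: p V0 => [|p] V0; first exact: Cinf_slice0.
  rewrite (_ : (fun _ => _) = fun _ _ => 0); first exact: Ckp0.
  by apply: ext2 => x t; exact: (V0 0%N).
apply: IH => // q qp x tau.
by rewrite /Dn -iterSr; exact: (V0 q.+1).
Qed.

End Classes.

(** * The Laplacian and the kernel *)

Lemma sumZ (I : Type) (r : seq I) (P : pred I) (c : R) (F : I -> R) :
  c * \big[Rplus/0]_(i <- r | P i) F i = \big[Rplus/0]_(i <- r | P i) (c * F i).
Proof.
by apply: (big_morph (fun y => c * y)) => [y z|]; ring.
Qed.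

Lemma RInt_sum (I : Type) (r : seq I) (P : pred I) (G : I -> R -> R) x y :
  (forall i, contf (G i)) ->
  RInt (fun t => \big[Rplus/0]_(i <- r | P i) G i t) x y = \big[Rplus/0]_(i <- r | P i) RInt (G i) x y.
Proof.
move=> cG; elim: r => [|i r IH].
  rewrite big_nil (RInt_congr (g := fun _ => 0)); last by move=> *; rewrite big_nil.
  by rewrite RInt_const /scal /= /mult /=; ring.
rewrite big_cons -IH; case Pi: (P i).
  rewrite -RIntD //; last by apply: contf_sum.
  by apply: RInt_congr => t; rewrite big_cons Pi.
by apply: RInt_congr => t; rewrite big_cons Pi.
Qed.

Section Laplacian.
Variables (n : nat) (a : R).
Implicit Types (g F : vec n -> R -> R) (V : vec n -> R -> R -> R).

Definition lap2 g := fun x tau => a2lap a (fun y => g y tau) x.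
Definition lap3 V := fun x s tau => a2lap a (fun y => V y s tau) x.

Lemma lap3E V x s tau : lap3 V x s tau = a ^ 2 * \sum_(i < n) pd3 i (pd3 i V) x s tau.
Proof. by []. Qed.

Lemma lap2E g x tau : lap2 g x tau = a ^ 2 * \sum_(i < n) pd2 i (pd2 i g) x tau.
Proof. by []. Qed.

Lemma xsmooth_lap2 g : xsmooth g -> xsmooth (lap2 g).
Proof.
move=> cg k; rewrite (_ : lap2 g = fun x tau => a ^ 2 * \sum_(i < n) pd2 i (pd2 i g) x tau) //.
apply: CkpZ; apply: Ckp_sum => i _.
by have [_ c1] := xsmooth_pd i cg; have [_ c2] := xsmooth_pd i c1.
Qed.

Lemma xsmooth_iter_lap2 k g : xsmooth g -> xsmooth (iter k lap2 g).
Proof. by move=> cg; elim: k => [//|k IH] /=; exact: xsmooth_lap2. Qed.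

Lemma pd3D i V V' : Cinf V -> Cinf V' ->
  pd3 i (fun x s tau => V x s tau + V' x s tau) = fun x s tau => pd3 i V x s tau + pd3 i V' x s tau.
Proof.
move=> c1 c2; apply: is_pd3E => s tau x.
have [d1 _] := Cinf_pd i c1; have [d2 _] := Cinf_pd i c2.
exact: (is_deriveD (d1 s tau x) (d2 s tau x)).
Qed.

Lemma lap3D V V' : Cinf V -> Cinf V' ->
  lap3 (fun x s tau => V x s tau + V' x s tau) = fun x s tau => lap3 V x s tau + lap3 V' x s tau.
Proof.
move=> c1 c2; apply: ext3 => x s tau; rewrite !lap3E -Rmult_plus_distr_l -big_split /=.
congr (_ * _); apply: eq_bigr => i _; rewrite pd3D // pd3D //.
  by have [] := Cinf_pd i c1.
by have [] := Cinf_pd i c2.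
Qed.

Lemma pd3M i (q : R -> R) V :
  pd3 i (fun x s tau => q s * V x s tau) = fun x s tau => q s * pd3 i V x s tau.
Proof. by apply: ext3 => x s tau; exact: Derive_scal. Qed.

Lemma lap3M (q : R -> R) V :
  lap3 (fun x s tau => q s * V x s tau) = fun x s tau => q s * lap3 V x s tau.
Proof.
apply: ext3 => x s tau; rewrite !lap3E !sumZ; apply: eq_bigr => i _.
by rewrite !pd3M; ring.
Qed.

Lemma lap3Z c V : lap3 (fun x s tau => c * V x s tau) = fun x s tau => c * lap3 V x s tau.
Proof. exact: (lap3M (fun _ => c)). Qed.

Lemma lap3_0 : lap3 (fun _ _ _ => 0) = fun _ _ _ => 0.
Proof.
have := lap3Z 0 (fun _ _ _ => 0); rewrite (_ : (fun _ _ _ => 0 * 0) = fun _ _ _ => 0); last first.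
  by apply: ext3 => *; ring.
by move=> ->; apply: ext3 => *; ring.
Qed.

Lemma lap3_sum (I : Type) (r : seq I) (P : pred I) (G : I -> vec n -> R -> R -> R) :
  (forall i, Cinf (G i)) ->
  lap3 (fun x s tau => \big[Rplus/0]_(i <- r | P i) G i x s tau)
  = fun x s tau => \big[Rplus/0]_(i <- r | P i) lap3 (G i) x s tau.
Proof.
move=> cG; elim: r => [|i r IH].
  have e : (fun x s tau => \big[Rplus/0]_(i <- [::] | P i) G i x s tau) = fun _ _ _ => 0.
    by apply: ext3 => *; rewrite big_nil.
  by rewrite e lap3_0; apply: ext3 => *; rewrite big_nil.
case Pi: (P i).
  have -> : (fun x s tau => \big[Rplus/0]_(i <- i :: r | P i) G i x s tau)
     = fun x s tau => G i x s tau + \big[Rplus/0]_(i <- r | P i) G i x s tau.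
    by apply: ext3 => *; rewrite big_cons Pi.
  rewrite lap3D //; last exact: Cinf_sum.
  by rewrite IH; apply: ext3 => *; rewrite big_cons Pi.
have -> : (fun x s tau => \big[Rplus/0]_(i <- i :: r | P i) G i x s tau)
   = fun x s tau => \big[Rplus/0]_(i <- r | P i) G i x s tau.
  by apply: ext3 => *; rewrite big_cons Pi.
by rewrite IH; apply: ext3 => *; rewrite big_cons Pi.
Qed.

Lemma pd3_int0s i V : Cinf V -> pd3 i (int0s V) = int0s (pd3 i V).
Proof.
move=> cV; have [d c] := Cinf_pd i cV; apply: is_pd3E.
by apply: is_pd3_int0s => //; exact: Cinf_cont.
Qed.

Lemma int0s_sum (I : Type) (r : seq I) (P : pred I) (G : I -> vec n -> R -> R -> R) c x s tau :
  (forall i, cont3 (G i)) ->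
  int0s (fun x s tau => c * \big[Rplus/0]_(i <- r | P i) G i x s tau) x s tau
  = c * \big[Rplus/0]_(i <- r | P i) int0s (G i) x s tau.
Proof.
move=> cG; apply: (eq_of_is_derive (f := int0s (fun x s tau => c * \big[Rplus/0]_(i <- r | P i) G i x s tau) x ^~ tau)
   (g := fun s => c * \big[Rplus/0]_(i <- r | P i) int0s (G i) x s tau)
   (h := fun s => c * \big[Rplus/0]_(i <- r | P i) G i x s tau)) => [t|t|].
- apply: is_ds_int0s; apply: contf_mult; first exact: contf_const.
  by apply: contf_sum => i; exact: cG.
- by apply: is_derive_scal; apply: is_derive_sum => i; exact: is_ds_int0s.
- by rewrite /int0s int0_0 big1 ?Rmult_0_r // => i _; rewrite int0_0.
Qed.

Lemma lap3_int0s V : Cinf V -> lap3 (int0s V) = int0s (lap3 V).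
Proof.
move=> cV; apply: ext3 => x s tau; rewrite lap3E.
rewrite (_ : int0s (lap3 V) = int0s (fun x s tau => a ^ 2 * \sum_(i < n) pd3 i (pd3 i V) x s tau)) //.
rewrite int0s_sum; last first.
  by move=> i; have [_ c1] := Cinf_pd i cV; have [_ c2] := Cinf_pd i c1; exact: Cinf_cont.
congr (_ * _); apply: eq_bigr => i _; rewrite pd3_int0s // pd3_int0s //.
by have [] := Cinf_pd i cV.
Qed.

Lemma lap3_ds V : Cinf V -> lap3 (ds V) = ds (lap3 V).
Proof.
move=> cV; symmetry; apply: is_dsE => x s tau.
rewrite lap3E.
apply: (is_derive_extR (f := fun s => a ^ 2 * \sum_(i < n) pd3 i (pd3 i V) x s tau)) => //.
apply: is_derive_scal; apply: is_derive_sum => i.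
have [_ c1] := Cinf_pd i cV; have [_ c2] := Cinf_pd i c1; have [d3 _] := Cinf_ds c2.
by rewrite pd3_ds // pd3_ds //; exact: d3.
Qed.

Lemma lap3_Dn p V : Cinf V -> lap3 (Dn p V) = Dn p (lap3 V).
Proof.
by move=> cV; elim: p => [//|p IH] /=; rewrite lap3_ds ?IH //; exact: Cinf_Dn.
Qed.

Lemma lap2_duhamel V x t : Cinf V -> lap2 (duhamel V) x t = duhamel (lap3 V) x t.
Proof.
move=> cV; rewrite lap2E.
have e W i : Cinf W -> pd2 i (duhamel W) = duhamel (pd3 i W).
  move=> cW; have [d c] := Cinf_pd i cW; apply: ext2 => y r.
  by rewrite /pd2 (is_pd_pderiv (is_pd_duhamel (Cinf_cont cW) (Cinf_cont c) d r)).
have c2 i : Cinf (pd3 i (pd3 i V)) by have [_ c1] := Cinf_pd i cV; have [_] := Cinf_pd i c1.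
transitivity (a ^ 2 * \sum_(i < n) duhamel (pd3 i (pd3 i V)) x t).
  congr (_ * _); apply: eq_bigr => i _; rewrite !e //.
  by have [] := Cinf_pd i cV.
have cs i : contf (fun tau => pd3 i (pd3 i V) x (t - tau) tau).
  by apply: (cont3_comp (Cinf_cont (c2 i))); cont.
rewrite /duhamel (RInt_congr (f := fun tau => lap3 V x (t - tau) tau)
  (g := fun tau => a ^ 2 * \sum_(i < n) pd3 i (pd3 i V) x (t - tau) tau)) //.
rewrite RIntZ; last by apply: contf_sum.
by rewrite RInt_sum.
Qed.

End Laplacian.

Lemma dfact_evenS m : dfact (2 * m.+1) = (2 * m.+1 * dfact (2 * m))%N.
Proof. by rewrite mulnS. Qed.

(** The operators h -> 1 / (2 j) int_0^T s h ds applied for j = 1, ..., m. This is the recursion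
    leading from E_1 to E_(m+1), and m = 0 agrees with the convention for the kernel of order 1. *)
Fixpoint Kiter m (h : R -> R) : R -> R :=
  match m with
  | 0%N => h
  | m'.+1 => fun T => / (2 * INR m) * int0 (fun s => s * Kiter m' h s) T
  end.

Lemma contf_Kiter m h : contf h -> contf (Kiter m h).
Proof.
move=> ch; elim: m => [//|m IH] /=; apply: contf_mult; first exact: contf_const.
by apply: contf_int0; cont.
Qed.

(** Differentiating (T^2 - s^2)^(m+1) in T brings out 2 (m + 1) T and lowers the exponent, the
    boundary term at s = T being 0. The double factorials of consecutive orders have ratio 4 (m + 2)
    (m + 1), which leaves T / (2 (m + 2)), the factor of [Kiter]. *)
Lemma kernel_intE m h T : contf h -> kernel_int m.+1 h T = Kiter m h T.
Proof.
(* [kernel_int] of order 1 is [h] by convention, so the induction over integrals starts at order 2,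
   with constant 2!! 0!! = 2. *)
move=> ch; case: m => [//|m].
elim: m T => [|m IH] T.
  rewrite /kernel_int /= /int0 -RIntZ; last by cont.
  by apply: RInt_congr => s; rewrite /=; field.
pose c' := INR (dfact (2 * m.+1)) * INR (dfact (2 * m)).
pose c := INR (dfact (2 * m.+2)) * INR (dfact (2 * m.+1)).
have ec : c = (2 * INR m.+2) * (2 * INR m.+1) * c'.
  by rewrite /c dfact_evenS dfact_evenS !INR_mul /c' dfact_evenS !INR_mul [INR 2]/=; ring.
have k2 t : kernel_int m.+2 h t = RInt (fun s => (t ^ 2 - s ^ 2) ^ m / c' * h s * s) 0 t.
  rewrite /kernel_int -[m.+2 == 1%N]/false /c'.
  have -> : (m.+2 - 2 = m)%N by lia.
  have -> : (2 * m.+2 - 2 = 2 * m.+1)%N by lia.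
  by have -> : (2 * m.+2 - 4 = 2 * m)%N by lia.
have k3 : kernel_int m.+3 h = fun t => RInt (fun s => (t ^ 2 - s ^ 2) ^ m.+1 / c * h s * s) 0 t.
  apply: functional_extensionality => t.
  rewrite /kernel_int -[m.+3 == 1%N]/false /c.
  have -> : (m.+3 - 2 = m.+1)%N by lia.
  have -> : (2 * m.+3 - 2 = 2 * m.+2)%N by lia.
  by have -> : (2 * m.+3 - 4 = 2 * m.+1)%N by lia.
have c0 : c' <> 0 by apply: Rmult_integral_contrapositive; split; exact: dfact_neq0R.
have cF p d : contf2 (fun T s => (T ^ 2 - s ^ 2) ^ p / d * h s * s).
  by rewrite /contf2 /Rdiv; cont; apply: (contf_comp ch); cont.
have pm1 := INR_gt0 (ltn0Sn m); have pm2 := INR_gt0 (ltn0Sn m.+1).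
rewrite k3; apply: (eq_of_is_derive (f := fun t => RInt (fun s => (t ^ 2 - s ^ 2) ^ m.+1 / c * h s * s) 0 t)
  (g := Kiter m.+2 h)
   (h := fun t => / (2 * INR m.+2) * (t * Kiter m.+1 h t))) => [t|t|].
- apply: is_derive_eq.
    apply: (is_derive_leibniz (F := fun T s => (T ^ 2 - s ^ 2) ^ m.+1 / c * h s * s)
      (F' := fun T s => (2 * INR m.+1 * T) * ((T ^ 2 - s ^ 2) ^ m / c * h s * s))).
    + exact: cF.
    + by apply: contf_mult; [cont|exact: cF].
    + move=> s r; apply: (is_derive_extR (f := fun s => (h r * r / c) * (s ^ 2 - r ^ 2) ^ m.+1)).
        by move=> y; rewrite /Rdiv; ring.
      apply: is_derive_eq.
        apply: is_derive_scal; apply: is_derive_pow.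
        apply: is_deriveB (is_deriveC _ _); apply: is_derive_pow; exact: is_deriveI.
      by rewrite /= /Rdiv; ring.
  have ck := contf_slice (x := t) (cF m c').
  rewrite -IH k2 -!RIntZ //; last by apply: contf_mult; [exact: contf_const|exact: ck].
  rewrite Rminus_diag_eq // pow_i /Rdiv ?Rmult_0_l ?Rplus_0_l; last exact/ltP.
  apply: RInt_congr => s; rewrite ec; field; split=> //; lra.
- apply: is_derive_scal; apply: (is_derive_int0 (h := fun s => s * Kiter m.+1 h s)); apply: contf_mult; [exact: contf_id|exact: contf_Kiter].
- rewrite /= int0_0 Rmult_0_r; exact: (@RInt_point R_CompleteNormedModule).
Qed.

(** * The impulse solution of the wave equation *)

Section Operators.
Variables (nu : nat) (a : R).
Local Notation n := (2 * nu).+3.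
Implicit Types (g h : vec n -> R -> R) (V : vec n -> R -> R -> R).

Definition Amean3 g : vec n -> R -> R -> R := fun x s tau => Amean (nu := nu) a s (fun y => g y tau) x.

Lemma cont3_Amean3 g : contf2 g -> cont3 (Amean3 g).
Proof.
move=> cg; apply: contf_mult; first exact: contf_const.
apply: (contf_sphere_int (H := fun (p : vec n * R * R) w => g (fun i => p.1.1 i + a * p.1.2 * w i) p.2)).
by apply: (contf2_comp cg); [apply: contf_vec => i|]; cont.
Qed.

Lemma is_pd3_Amean3 i g g' : contf2 g -> contf2 g' ->
  (forall tau, is_pd i (fun y => g y tau) (fun y => g' y tau)) -> is_pd3 i (Amean3 g) (Amean3 g').
Proof.
move=> cg cg' dg s tau x; apply: is_derive_scal.
have e : [eta x with i |-> x i] = x :> vec n.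
  by apply: functional_extensionality => j /=; case: eqP => [->|].
have := @is_derive_sphere_int _ (fun r w => g (fun k => [eta x with i |-> r] k + a * s * w k) tau)
  (fun r w => g' (fun k => [eta x with i |-> r] k + a * s * w k) tau) (x i).
rewrite e; apply.
- move=> r w.
  have := is_pd_at (fun k => x k + a * s * w k) (r + a * s * w i) (dg tau).
  rewrite (_ : ([eta (fun k => x k + a * s * w k) with i |-> r + a * s * w i] : vec n)
     = fun k => [eta x with i |-> r] k + a * s * w k); last first.
    by apply: functional_extensionality => k /=; case: eqP => [->|].
  move=> H.
  apply: (is_derive_extR (f := fun r => g [eta (fun k => x k + a * s * w k) with i |-> r + a * s * w i] tau)).
    move=> y; congr (g _ tau); apply: functional_extensionality => k /=.
    by case: eqP => [->|].
  apply: is_derive_eq.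
    apply: (@is_derive_comp R_AbsRing R_NormedModule
      (fun r => g [eta (fun k => x k + a * s * w k) with i |-> r] tau) (fun r => r + a * s * w i)); first exact: H.
    exact: is_deriveD (is_deriveI _) (is_deriveC _ _).
  by rewrite /scal /= /mult /=; ring.
- apply: (contf2_comp cg); last exact: contf_const.
  by apply: contf_vec => k; apply: contf_plus; [rewrite /=; case: (k == i)|]; cont.
- apply: (contf2_comp cg'); last exact: contf_const.
  by apply: contf_vec => k; apply: contf_plus; [rewrite /=; case: (k == i)|]; cont.
Qed.

Definition Iop3 V : vec n -> R -> R -> R := int0s (fun x s tau => V x s tau * s).

Lemma cont3_Iop3 V : cont3 V -> cont3 (Iop3 V).
Proof. by move=> cV; apply: cont3_int0s; apply: contf_mult => //; cont. Qed.

Lemma cont3_iter_Iop3 k V : cont3 V -> cont3 (iter k Iop3 V).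
Proof. by move=> cV; elim: k => [//|k IH] /=; exact: cont3_Iop3. Qed.

Lemma is_pd3_iter_Iop3 k i V V' : cont3 V -> cont3 V' -> is_pd3 i V V' ->
  is_pd3 i (iter k Iop3 V) (iter k Iop3 V').
Proof.
move=> cV cV' dV; elim: k => [//|k IH] /=; apply: is_pd3_int0s.
- by apply: contf_mult; [exact: cont3_iter_Iop3|cont].
- by apply: contf_mult; [exact: cont3_iter_Iop3|cont].
move=> s tau x; apply: is_derive_eq (is_deriveM (IH s tau x) (is_deriveC _ _)) _.
by cbv beta; ring.
Qed.

(** B[g] of the overview. *)
Definition Imean g : vec n -> R -> R -> R := fun x s tau => s * iter nu Iop3 (Amean3 g) x s tau.

Lemma iter_Iop3E k V x s tau : iter k Iop3 V x s tau = iter k Iop (fun s => V x s tau) s.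
Proof.
elim: k s => [//|k IH] s; rewrite !iterS /Iop3 /int0s /int0 /Iop.
by apply: RInt_congr => r; rewrite IH.
Qed.

Lemma ImeanE g x s tau :
  Imean g x s tau = s * iter nu Iop (fun s => Amean (nu := nu) a s (fun y => g y tau) x) s.
Proof. by rewrite /Imean iter_Iop3E. Qed.

Lemma cont3_Imean g : contf2 g -> cont3 (Imean g).
Proof.
by move=> cg; apply: contf_mult; [cont|apply: cont3_iter_Iop3; exact: cont3_Amean3].
Qed.

Lemma is_pd3_Imean i g : xsmooth g -> is_pd3 i (Imean g) (Imean (pd2 i g)).
Proof.
move=> cg s tau x; apply: is_derive_scal.
have [d c] := xsmooth_pd i cg; have c1 := xsmooth_cont cg; have c2 := xsmooth_cont c.
by apply: is_pd3_iter_Iop3; [exact: cont3_Amean3|exact: cont3_Amean3|exact: is_pd3_Amean3].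
Qed.

Lemma Imean_eq g x s tau : xsmooth g ->
  Imean g x s tau = s ^ (2 * nu).+1 / INR (2 * nu).+1`! * g x tau + int0s (int0s (Imean (lap2 a g))) x s tau.
Proof.
move=> cg.
have cslice h : xsmooth h -> contf (fun y => h y tau).
  by move=> ch; apply: (contf2_comp (xsmooth_cont ch)); cont.
rewrite ImeanE (@iter_Iop_Amean nu a (fun y => g y tau) (fun i y => pd2 i g y tau)
  (fun i j y => pd2 j (pd2 i g) y tau)).
- congr (_ + _); rewrite /int0s; congr (int0 _ s); apply: functional_extensionality => p.
  by congr (int0 _ p); apply: functional_extensionality => q; rewrite ImeanE.
- exact: cslice.
- by move=> i; apply: cslice; have [] := xsmooth_pd i cg.
- by move=> i j; apply: cslice; have [_ c] := xsmooth_pd i cg; have [] := xsmooth_pd j c.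
- by move=> i; have [d _] := xsmooth_pd i cg; exact: d.
- by move=> i j; have [_ c] := xsmooth_pd i cg; have [d _] := xsmooth_pd j c; exact: d.
Qed.

(** By [Imean_eq] the s-derivative is a power of s times g plus one integral of [Imean (lap2 a g)],
    so regularity in s is paid for with x-derivatives of g; the induction on k therefore runs over
    all g. *)
Lemma Cinf_Imean g : xsmooth g -> Cinf (Imean g).
Proof.
move=> cg k; elim: k g cg => [|k IH] g cg; split => //; try exact: cont3_Imean (xsmooth_cont cg).
have cL := xsmooth_lap2 a cg; split.
  move=> i; exists (Imean (pd2 i g)); first exact: is_pd3_Imean.
  by apply: IH; have [] := xsmooth_pd i cg.
exists (fun x s tau => INR (2 * nu).+1 / INR (2 * nu).+1`! * (s ^ (2 * nu) * g x tau) + int0s (Imean (lap2 a g)) x s tau).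
  move=> x s tau; apply: (is_derive_extR (f := fun s => (g x tau / INR (2 * nu).+1`!) * s ^ (2 * nu).+1 + int0s (int0s (Imean (lap2 a g))) x s tau)).
    by move=> y; rewrite (Imean_eq _ _ _ cg) /Rdiv; ring.
  apply: is_derive_eq.
    apply: is_deriveD; first by apply: is_derive_scal; apply: is_derive_pow; exact: is_deriveI.
    by apply: is_ds_int0s; apply: cont3_int0s; apply: cont3_Imean; exact: xsmooth_cont.
  by rewrite -pred_Sn /Rdiv; ring.
apply: CksD; last by apply: CksJ; exact: IH.
by apply: CksZ; apply: CksX; exact: (Cinf_lift cg).
Qed.

Lemma Amean3D g h x s tau : contf2 g -> contf2 h ->
  Amean3 (fun x tau => g x tau + h x tau) x s tau = Amean3 g x s tau + Amean3 h x s tau.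
Proof.
move=> cg ch; rewrite /Amean3 /Amean -Rmult_plus_distr_l -sphere_int_D //.
  by apply: (contf2_comp cg); [apply: contf_vec => k|]; cont.
by apply: (contf2_comp ch); [apply: contf_vec => k|]; cont.
Qed.

Lemma Amean3Z c g x s tau : contf2 g ->
  Amean3 (fun x tau => c * g x tau) x s tau = c * Amean3 g x s tau.
Proof.
move=> cg; rewrite /Amean3 /Amean sphere_int_Z; first by ring.
by apply: (contf2_comp cg); [apply: contf_vec => k|]; cont.
Qed.

Lemma ImeanD g h x s tau : contf2 g -> contf2 h ->
  Imean (fun x tau => g x tau + h x tau) x s tau = Imean g x s tau + Imean h x s tau.
Proof.
move=> cg ch; rewrite !ImeanE -Rmult_plus_distr_l; congr (_ * _).
have cA (h' : vec n -> R -> R) : contf2 h' -> contf (fun s => Amean (nu := nu) a s (fun y => h' y tau) x).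
  by move=> ch'; exact: (cont3_slice (cont3_Amean3 ch')).
rewrite -(congr1 (fun F : R -> R => F s) (iter_IopD nu (cA g cg) (cA h ch))).
congr (iter nu Iop _ s); apply: functional_extensionality => r.
exact: (Amean3D x r tau cg ch).
Qed.

Lemma iter_IopZ k c (h : R -> R) s : contf h -> iter k Iop (fun s => c * h s) s = c * iter k Iop h s.
Proof.
move=> ch; elim: k s => [//|k IH] s; rewrite !iterS -[Iop (iter k Iop h) s]/(RInt (fun r => iter k Iop h r * r) 0 s).
rewrite -RIntZ; last by cont; exact: contf_iter_Iop.
by apply: RInt_congr => r; rewrite IH; ring.
Qed.

Lemma ImeanZ c g x s tau : contf2 g ->
  Imean (fun x tau => c * g x tau) x s tau = c * Imean g x s tau.
Proof.
move=> cg; rewrite !ImeanE.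
have -> : (fun s => Amean (nu := nu) a s (fun y => c * g y tau) x)
   = (fun s => c * Amean (nu := nu) a s (fun y => g y tau) x).
  by apply: functional_extensionality => r; exact: (Amean3Z c x r tau cg).
rewrite iter_IopZ; first by ring.
exact: (cont3_slice (cont3_Amean3 cg)).
Qed.

Lemma Imean_sum (I : Type) (r : seq I) (G : I -> vec n -> R -> R) x s tau :
  (forall i, contf2 (G i)) ->
  Imean (fun x tau => \big[Rplus/0]_(i <- r) G i x tau) x s tau = \big[Rplus/0]_(i <- r) Imean (G i) x s tau.
Proof.
move=> cG; elim: r => [|i r IH].
  have -> : (fun x tau => \big[Rplus/0]_(i <- [::]) G i x tau) = (fun x tau => 0 * (fun _ _ => 0) x tau).
    by apply: ext2 => *; rewrite big_nil; ring.
  by rewrite big_nil ImeanZ ?Rmult_0_l //; exact: contf_const.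
rewrite big_cons -IH -ImeanD //; last by apply: contf_sum.
by congr (Imean _ x s tau); apply: ext2 => *; rewrite big_cons.
Qed.

Lemma lap3_Imean g : xsmooth g -> lap3 a (Imean g) = Imean (lap2 a g).
Proof.
move=> cg; apply: ext3 => x s tau; rewrite lap3E.
have c i : xsmooth (pd2 i (pd2 i g)) by have [_ c] := xsmooth_pd i cg; have [] := xsmooth_pd i c.
rewrite (_ : lap2 a g = fun x tau => a ^ 2 * \sum_(i < n) pd2 i (pd2 i g) x tau) //.
rewrite ImeanZ; last by apply: contf_sum => i; exact: xsmooth_cont.
rewrite Imean_sum; last by move=> i; exact: xsmooth_cont.
congr (_ * _); apply: eq_bigr => i _.
rewrite (is_pd3E (is_pd3_Imean i cg)).
by have [_ c1] := xsmooth_pd i cg; rewrite (is_pd3E (is_pd3_Imean i c1)).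
Qed.

Definition wave_impulse g : vec n -> R -> R -> R := fun x s tau =>
  Imean (iter nu (lap2 a) g) x s tau
  + \sum_(i < nu) (/ INR (2 * i).+1`! * (s ^ (2 * i).+1 * iter i (lap2 a) g x tau)).

Lemma Cinf_wave_impulse g : xsmooth g -> Cinf (wave_impulse g).
Proof.
move=> cg; apply: CinfD; first by apply: Cinf_Imean; exact: xsmooth_iter_lap2.
apply: (@Cinf_sum _ _ _ _ (fun (i : 'I_nu) x s tau => / INR (2 * i).+1`! * (s ^ (2 * i).+1 * iter i (lap2 a) g x tau))) => i.
by apply: CinfZ; apply: CinfX; apply: Cinf_lift; exact: xsmooth_iter_lap2.
Qed.

Lemma lap3_wave_impulse g : xsmooth g -> lap3 a (wave_impulse g) = wave_impulse (lap2 a g).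
Proof.
move=> cg; rewrite /wave_impulse.
have ci (i : nat) : Cinf (fun (x : vec n) (s tau : R) => / INR (2 * i).+1`! * (s ^ (2 * i).+1 * iter i (lap2 a) g x tau)).
  by apply: CinfZ; apply: CinfX; apply: Cinf_lift; exact: xsmooth_iter_lap2.
rewrite lap3D; last 2 first.
- by apply: Cinf_Imean; exact: xsmooth_iter_lap2.
- exact: (@Cinf_sum _ _ _ _ (fun (i : 'I_nu) x s tau => / INR (2 * i).+1`! * (s ^ (2 * i).+1 * iter i (lap2 a) g x tau))).
rewrite (@lap3_sum _ a _ _ _ (fun (i : 'I_nu) x s tau => / INR (2 * i).+1`! * (s ^ (2 * i).+1 * iter i (lap2 a) g x tau))) //.
rewrite lap3_Imean; last exact: xsmooth_iter_lap2.
apply: ext3 => x s tau; rewrite -iterS iterSr; congr (_ + _); apply: eq_bigr => i _.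
by rewrite lap3Z (lap3M a (fun s => s ^ (2 * i).+1)) -[iter i (lap2 a) (lap2 a g)]iterSr.
Qed.

(** With t_i = s^(2 i) / (2 i)! L^i g, the derivative of E_1[g] is t_0 + ... + t_nu plus one
    integral of B[L^(nu+1) g]: the terms i < nu come from the correction sum, t_nu from the leading
    term of B[L^nu g]. Integrating E_1[L g] gives the same with t_1, ..., t_nu only, so the
    difference is t_0 = g. *)
Lemma is_ds_wave_impulse g : xsmooth g -> is_ds (wave_impulse g) (fun x s tau => g x tau + int0s (wave_impulse (lap2 a g)) x s tau).
Proof.
move=> cg x s tau.
have cL := xsmooth_lap2 a cg.
have cN := xsmooth_iter_lap2 a nu cg.
have cNL := xsmooth_iter_lap2 a nu cL.
have p1 k := INR_gt0 (ltn0Sn k).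
have eJ r : int0s (wave_impulse (lap2 a g)) x r tau = int0s (Imean (iter nu (lap2 a) (lap2 a g))) x r tau
   + \sum_(i < nu) (/ INR (2 * i).+2`! * (r ^ (2 * i).+2 * iter i.+1 (lap2 a) g x tau)).
  apply: (eq_of_is_derive (f := fun r => int0s (wave_impulse (lap2 a g)) x r tau)
    (g := fun r => int0s (Imean (iter nu (lap2 a) (lap2 a g))) x r tau
     + \sum_(i < nu) (/ INR (2 * i).+2`! * (r ^ (2 * i).+2 * iter i.+1 (lap2 a) g x tau)))
    (h := fun r => wave_impulse (lap2 a g) x r tau)) => [t|t|].
  - by apply: is_ds_int0s; exact: Cinf_cont (Cinf_wave_impulse cL).
  - apply: is_deriveD; first by apply: is_ds_int0s; apply: cont3_Imean; exact: xsmooth_cont.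
    apply: is_derive_sum => i; apply: is_derive_scal_eq; first apply: is_deriveM.
    + by apply: is_derive_pow; exact: is_deriveI.
    + exact: is_deriveC.
    rewrite factS INR_mul iterSr -pred_Sn; field; split; first exact: fact_neq0R.
    by have := p1 (2 * i).+1; lra.
  - rewrite /int0s !int0_0 big1; first by ring.
    by move=> i _; rewrite [0 ^ _]/=; ring.
rewrite eJ.
apply: is_derive_eq.
  apply: is_deriveD.
    apply: (is_derive_extR (f := fun s => (iter nu (lap2 a) g x tau / INR (2 * nu).+1`!) * s ^ (2 * nu).+1 + int0s (int0s (Imean (lap2 a (iter nu (lap2 a) g)))) x s tau)).
      by move=> y; rewrite (Imean_eq _ _ _ cN) /Rdiv; ring.
    apply: is_deriveD; first by apply: is_derive_scal; apply: is_derive_pow; exact: is_deriveI.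
    by apply: is_ds_int0s; apply: cont3_int0s; apply: cont3_Imean; apply: xsmooth_cont; exact: xsmooth_lap2.
  apply: (@is_derive_sum _ _ _ _ (fun i : 'I_nu => / INR (2 * i)`! * (s ^ (2 * i) * iter i (lap2 a) g x tau))) => i.
  apply: is_derive_scal_eq; first apply: is_deriveM.
  - by apply: is_derive_pow; exact: is_deriveI.
  - exact: is_deriveC.
  rewrite factS INR_mul -pred_Sn; field; split; first exact: fact_neq0R.
  by have := p1 (2 * i)%N; lra.
rewrite -iterSr iterS -pred_Sn.
have -> : g x tau = / INR (2 * 0)`! * (s ^ (2 * 0) * iter 0 (lap2 a) g x tau) by rewrite /=; field.
pose t i := / INR (2 * i)`! * (s ^ (2 * i) * iter i (lap2 a) g x tau).
have -> : \sum_(i < nu) (/ INR (2 * i).+2`! * (s ^ (2 * i).+2 * iter i.+1 (lap2 a) g x tau)) = \sum_(i < nu) t i.+1.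
  by apply: eq_bigr => i _; rewrite /t mulnS.
have e : t 0%N + \sum_(i < nu) t i.+1 = \sum_(i < nu) t i + t nu.
  by rewrite -(big_ord_recr (op := Rplus) nu t) big_ord_recl.
transitivity (\sum_(i < nu) t i + t nu + int0s (Imean (lap2 a (iter nu (lap2 a) g))) x s tau); last by rewrite -e /t; ring.
have aux (A N F S B C : R) : N <> 0 -> F <> 0 ->
    A / (N * F) * (N * 1 * S) + C + B = B + / F * (S * A) + C.
  by move=> ? ?; field.
rewrite /t factS INR_mul; apply: aux; last exact: fact_neq0R.
by have := p1 (2 * nu)%N; lra.
Qed.

End Operators.

(** * The impulse solutions of its powers *)

Section DnLinear.
Variable n : nat.
Implicit Types (V : vec n -> R -> R -> R).

Lemma dsD V V' : Cinf V -> Cinf V' ->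
  ds (fun x s tau => V x s tau + V' x s tau) = fun x s tau => ds V x s tau + ds V' x s tau.
Proof.
move=> c1 c2; have [d1 _] := Cinf_ds c1; have [d2 _] := Cinf_ds c2.
by apply: is_dsE => x s tau; exact: is_deriveD.
Qed.

Lemma dsZ c V : ds (fun x s tau => c * V x s tau) = fun x s tau => c * ds V x s tau.
Proof. by apply: ext3 => x s tau; exact: Derive_scal. Qed.

Lemma DnS p V : Dn p.+1 V = Dn p (ds V). Proof. exact: iterSr. Qed.

Lemma Dn_add p q V : Dn p (Dn q V) = Dn (p + q) V.
Proof. by rewrite /Dn iterD. Qed.

Lemma DnD p V V' : Cinf V -> Cinf V' ->
  Dn p (fun x s tau => V x s tau + V' x s tau) = fun x s tau => Dn p V x s tau + Dn p V' x s tau.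
Proof.
move=> c1 c2; elim: p => [//|p IH]; rewrite /Dn !iterS -!/(Dn _ _) IH.
by apply: dsD; exact: Cinf_Dn.
Qed.

Lemma DnZ p c V : Dn p (fun x s tau => c * V x s tau) = fun x s tau => c * Dn p V x s tau.
Proof. by elim: p => [//|p IH]; rewrite /Dn !iterS -!/(Dn _ _) IH dsZ. Qed.

Lemma Dn_0 p : Dn p (fun _ _ _ => 0) = fun (_ : vec n) _ _ => 0.
Proof.
elim: p => [//|p IH]; rewrite /Dn !iterS -!/(Dn _ _) IH; apply: is_dsE => x s tau; exact: is_deriveC.
Qed.

Lemma Dn_sum (I : Type) (r : seq I) (P : pred I) (G : I -> vec n -> R -> R -> R) p :
  (forall i, Cinf (G i)) ->
  Dn p (fun x s tau => \big[Rplus/0]_(i <- r | P i) G i x s tau)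
  = fun x s tau => \big[Rplus/0]_(i <- r | P i) Dn p (G i) x s tau.
Proof.
move=> cG; elim: r => [|i r IH].
  have e : (fun x s tau => \big[Rplus/0]_(i <- [::] | P i) G i x s tau) = fun _ _ _ => 0.
    by apply: ext3 => *; rewrite big_nil.
  by rewrite e Dn_0; apply: ext3 => *; rewrite big_nil.
case Pi: (P i).
  have -> : (fun x s tau => \big[Rplus/0]_(i <- i :: r | P i) G i x s tau)
     = fun x s tau => G i x s tau + \big[Rplus/0]_(i <- r | P i) G i x s tau.
    by apply: ext3 => *; rewrite big_cons Pi.
  rewrite DnD //; last exact: Cinf_sum.
  by rewrite IH; apply: ext3 => *; rewrite big_cons Pi.
have -> : (fun x s tau => \big[Rplus/0]_(i <- i :: r | P i) G i x s tau)
   = fun x s tau => \big[Rplus/0]_(i <- r | P i) G i x s tau.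
  by apply: ext3 => *; rewrite big_cons Pi.
by rewrite IH; apply: ext3 => *; rewrite big_cons Pi.
Qed.

End DnLinear.

(* With T i k = d_t^(2 i) L^k v this is the binomial expansion of (d_t^2 - L)^l v. *)
Definition altsum (l : nat) (T : nat -> nat -> R) :=
  \sum_(k < l.+1) ((-1) ^ k * INR 'C(l, k) * T (l - k)%N k).

(** Pascal's rule; the first sum on the right is padded with the index k = l + 1, whose binomial
    coefficient is 0. *)
Lemma altsumS l T :
  altsum l.+1 T = altsum l (fun i k => T i.+1 k) - altsum l (fun i k => T i k.+1).
Proof.
have e1 : altsum l (fun i k => T i.+1 k) = T l.+1 0%N
   + \sum_(k < l.+1) ((-1) ^ k.+1 * INR 'C(l, k.+1) * T (l - k)%N k.+1).
  rewrite /altsum big_ord_recl subn0 bin0 [X in _ = _ + X]big_ord_recr /= bin_small //.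
  rewrite (eq_bigr (fun k : 'I_l => -1 * (-1) ^ k * INR 'C(l, k.+1) * T (l - k)%N k.+1)); first by rewrite /=; ring.
  by move=> k _; rewrite /bump /= add1n -subSn ?subSS.
rewrite e1 /altsum big_ord_recl subn0 bin0 /Rminus Rplus_assoc.
congr (_ + _); first by rewrite /=; ring.
have -> : - (\sum_(k < l.+1) ((-1) ^ k * INR 'C(l, k) * T (l - k)%N k.+1))
  = \sum_(k < l.+1) (-1 * ((-1) ^ k * INR 'C(l, k) * T (l - k)%N k.+1)).
  rewrite -[LHS]Rmult_1_l -Ropp_mult_distr_r Ropp_mult_distr_l; exact: sumZ.
rewrite -big_split /=; apply: eq_bigr => k _.
by rewrite /bump /= add1n ?add0n subSS binS INR_add; ring.
Qed.

Lemma altsumD l T T' : altsum l (fun i k => T i k + T' i k) = altsum l T + altsum l T'.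
Proof. by rewrite /altsum -big_split; apply: eq_bigr => k _; rewrite Rmult_plus_distr_l. Qed.

Section impulse.
Variables (nu : nat) (a : R).
Local Notation n := (2 * nu).+3.
Implicit Types (g : vec n -> R -> R).

(** E_0 = 0 is included so that (d_t^2 - L) E_(q+1) = E_q holds from q = 0 on; the factor 1 / (2 q)
    of the recursion makes sense from q = 1, hence the inner match. *)
Fixpoint impulse (q : nat) g : vec n -> R -> R -> R :=
  match q with
  | 0%N => fun _ _ _ => 0
  | q'.+1 => match q' with
     | 0%N => wave_impulse (nu := nu) a g
     | _ => fun x s tau => / (2 * INR q') * int0s (fun x s tau => s * impulse q' g x s tau) x s tau
     end
  end.

Lemma impulseS q g : impulse q.+2 g = fun x s tau => / (2 * INR q.+1) * int0s (fun x s tau => s * impulse q.+1 g x s tau) x s tau.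
Proof. by []. Qed.

Lemma Cinf_M V : Cinf V -> Cinf (fun (x : vec n) s tau => s * V x s tau).
Proof.
move=> cV; have := CinfX 1 cV.
by congr Cinf; apply: ext3 => x s tau; rewrite /= Rmult_1_r.
Qed.

Lemma Cinf_impulse q g : xsmooth g -> Cinf (impulse q g).
Proof.
move=> cg; case: q => [|q]; first by move=> k; exact: Cks0.
elim: q => [|q IH]; first exact: Cinf_wave_impulse.
by rewrite impulseS; apply: CinfZ; apply: CinfJ; apply: Cinf_M.
Qed.

Lemma lap3_impulse q g : xsmooth g -> lap3 a (impulse q g) = impulse q (lap2 a g).
Proof.
move=> cg; case: q => [|q]; first exact: lap3_0.
elim: q => [|q IH]; first exact: lap3_wave_impulse.
rewrite !impulseS lap3Z lap3_int0s; last by apply: Cinf_M; exact: Cinf_impulse.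
by rewrite (lap3M a (fun s => s)) IH.
Qed.

Lemma impulse_at0 q g x tau : impulse q g x 0 tau = 0.
Proof.
case: q => [//|[|q]]; last by rewrite impulseS /int0s int0_0; ring.
rewrite /= /wave_impulse /Imean Rmult_0_l big1; first by ring.
by move=> i _; rewrite /=; ring.
Qed.

Lemma ds_impulse1 g : xsmooth g -> ds (impulse 1 g) = fun x s tau => g x tau + int0s (impulse 1 (lap2 a g)) x s tau.
Proof. by move=> cg; apply: is_dsE; exact: is_ds_wave_impulse. Qed.

Lemma ds_impulseS q g : xsmooth g ->
  ds (impulse q.+2 g) = fun x s tau => / (2 * INR q.+1) * (s * impulse q.+1 g x s tau).
Proof.
move=> cg; rewrite impulseS dsZ (is_dsE (is_ds_int0s _)) //.
by apply: Cinf_cont; apply: Cinf_M; exact: Cinf_impulse.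
Qed.

(** Kept multiplied by 2 q, so that q = 0 is included; the induction for [dds_impulse] meets this
    case. *)
Lemma ds_impulse q g x s tau : xsmooth g -> 2 * INR q * ds (impulse q.+1 g) x s tau = s * impulse q g x s tau.
Proof.
move=> cg; case: q => [|q]; first by rewrite /=; ring.
rewrite ds_impulseS //; field; have := INR_gt0 (ltn0Sn q); lra.
Qed.

(** In the induction step the claim for E_(q+2) amounts to E_(q+1) + s E_(q+1)' = 2 (q + 1)
    (E_(q+2)[L g] + E_(q+1)). Both sides vanish at 0; the derivative of the left side is 2 E_(q+1)'
    + s E_(q+1)'', and the induction hypothesis with [ds_impulse] turns s E_(q+1)'' into 2 (q + 1)
    E_(q+2)[L g]' + 2 q E_(q+1)'. *)
Lemma dds_impulse q g : xsmooth g ->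
  ds (ds (impulse q.+1 g)) = fun x s tau => impulse q.+1 (lap2 a g) x s tau + impulse q g x s tau.
Proof.
elim: q g => [|q IH] g cg; have cL := xsmooth_lap2 a cg.
  rewrite ds_impulse1 //; apply: is_dsE => x s tau.
  apply: is_derive_eq (is_deriveD (is_deriveC _ _) (is_ds_int0s (Cinf_cont (Cinf_impulse 1 cL)) x s tau)) _.
  by rewrite /=; ring.
have [d1 c1] := Cinf_ds (Cinf_impulse q.+1 cg); have [d2 _] := Cinf_ds c1.
have q0 := INR_gt0 (ltn0Sn q).
rewrite ds_impulseS //; apply: is_dsE => x s tau.
apply: is_derive_scal_eq; first by apply: (is_deriveM (is_deriveI s)); exact: d1.
rewrite Rmult_comm; apply: (Rmult_eq_reg_l (2 * INR q.+1)); last lra.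
rewrite Rmult_comm Rmult_assoc Rinv_l; last lra.
rewrite Rmult_1_r.
apply: (eq_of_is_derive (f := fun s => 1 * impulse q.+1 g x s tau + s * ds (impulse q.+1 g) x s tau)
  (g := fun s => 2 * INR q.+1 * (impulse q.+2 (lap2 a g) x s tau + impulse q.+1 g x s tau))
  (h := fun s => 2 * ds (impulse q.+1 g) x s tau + s * ds (ds (impulse q.+1 g)) x s tau)) => [t|t|].
- apply: is_derive_eq.
    by apply: is_deriveD (is_derive_scal _ _ _ _ (d1 x t tau)) (is_deriveM (is_deriveI t) (d2 x t tau)).
  by cbv beta; ring.
- have [d3 _] := Cinf_ds (Cinf_impulse q.+2 cL).
  apply: is_derive_scal_eq; first exact: (is_deriveD (d3 x t tau) (d1 x t tau)).
  rewrite IH // Rmult_plus_distr_l (ds_impulse q.+1) // Rmult_plus_distr_l -(ds_impulse q) // S_INR; ring.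
- by rewrite !impulse_at0; ring.
Qed.

Lemma ds_impulse_at0 q g x tau : xsmooth g -> ds (impulse q.+1 g) x 0 tau = if q == 0%N then g x tau else 0.
Proof.
move=> cg; case: q => [|q]; first by rewrite ds_impulse1 // /int0s int0_0 Rplus_0_r.
by rewrite ds_impulseS //=; ring.
Qed.

Lemma DnSS_impulse p q g : xsmooth g ->
  Dn p.+2 (impulse q.+1 g) = fun x s tau => Dn p (impulse q.+1 (lap2 a g)) x s tau + Dn p (impulse q g) x s tau.
Proof.
move=> cg; rewrite !DnS dds_impulse // DnD //; apply: Cinf_impulse => //; exact: xsmooth_lap2.
Qed.

(** [DnSS_impulse] trades two time derivatives for a Laplacian at the same q or for a step from q to
    q - 1. Only the second keeps the gap between p + 1 and 2 q, so the top order p + 1 = 2 q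
    descends to E_1'(0) = g while the other contributions vanish; the second claim uses the
    first. *)
Lemma Dn_impulse_at0 p : (forall q g x tau, xsmooth g -> (p.+1 < 2 * q)%N -> Dn p (impulse q g) x 0 tau = 0) /\
  (forall q g x tau, xsmooth g -> (p.+1 = 2 * q)%N -> Dn p (impulse q g) x 0 tau = g x tau).
Proof.
elim/ltn_ind: p => p IH; case: p IH => [|[|p]] IH.
- by split=> q g x tau cg h; [exact: impulse_at0 | lia].
- split=> q g x tau cg h; case: q h => [|q] h; try lia; rewrite [Dn _ _]/= ds_impulse_at0 //.
    by case: eqP h => // ->; lia.
  by have -> : q = 0%N by lia.
have [IH1 IH2] := IH p (leqnSn _).
split=> q g x tau cg h; case: q h => [|q] h; try lia; have cL := xsmooth_lap2 a cg.
  by rewrite DnSS_impulse // !IH1 //; [ring|lia|lia].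
by rewrite DnSS_impulse // IH1 // ?IH2 //; [ring|lia|lia].
Qed.

(** Binomial form of (d_t^2 - L)^l E_q = E_(q - l), with e further time derivatives. For l = q the
    right side is 0, which is the relation used for the initial values. *)
Lemma altsum_impulse l q e g x s tau : xsmooth g -> (l <= q)%N ->
  altsum l (fun i k => Dn (2 * i + e) (impulse q (iter k (lap2 a) g)) x s tau) = Dn e (impulse (q - l) g) x s tau.
Proof.
move=> cg; elim: l q => [|l IH] q lq.
  by rewrite /altsum big_ord_recl big_ord0 subnn bin0 muln0 add0n [INR 1]/= subn0 /=; ring.
case: q lq => [//|q] lq; rewrite subSS -IH // altsumS.
rewrite (_ : altsum l (fun i k => Dn (2 * i.+1 + e) (impulse q.+1 (iter k (lap2 a) g)) x s tau)
  = altsum l (fun i k => Dn (2 * i + e) (impulse q.+1 (iter k.+1 (lap2 a) g)) x s tau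
       + Dn (2 * i + e) (impulse q (iter k (lap2 a) g)) x s tau)).
  by rewrite altsumD; ring.
apply: eq_bigr => k _; congr (_ * _).
rewrite (_ : 2 * (l - k).+1 + e = (2 * (l - k) + e).+2)%N; last by lia.
by rewrite DnSS_impulse //; exact: xsmooth_iter_lap2.
Qed.

(** Each step of the recursion divides the term s^(2 q + 2 i + 1) by 2 (q + 1) (2 q + 2 i + 3) while
    raising its exponent by 2. Since (q + 1) C(q + 1 + i, i) = (q + 1 + i) C(q + i, i), the
    coefficients keep their form; this is the origin of the binomial coefficient in the last line of
    the theorem. *)
Lemma impulse_formula q g x s tau : xsmooth g ->
  impulse q.+1 g x s tau = Kiter q (fun s => Imean (nu := nu) a (iter nu (lap2 a) g) x s tau) s
   + \sum_(i < nu) (INR 'C(q + i, i) / INR (2 * q + 2 * i).+1`! * s ^ (2 * q + 2 * i).+1 * iter i (lap2 a) g x tau).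
Proof.
move=> cg; elim: q s => [|q IH] s.
  rewrite /= /wave_impulse; congr (_ + _); apply: eq_bigr => i _.
  by rewrite muln0 add0n add0n binn /Rdiv (_ : INR 1 = 1) // [s ^ (2 * i).+1]/=; ring.
have cB : contf (fun s => Imean (nu := nu) a (iter nu (lap2 a) g) x s tau).
  by apply: cont3_slice; apply: cont3_Imean; apply: xsmooth_cont; exact: xsmooth_iter_lap2.
have q0 := INR_gt0 (ltn0Sn q).
rewrite impulseS.
apply: (eq_of_is_derive (f := fun s => / (2 * INR q.+1) * int0s (fun x s tau => s * impulse q.+1 g x s tau) x s tau)
 (g := fun s => Kiter q.+1 (fun s => Imean (nu := nu) a (iter nu (lap2 a) g) x s tau) s
   + \sum_(i < nu) (INR 'C(q.+1 + i, i) / INR (2 * q.+1 + 2 * i).+1`! * s ^ (2 * q.+1 + 2 * i).+1 * iter i (lap2 a) g x tau))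
 (h := fun s => / (2 * INR q.+1) * (s * impulse q.+1 g x s tau))) => [t|t|].
- apply: is_derive_scal; apply: is_ds_int0s; apply: Cinf_cont; apply: Cinf_M; exact: Cinf_impulse.
- rewrite IH; apply: is_derive_eq.
    apply: is_deriveD.
      apply: is_derive_scal; apply: (is_derive_int0 (h := fun s => s * Kiter q (fun s => Imean (nu := nu) a (iter nu (lap2 a) g) x s tau) s)).
      by apply: contf_mult; [exact: contf_id|exact: contf_Kiter].
    apply: (@is_derive_sum _ _ _ _ (fun i : 'I_nu => / (2 * INR q.+1) * (t * (INR 'C(q + i, i) / INR (2 * q + 2 * i).+1`! * t ^ (2 * q + 2 * i).+1 * iter i (lap2 a) g x tau)))) => i.
    apply: is_derive_eq.
      by apply: is_deriveM (is_deriveC _ _); apply: is_derive_scal; apply: is_derive_pow; exact: is_deriveI.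
    rewrite -pred_Sn (_ : 2 * q.+1 + 2 * i = (2 * q + 2 * i).+2)%N; last by lia.
    have eC : INR q.+1 * INR 'C(q.+1 + i, i) = INR (q + i).+1 * INR 'C(q + i, i).
      rewrite -!INR_mul; congr INR.
      by have := mul_bin_down (q + i).+1 i; rewrite -addSn addnK => ->.
    rewrite [((2 * q + 2 * i).+3)`!]factS (INR_mul (2 * q + 2 * i).+3).
    rewrite [((2 * q + 2 * i).+2)`!]factS (INR_mul (2 * q + 2 * i).+2).
    have e2 : INR (2 * q + 2 * i).+2 = 2 * INR (q + i).+1.
      by rewrite (_ : (2 * q + 2 * i).+2 = 2 * (q + i).+1)%N ?INR_mul //; lia.
    have p3 := INR_gt0 (ltn0Sn (2 * q + 2 * i).+2). have p4 := INR_gt0 (ltn0Sn (q + i)).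
    rewrite e2; have := @fact_neq0R (2 * q + 2 * i).+1 => hf.
    have -> : INR 'C(q.+1 + i, i) = INR (q + i).+1 * INR 'C(q + i, i) / INR q.+1 by rewrite -eC; field; lra.
    rewrite -[t ^ (2 * q + 2 * i).+2]/(t * t ^ (2 * q + 2 * i).+1).
    move: hf; move: (INR ((2 * q + 2 * i).+1)`!) => F hf; field; repeat split=> //; lra.
  rewrite -sumZ -sumZ; by rewrite -Rmult_plus_distr_l -Rmult_plus_distr_l.
- rewrite /int0s /= !int0_0 big1; first by ring.
  by move=> i _; ring.
Qed.
End impulse.

(** * The closed half-line *)

Lemma locally_within_ge0 (t : R) (P : R -> Prop) :
  0 <= t -> within (fun s => 0 <= s) (locally t) P -> exists2 s, t < s & P s.
Proof.
move=> t0 [d Hd]; have := cond_pos d => d0.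
exists (t + d / 2); first lra.
apply: Hd; last lra.
rewrite /ball /= /AbsRing_ball /abs /minus /plus /opp /= Rabs_right; lra.
Qed.

(** [filterdiff] asks for an estimate at each limit point of the filter; as points of the half-line
    lie arbitrarily near t, that limit point can only be t. *)
Lemma is_filter_lim_within_ge0 (t x : R) : 0 <= t ->
  is_filter_lim (within (fun s => 0 <= s) (locally t)) x -> x = t.
Proof.
move=> t0 H; apply: NNPP => ne.
have d0 : 0 < Rabs (x - t) / 2 by have := Rabs_pos_lt (x - t); lra.
have h1 := H _ (locally_ball x (mkposreal _ d0)).
have h2 : within (fun s => 0 <= s) (locally t) (fun s => ball t (mkposreal _ d0) s).
  by exists (mkposreal _ d0) => y.
have [s _ [b1 b2]] := locally_within_ge0 t0 (filter_and _ _ h1 h2).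
have {}b1 : Rabs (s - x) < Rabs (x - t) / 2 by exact: b1.
have {}b2 : Rabs (s - t) < Rabs (x - t) / 2 by exact: b2.
have := Rabs_triang (s - t) (- (s - x)); rewrite Rabs_Ropp (_ : _ + _ = x - t); [lra|ring].
Qed.

(** Passage from the construction on the whole line to the half-line: [H] is an extension with an
    ordinary derivative, and [h] agrees with it for s >= 0. *)
Lemma is_derive_ge0_of (h H : R -> R) t l : 0 <= t -> (forall s, 0 <= s -> h s = H s) ->
  is_derive H t l -> is_derive_ge0 h t l.
Proof.
move=> t0 hH [lin dH]; split=> // x lx eps.
have -> := is_filter_lim_within_ge0 t0 lx.
have [d Hd] := dH t (fun P => id) eps.
exists d => y By y0; rewrite !hH //; exact: Hd.
Qed.

(** Points s > t near t always belong to the half-line, so they separate two slopes, at t = 0 as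
    well. *)
Lemma is_derive_ge0_unique h t l l' : 0 <= t -> is_derive_ge0 h t l -> is_derive_ge0 h t l' -> l = l'.
Proof.
move=> t0 [_ d1] [_ d2]; apply: NNPP => ne.
have e0 : 0 < Rabs (l - l') / 4 by have := Rabs_pos_lt (l - l'); lra.
have lt : is_filter_lim (within (fun s => 0 <= s) (locally t)) t.
  by move=> P; apply: filter_imp.
have [s st [b1 b2]] := locally_within_ge0 t0
  (filter_and _ _ (d1 t lt (mkposreal _ e0)) (d2 t lt (mkposreal _ e0))).
have {}b1 : Rabs (h s - h t - (s - t) * l) <= Rabs (l - l') / 4 * Rabs (s - t) by exact: b1.
have {}b2 : Rabs (h s - h t - (s - t) * l') <= Rabs (l - l') / 4 * Rabs (s - t) by exact: b2.
have := Rabs_triang (h s - h t - (s - t) * l') (- (h s - h t - (s - t) * l)).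
rewrite Rabs_Ropp (_ : _ + _ = (s - t) * (l - l')); last by ring.
rewrite Rabs_mult => b3.
have : 0 < Rabs (s - t) by apply: Rabs_pos_lt; lra.
have : 0 < Rabs (l - l') by lra.
nra.
Qed.

Lemma derive_ge0_unique h t l : 0 <= t -> is_derive_ge0 h t l -> derive_ge0 h t = l.
Proof.
move=> t0 dh; apply: (@iota_unique R_AbsRing R_CompleteNormedModule) => // y dy.
exact: is_derive_ge0_unique t0 dy dh.
Qed.

Lemma derive_ge0E (h H : R -> R) t l : 0 <= t -> (forall s, 0 <= s -> h s = H s) ->
  is_derive H t l -> derive_ge0 h t = l.
Proof. by move=> t0 hH dH; apply: derive_ge0_unique => //; exact: is_derive_ge0_of dH. Qed.

Lemma derive_n_ge0E (h : R -> R) (H : nat -> R -> R) N :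
  (forall s, 0 <= s -> h s = H 0%N s) ->
  (forall r s, (r < N)%N -> is_derive (H r) s (H r.+1 s)) ->
  forall r s, (r <= N)%N -> 0 <= s -> derive_n_ge0 r h s = H r s.
Proof.
move=> h0 dH; elim=> [|r IH] s rN s0; first exact: h0.
by apply: (derive_ge0E s0) (dH r s rN) => t t0; apply: IH => //; exact: ltnW.
Qed.

Lemma contf2_half n (F : vec n -> R -> R) (f : vec n -> R -> R) :
  contf2 F -> (forall x t, 0 <= t -> f x t = F x t) -> continuous_half f.
Proof.
move=> cF fF x t t0; rewrite fF //.
apply: (filterlim_ext_loc (fun p : vec n * R => F p.1 p.2)).
  apply: (@filter_imp _ (locally (x, t)) _ (fun _ => True)); last exact: filter_true.
  by move=> p _ p0; rewrite fF.
apply: (filterlim_filter_le_1 _ _ (cF (x, t))).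
exact: filter_le_within.
Qed.

Lemma Ckp_half n k p (F f : vec n -> R -> R) : (k <= p)%N -> Ckp k p F ->
  (forall x t, 0 <= t -> f x t = F x t) -> Ck_half k f.
Proof.
elim: k p F f => [|k IH] p F f kp H fF.
  by split=> //; case: H => cF _; exact: contf2_half cF fF.
case: p kp H => [//|p] kp [cF [dx [Ft dt ct]]]; split; first exact: contf2_half cF fF.
split; [|split].
- move=> i; have [F' dF' cF'] := dx i; split.
    move=> x t t0; exists (F' x t); apply: is_derive_extR (dF' t x) => s; by rewrite fF.
  apply: (IH p.+1 F') => //; first exact: leqW.
  move=> x t t0; apply: is_derive_unique.
  by apply: is_derive_extR (dF' t x) => s; rewrite fF.
- by move=> x t t0; exists (Ft x t); apply: is_derive_ge0_of (dt x t) => // s s0; exact: fF.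
- apply: (IH p Ft) => // x t t0; apply: derive_ge0E (dt x t) => // s s0; exact: fF.
Qed.

Lemma box_of n (a : R) (F F1 F2 v : vec n -> R -> R) x t : 0 <= t ->
  (forall x t, is_derive (F x) t (F1 x t)) -> (forall x t, is_derive (F1 x) t (F2 x t)) ->
  (forall x t, 0 <= t -> v x t = F x t) -> box a v x t = F2 x t - lap2 a F x t.
Proof.
move=> t0 d1 d2 vF; congr (_ - _).
  apply: (derive_n_ge0E (H := fun r => match r with 0%N => F x | 1%N => F1 x | _ => F2 x end) (N := 2)) => //.
    by move=> s s0; exact: vF.
  by move=> [|[|r]] s //= _.
rewrite /lap2; congr (a2lap a _ x); apply: functional_extensionality => y; exact: vF.
Qed.

Lemma Rmax0_lipschitz s t : Rabs (Rmax 0 s - Rmax 0 t) <= Rabs (s - t).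
Proof.
rewrite /Rmax; case: (Rle_dec 0 s) => ?; case: (Rle_dec 0 t) => ?; split_Rabs; lra.
Qed.

(* Freezing f at its value at time 0 for negative times keeps all its x-derivatives
   continuous on the whole line; no t-derivative of f is ever needed. *)
Lemma contf2_Rmax n (f : vec n -> R -> R) : continuous_half f -> contf2 (fun x t => f x (Rmax 0 t)).
Proof.
move=> cf [x t].
apply: (filterlim_comp _ _ _ (fun p : vec n * R => (p.1, Rmax 0 p.2)) (fun p => f p.1 p.2)
   _ (within (fun p : vec n * R => 0 <= p.2) (locally (x, Rmax 0 t)))); last first.
  by apply: (cf x); exact: Rmax_l.
move=> P [d HP]; exists d => -[y s] [By Bs]; apply: HP; last exact: Rmax_l.
by split=> //; exact: (Rle_lt_trans _ _ _ (Rmax0_lipschitz s t) Bs).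
Qed.

Lemma xsmooth_half n (f : vec n -> R -> R) : smooth_half f -> xsmooth (fun x t => f x (Rmax 0 t)).
Proof.
move=> sf k; elim: k f sf => [|k IH] f sf.
  by have [cf _] := sf 0%N; split=> //; exact: contf2_Rmax.
have [cf _] := sf 0%N; split; first exact: contf2_Rmax.
split=> // i.
exists (fun x t => pderiv i (fun y => f y (Rmax 0 t)) x).
  move=> t x; have [_ [dx _]] := sf 1%N; have [ex _] := dx i.
  by apply: Derive_correct; apply: ex; exact: Rmax_l.
apply: (IH (fun x t => pderiv i (fun y => f y t) x)) => k'.
by have [_ [dx _]] := sf k'.+1; have [] := dx i.
Qed.

Lemma xsmooth_smooth n (g : vec n -> R) : smooth g -> xsmooth (fun x (_ : R) => g x).
Proof.
move=> sg k; elim: k g sg => [|k IH] g sg.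
  split=> //; have [cg _] := sg 0%N; apply: (contf_comp (V := fct_UniformSpace _ _) cg); cont.
have [cg _] := sg 0%N.
split; first by apply: (contf_comp (V := fct_UniformSpace _ _) cg); cont.
split=> // i; exists (fun x _ => pderiv i g x).
  move=> t x; have [_ dx] := sg 1%N; have [ex _] := dx i.
  by apply: Derive_correct; apply: ex.
by apply: IH => k'; have [_ dx] := sg k'.+1; have [] := dx i.
Qed.

(** * The Cauchy problem *)

Section Solution.
Variables (nu m : nat) (a : R).
Hypothesis hm : (0 < m)%N.
Local Notation n := (2 * nu).+3.
Implicit Types (g f : vec n -> R -> R) (psi : nat -> vec n -> R -> R).

(** The order q of the impulse is kept apart from m: applying d_t^2 - L lowers q, while the
    coefficients and the orders of differentiation remain those fixed by m. *)
Definition data_term q psi (k j : nat) : vec n -> R -> R -> R := fun x s tau =>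
  (-1) ^ k * INR 'C(m, k) * Dn (2 * m - 1 - 2 * k - j) (impulse (nu := nu) a q (iter k (lap2 a) (psi j))) x s tau.

Definition data_sol q psi : vec n -> R -> R -> R := fun x s tau =>
  \sum_(k < m) \sum_(j < 2 * m - 2 * k) data_term q psi k j x s tau.

Definition xsmooth_below psi := forall j, (j < 2 * m)%N -> xsmooth (psi j).

Lemma Cinf_data_term q psi (k : nat) (j : 'I_(2 * m - 2 * k)) : xsmooth_below psi -> Cinf (data_term q psi k j).
Proof.
move=> cpsi; apply: CinfZ; apply: Cinf_Dn; apply: Cinf_impulse; apply: xsmooth_iter_lap2; apply: cpsi.
exact: leq_trans (ltn_ord j) (leq_subr _ _).
Qed.

Lemma Cinf_data_inner q psi (k : nat) : xsmooth_below psi ->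
  Cinf (fun x s tau => \sum_(j < 2 * m - 2 * k) data_term q psi k j x s tau).
Proof.
move=> cpsi.
by apply: (@Cinf_sum _ _ _ _ (fun (j : 'I_(2 * m - 2 * k)) => data_term q psi k j)) => j; exact: Cinf_data_term.
Qed.

Lemma Cinf_data_sol q psi : xsmooth_below psi -> Cinf (data_sol q psi).
Proof.
move=> cpsi.
apply: (@Cinf_sum _ _ _ _ (fun (k : 'I_m) x s tau => \sum_(j < 2 * m - 2 * k) data_term q psi k j x s tau)) => k.
exact: Cinf_data_inner.
Qed.

Lemma lap3_data_sol q psi : xsmooth_below psi -> lap3 a (data_sol q psi) = data_sol q (fun j => lap2 a (psi j)).
Proof.
move=> cpsi; rewrite /data_sol.
rewrite (@lap3_sum _ a _ _ _ (fun (k : 'I_m) x s tau => \sum_(j < 2 * m - 2 * k) data_term q psi k j x s tau)); last first.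
  by move=> k; exact: Cinf_data_inner.
apply: ext3 => x s tau; apply: eq_bigr => k _.
rewrite (@lap3_sum _ a _ _ _ (fun (j : 'I_(2 * m - 2 * k)) => data_term q psi k j)); last first.
  by move=> j; exact: Cinf_data_term.
apply: eq_bigr => j _.
have cj : xsmooth (iter k (lap2 a) (psi j)).
  apply: xsmooth_iter_lap2; apply: cpsi; exact: leq_trans (ltn_ord j) (leq_subr _ _).
rewrite /data_term lap3Z lap3_Dn; last exact: Cinf_impulse.
by rewrite lap3_impulse // -iterS iterSr.
Qed.

Lemma Dn_data_sol p q psi : xsmooth_below psi -> Dn p (data_sol q psi) = fun x s tau =>
  \sum_(k < m) \sum_(j < 2 * m - 2 * k) ((-1) ^ k * INR 'C(m, k) *
     Dn (p + (2 * m - 1 - 2 * k - j)) (impulse (nu := nu) a q (iter k (lap2 a) (psi j))) x s tau).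
Proof.
move=> cpsi; rewrite /data_sol.
rewrite (@Dn_sum _ _ _ _ (fun (k : 'I_m) x s tau => \sum_(j < 2 * m - 2 * k) data_term q psi k j x s tau)); last first.
  by move=> k; exact: Cinf_data_inner.
apply: ext3 => x s tau; apply: eq_bigr => k _.
rewrite (@Dn_sum _ _ _ _ (fun (j : 'I_(2 * m - 2 * k)) => data_term q psi k j)); last first.
  by move=> j; exact: Cinf_data_term.
by apply: eq_bigr => j _; rewrite /data_term DnZ Dn_add.
Qed.

Lemma dds_data_sol q psi : xsmooth_below psi ->
  Dn 2 (data_sol q.+1 psi) = fun x s tau => data_sol q.+1 (fun j => lap2 a (psi j)) x s tau + data_sol q psi x s tau.
Proof.
move=> cpsi; rewrite Dn_data_sol //; apply: ext3 => x s tau; rewrite /data_sol -big_split; apply: eq_bigr => k _.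
rewrite -big_split; apply: eq_bigr => j _; rewrite /data_term add2n DnSS_impulse.
  by rewrite -iterS iterSr Rmult_plus_distr_l.
by apply: xsmooth_iter_lap2; apply: cpsi; exact: leq_trans (ltn_ord j) (leq_subr _ _).
Qed.

Lemma data_sol_0 psi x s tau : data_sol 0 psi x s tau = 0.
Proof.
rewrite /data_sol big1 // => k _; rewrite big1 // => j _.
by rewrite /data_term [impulse _ _ _]/= Dn_0 Rmult_0_r.
Qed.

(* The sum over k is completed to the full binomial expansion of
   d_t^(r - 1 - j) (d_t^2 - L)^m v = 0, where v = impulse m g; all the terms added vanish at 0 since
   they carry fewer than 2 m - 1 derivatives of v. *)
Lemma data_sol_initial psi r x tau : xsmooth_below psi -> (r < 2 * m)%N -> Dn r (data_sol m psi) x 0 tau = psi r x tau.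
Proof.
move=> cpsi rm; rewrite Dn_data_sol //.
pose e p k j := Dn p (impulse (nu := nu) a m (iter k (lap2 a) (psi j))) x 0 tau.
have e0 p k j : (j < 2 * m)%N -> (p.+1 < 2 * m)%N -> e p k j = 0.
  by move=> jm pm; apply: (Dn_impulse_at0 nu a p).1 => //; apply: xsmooth_iter_lap2; exact: cpsi.
pose c k := (-1) ^ k * INR 'C(m, k).
transitivity (\sum_(j < 2 * m) \sum_(k < m) (c k * e (r + 2 * m - 1 - 2 * k - j)%N k j)).
  rewrite exchange_big; apply: eq_bigr => k _.
  transitivity (\sum_(j < 2 * m - 2 * k) (c k * e (r + 2 * m - 1 - 2 * k - j)%N k j)).
    apply: eq_bigr => j _; congr (_ * Dn _ _ _ _ _).
    by have := ltn_ord j; have := ltn_ord k; lia.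
  (* An added term has j >= 2 m - 2 k, so its order is at most r - 1, or 0 by truncated
     subtraction. *)
  rewrite (big_ord_widen (2 * m) (fun j => c k * e (r + 2 * m - 1 - 2 * k - j)%N k j)) ?leq_subr //.
  rewrite big_mkcond; apply: eq_bigr => j _; case: ifP => // jk.
  by rewrite e0 ?Rmult_0_r //; have := ltn_ord j; have := ltn_ord k; lia.
(* For j = r the term k = 0 carries exactly 2 m - 1 derivatives and gives psi r; the terms with k >
   0 carry fewer. *)
rewrite (bigD1 (Ordinal rm)) //= [X in _ + X]big1 ?Rplus_0_r.
  rewrite (bigD1 (Ordinal hm)) //= [X in _ + X]big1 ?Rplus_0_r; last first.
    move=> k; rewrite -(inj_eq val_inj) /= => k0.
    by rewrite e0 ?Rmult_0_r //; have := ltn_ord k; lia.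
  rewrite /c bin0 /e /= (Dn_impulse_at0 nu a _).2; first by ring.
    exact: cpsi.
  by lia.
move=> j; rewrite -(inj_eq val_inj) /= => jr; have jm := ltn_ord j.
(* For j > r every order is at most 2 m - 2; the cancellation is needed for j < r. *)
case: (ltnP r j) => rj.
  by rewrite big1 // => k _; rewrite e0 ?Rmult_0_r //; lia.
have jr' : (j < r)%N by lia.
(* With e = r - 1 - j the k-th term has order 2 (m - k) + e; the term k = m, absent from the sum,
   has order e < 2 m - 1 and is zero. *)
have := @altsum_impulse nu a m m (r - 1 - j) (psi j) x 0 tau (cpsi j jm) (leqnn m).
rewrite subnn [impulse _ _ _]/= Dn_0 /altsum big_ord_recr /=.
rewrite -/(e _ _ _) e0 ?Rmult_0_r ?Rplus_0_r; [|by []|by lia].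
move=> H; rewrite -[RHS]H; apply: eq_bigr => k _; congr (_ * _); rewrite /e; congr (Dn _ _ _ _ _).
by have := ltn_ord k; lia.
Qed.

Definition sol q f psi : vec n -> R -> R := fun x t => duhamel (impulse (nu := nu) a q f) x t + data_sol q psi x t 0.

Lemma pd2D i F F' : Ckp 1 0 F -> Ckp 1 0 F' ->
  pd2 i (fun (x : vec n) t => F x t + F' x t) = fun x t => pd2 i F x t + pd2 i F' x t.
Proof.
move=> [_ [/(_ i) [G d _] _]] [_ [/(_ i) [G' d' _] _]]; apply: ext2 => x t.
rewrite /pd2 (is_pd_pderiv (d t)) (is_pd_pderiv (d' t)).
by apply: is_derive_unique; exact: (is_deriveD (d t x) (d' t x)).
Qed.

Lemma lap2D F F' x t : xsmooth F -> xsmooth F' ->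
  lap2 a (fun (x : vec n) t => F x t + F' x t) x t = lap2 a F x t + lap2 a F' x t.
Proof.
move=> c c'; rewrite !lap2E -Rmult_plus_distr_l -big_split; congr (_ * _); apply: eq_bigr => i _.
by rewrite pd2D // pd2D //; [have [_] := xsmooth_pd i c|have [_] := xsmooth_pd i c'].
Qed.

Lemma lap2_sol q f psi x t : xsmooth f -> xsmooth_below psi ->
  lap2 a (sol q f psi) x t = duhamel (impulse (nu := nu) a q (lap2 a f)) x t + data_sol q (fun j => lap2 a (psi j)) x t 0.
Proof.
move=> cf cpsi; rewrite /sol lap2D.
- rewrite lap2_duhamel; last exact: Cinf_impulse.
  by rewrite lap3_impulse //; congr (_ + _); exact: (congr1 (fun V => V x t 0) (lap3_data_sol q cpsi)).
- by move=> k; apply: Ckp_duhamel => //; exact: Cinf_impulse.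
- by move=> k; apply: Cinf_slice; exact: Cinf_data_sol.
Qed.

Lemma duhamelD (V V' : vec n -> R -> R -> R) x t : cont3 V -> cont3 V' ->
  duhamel (fun x s tau => V x s tau + V' x s tau) x t = duhamel V x t + duhamel V' x t.
Proof. by move=> cV cV'; apply: RIntD; [apply: (cont3_comp cV)|apply: (cont3_comp cV')]; cont. Qed.

Lemma duhamel_0 x t : duhamel (fun (_ : vec n) _ _ => 0) x t = 0.
Proof. by rewrite /duhamel RInt_const /scal /= /mult /=; ring. Qed.

(** After m applications of the wave operator the source itself remains, whereas [sol 0] would
    vanish together with E_0. *)
Definition sol_or_source q f psi := if q is 0%N then f else sol q f psi.

(** Two differentiations of the Duhamel integral give the boundary values E_(q+1)(0) = 0 and
    E_(q+1)'(0), which is f for q = 0 and 0 otherwise: the source is released at the last of the m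
    steps. *)
Lemma box_sol q f psi v x t : xsmooth f -> xsmooth_below psi -> 0 <= t ->
  (forall x t, 0 <= t -> v x t = sol q.+1 f psi x t) -> box a v x t = sol_or_source q f psi x t.
Proof.
move=> cf cpsi t0 vU.
have cE := Cinf_impulse a q.+1 cf; have [d1 c1] := Cinf_ds cE; have [d2 c2] := Cinf_ds c1.
have cV := Cinf_data_sol q.+1 cpsi; have [d3 c3] := Cinf_ds cV; have [d4 c4] := Cinf_ds c3.
have cL := xsmooth_lap2 a cf.
rewrite (box_of (F := sol q.+1 f psi) (F1 := fun x t => duhamel (ds (impulse (nu := nu) a q.+1 f)) x t + ds (data_sol q.+1 psi) x t 0)
  (F2 := fun x t => (ds (impulse (nu := nu) a q.+1 f) x 0 t + duhamel (ds (ds (impulse (nu := nu) a q.+1 f))) x t) + ds (ds (data_sol q.+1 psi)) x t 0) a x t0 _ _ vU).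
- rewrite lap2_sol // -[ds (ds (data_sol _ _))]/(Dn 2 _) dds_data_sol // dds_impulse //.
  rewrite duhamelD; [|by apply: Cinf_cont; exact: Cinf_impulse|by apply: Cinf_cont; exact: Cinf_impulse].
  rewrite ds_impulse_at0 //; case: q {vU cE d1 c1 d2 c2 cV d3 c3 d4 c4} => [|q].
    have -> : duhamel (impulse (nu := nu) a 0 f) x t = 0 by exact: duhamel_0.
    by rewrite data_sol_0 eqxx -[sol_or_source _ _ _ _ _]/(f x t); ring.
  by rewrite (_ : (q.+1 == 0)%N = false) // -[sol_or_source _ _ _ _ _]/(sol q.+1 f psi x t) /sol; ring.
- move=> y s; apply: is_deriveD; last exact: d3.
  apply: is_derive_eq; first exact: (is_derive_duhamel y s (Cinf_cont cE) (Cinf_cont c1) d1).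
  by rewrite impulse_at0; ring.
- move=> y s; apply: is_deriveD; last exact: d4.
  exact: (is_derive_duhamel y s (Cinf_cont c1) (Cinf_cont c2) d2).
Qed.

Lemma iter_box_sol f psi u : xsmooth f -> xsmooth_below psi -> (forall x t, 0 <= t -> u x t = sol m f psi x t) ->
  forall l, (l <= m)%N -> forall x t, 0 <= t -> iter l (box a) u x t = sol_or_source (m - l) f psi x t.
Proof.
move=> cf cpsi uU; elim=> [|l IH] lm x t t0.
  by rewrite subn0 /= uU //; case: (m) hm.
rewrite iterS (_ : m - l.+1 = (m - l).-1)%N; last by lia.
case e: (m - l)%N => [|q]; first by lia.
apply: box_sol => // y s s0; rewrite IH ?e //; exact: ltnW.
Qed.

Lemma sol_solves f psi u : xsmooth f -> xsmooth_below psi -> (forall x t, 0 <= t -> u x t = sol m f psi x t) ->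
  [/\ Ck_half (2 * m) u,
      forall x t, 0 <= t -> iter m (box a) u x t = f x t
    & forall j, (j < 2 * m)%N -> forall x, derive_n_ge0 j (u x) 0 = psi j x 0].
Proof.
move=> cf cpsi uU.
have cE := Cinf_impulse a m cf; have cV := Cinf_data_sol m cpsi.
have E0 r : (r.+1 < 2 * m)%N -> forall x tau, Dn r (impulse (nu := nu) a m f) x 0 tau = 0.
  by move=> rm x tau; exact: (Dn_impulse_at0 nu a r).1.
split.
(* The impulse vanishes at s = 0 to exactly the order that [Ckp_duhamel] asks for with p = 2 m. *)
- apply: (Ckp_half (leqnn _) _ uU); apply: CkpD; last exact: Cinf_slice.
  by apply: Ckp_duhamel => // q; exact: E0.
- by move=> x t t0; rewrite (iter_box_sol cf cpsi uU) // subnn.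
move=> j jm x.
(* Up to order 2 m - 1 no boundary term appears, so the derivatives pass onto the impulse inside the
   Duhamel integral, which vanishes at t = 0. *)
rewrite (derive_n_ge0E (H := fun r s => duhamel (Dn r (impulse (nu := nu) a m f)) x s + Dn r (data_sol m psi) x s 0) (N := (2 * m).-1)) //.
- by rewrite data_sol_initial // /duhamel RInt_point /zero /=; ring.
- by move=> s s0; exact: uU.
- move=> r s rm; have [d1 c1] := Cinf_ds (Cinf_Dn r cE); have [d2 _] := Cinf_ds (Cinf_Dn r cV).
  apply: is_deriveD; last exact: d2.
  apply: is_derive_eq; first exact: (is_derive_duhamel x s (Cinf_cont (Cinf_Dn r cE)) (Cinf_cont c1) d1).
  by rewrite E0; [rewrite Rplus_0_l|lia].
- by lia.
- lra.
Qed.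

End Solution.

(** * Comparison with the explicit formula *)

Section Conversion.
Variables (nu : nat) (a : R).
Local Notation n := (2 * nu).+3.
Implicit Types (g : vec n -> R -> R) (psi : nat -> vec n -> R -> R).

Lemma Amean3_sum (I : Type) (r : seq I) (G : I -> vec n -> R -> R) x s tau :
  (forall i, contf2 (G i)) ->
  Amean3 a (fun x tau => \big[Rplus/0]_(i <- r) G i x tau) x s tau = \big[Rplus/0]_(i <- r) Amean3 a (G i) x s tau.
Proof.
move=> cG; elim: r => [|i r IH].
  have -> : (fun x tau => \big[Rplus/0]_(i <- [::]) G i x tau) = (fun x tau => 0 * (fun _ _ => 0) x tau).
    by apply: ext2 => *; rewrite big_nil; ring.
  by rewrite big_nil Amean3Z ?Rmult_0_l //; exact: contf_const.
rewrite big_cons -IH -Amean3D //; last by apply: contf_sum.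
by congr (Amean3 a _ x s tau); apply: ext2 => *; rewrite big_cons.
Qed.

Lemma lap3_Amean3 g : xsmooth g -> lap3 a (Amean3 a g) = Amean3 a (lap2 a g).
Proof.
move=> cg; apply: ext3 => x s tau; rewrite lap3E.
have c i : xsmooth (pd2 i (pd2 i g)) by have [_ c] := xsmooth_pd i cg; have [] := xsmooth_pd i c.
have pA i h : xsmooth h -> pd3 i (Amean3 a h) = Amean3 a (pd2 i h).
  move=> ch; have [d c'] := xsmooth_pd i ch; apply: is_pd3E.
  by apply: is_pd3_Amean3 => //; exact: xsmooth_cont.
rewrite (_ : lap2 a g = fun x tau => a ^ 2 * \sum_(i < n) pd2 i (pd2 i g) x tau) //.
rewrite Amean3Z; last by apply: contf_sum => i; exact: xsmooth_cont.
rewrite Amean3_sum; last by move=> i; exact: xsmooth_cont.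
congr (_ * _); apply: eq_bigr => i _; rewrite !pA //.
by have [] := xsmooth_pd i cg.
Qed.

Lemma iter_a2lap_slice k (V : vec n -> R -> R -> R) s tau :
  iter k (a2lap a) (fun y => V y s tau) = fun y => iter k (lap3 a) V y s tau.
Proof. by elim: k => [//|k IH]; rewrite iterS IH. Qed.

Lemma iter_a2lap_slice2 k g tau :
  iter k (a2lap a) (fun y => g y tau) = fun y => iter k (lap2 a) g y tau.
Proof. by elim: k => [//|k IH]; rewrite iterS IH. Qed.

(** The theorem applies the Laplacians to the spherical means of the source, the impulse has them on
    the source itself. *)
Lemma iter_a2lap_Amean k g s tau x : xsmooth g ->
  iter k (a2lap a) (Amean (nu := nu) a s (fun y => g y tau)) x = Amean3 a (iter k (lap2 a) g) x s tau.
Proof.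
move=> cg; rewrite (iter_a2lap_slice k (Amean3 a g)).
have -> : iter k (lap3 a) (Amean3 a g) = Amean3 a (iter k (lap2 a) g) => //.
by elim: k => [//|k IH]; rewrite iterS IH lap3_Amean3 //; exact: xsmooth_iter_lap2.
Qed.

(** The kernel part of E_(q+1), with g in place of L^nu g. It is treated separately because the
    theorem applies its time derivatives to this part and writes the polynomial part already
    differentiated. *)
Definition Kmean q g : vec n -> R -> R -> R := fun x s tau =>
  Kiter q (fun s => Imean (nu := nu) a g x s tau) s.

Lemma KmeanS q g : Kmean q.+1 g = fun x s tau => / (2 * INR q.+1) * int0s (fun x s tau => s * Kmean q g x s tau) x s tau.
Proof. by []. Qed.

Lemma Cinf_Kmean q g : xsmooth g -> Cinf (Kmean q g).
Proof.
move=> cg; elim: q => [|q IH]; first exact: Cinf_Imean.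
by rewrite KmeanS; apply: CinfZ; apply: CinfJ; apply: Cinf_M.
Qed.

Lemma lap3_Kmean q g : xsmooth g -> lap3 a (Kmean q g) = Kmean q (lap2 a g).
Proof.
move=> cg; elim: q => [|q IH]; first exact: lap3_Imean.
rewrite !KmeanS lap3Z lap3_int0s; last by apply: Cinf_M; exact: Cinf_Kmean.
by rewrite (lap3M a (fun s => s)) IH.
Qed.

Lemma kernel_int_Kmean q g x T tau : xsmooth g ->
  kernel_int q.+1 (fun s => s * iter nu Iop (fun s => Amean (nu := nu) a s (fun y => g y tau) x) s) T
  = Kmean q g x T tau.
Proof.
move=> cg; have -> : (fun s => s * iter nu Iop (fun s => Amean (nu := nu) a s (fun y => g y tau) x) s)
   = (fun s => Imean a g x s tau) by apply: functional_extensionality => s; rewrite ImeanE.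
by apply: kernel_intE; apply: cont3_slice; apply: cont3_Imean; exact: xsmooth_cont.
Qed.

(** (2 q + 2 r + 1)! is a product of two consecutive double factorials, and the even one, 2^(q + r)
    (q + r)!, contains the binomial coefficient. With q = m - 1 this turns the coefficients of
    [impulse_formula] into those of the second line of the theorem. *)
Lemma binomial_dfact q r :
  INR 'C(q + r, r) / INR (2 * q + 2 * r).+1`!
  = / (INR (dfact (2 * q)) * INR (dfact (2 * q + 2 * r).+1) * INR (dfact (2 * r))).
Proof.
have e : ('C(q + r, r) * (dfact (2 * q) * dfact (2 * r)) = dfact (2 * q + 2 * r))%N.
  rewrite -mulnDr !dfact_even -(bin_fact (leq_addl q r)) addnK expnD; lia.
rewrite -dfactSM -e !INR_mul.
have := @dfact_neq0R (2 * q); have := @dfact_neq0R (2 * r); have := @dfact_neq0R (2 * q + 2 * r).+1.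
have : INR 'C(q + r, r) <> 0 by have := @INR_gt0 'C(q + r, r); rewrite bin_gt0 leq_addl => /(_ isT); lra.
move: (INR 'C(q + r, r)) (INR (dfact (2 * q + 2 * r).+1)) (INR (dfact (2 * r))) (INR (dfact (2 * q))) => A B C D *.
by field; repeat split.
Qed.

Lemma Dn_pow p e g : (p <= e)%N ->
  Dn p (fun x s tau => s ^ e * g x tau) = fun x s tau => INR e`! / INR (e - p)`! * s ^ (e - p) * g x tau.
Proof.
elim: p => [|p IH] pe.
  by rewrite subn0; apply: ext3 => x s tau /=; field; exact: fact_neq0R.
rewrite /Dn iterS -/(Dn _ _) IH ?(ltnW pe) //; apply: is_dsE => x s tau.
apply: is_derive_eq.
  by apply: is_deriveM (is_deriveC _ _); apply: is_derive_scal; apply: is_derive_pow; exact: is_deriveI.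
rewrite (_ : e - p = (e - p.+1).+1)%N; last by lia.
rewrite factS INR_mul -pred_Sn; field; split; first exact: fact_neq0R.
by have := INR_gt0 (ltn0Sn (e - p.+1)); lra.
Qed.

Lemma impulse_Kmean q g : xsmooth g -> impulse (nu := nu) a q.+1 g = fun x s tau => Kmean q (iter nu (lap2 a) g) x s tau
   + \sum_(i < nu) (INR 'C(q + i, i) / INR (2 * q + 2 * i).+1`! * (s ^ (2 * q + 2 * i).+1 * iter i (lap2 a) g x tau)).
Proof.
move=> cg; apply: ext3 => x s tau; rewrite impulse_formula //; congr (_ + _).
by apply: eq_bigr => i _; ring.
Qed.

(** The bound on p, which is 2 m - 1 for q = m - 1, keeps every exponent 2 q + 2 i + 1 - p free of
    truncation. *)
Lemma Dn_impulse q p g : xsmooth g -> (p <= (2 * q).+1)%N ->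
  Dn p (impulse (nu := nu) a q.+1 g) = fun x s tau => Dn p (Kmean q (iter nu (lap2 a) g)) x s tau
   + \sum_(i < nu) (INR 'C(q + i, i) * (s ^ ((2 * q + 2 * i).+1 - p) / INR ((2 * q + 2 * i).+1 - p)`!)
        * iter i (lap2 a) g x tau).
Proof.
move=> cg pq; rewrite impulse_Kmean //.
have cp (i : nat) : Cinf (fun (x : vec n) s tau => INR 'C(q + i, i) / INR (2 * q + 2 * i).+1`!
     * (s ^ (2 * q + 2 * i).+1 * iter i (lap2 a) g x tau)).
  by apply: CinfZ; apply: CinfX; apply: Cinf_lift; exact: xsmooth_iter_lap2.
rewrite DnD; last 2 first.
- by apply: Cinf_Kmean; exact: xsmooth_iter_lap2.
- by apply: (@Cinf_sum _ _ _ _ (fun (i : 'I_nu) x s tau => INR 'C(q + i, i) / INR (2 * q + 2 * i).+1`!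
     * (s ^ (2 * q + 2 * i).+1 * iter i (lap2 a) g x tau))).
rewrite (@Dn_sum _ _ _ _ (fun (i : 'I_nu) x s tau => INR 'C(q + i, i) / INR (2 * q + 2 * i).+1`!
     * (s ^ (2 * q + 2 * i).+1 * iter i (lap2 a) g x tau))) //.
apply: ext3 => x s tau; congr (_ + _); apply: eq_bigr => i _.
rewrite DnZ Dn_pow; last by lia.
move: (@fact_neq0R (2 * q + 2 * i).+1) (@fact_neq0R ((2 * q + 2 * i).+1 - p)).
by move: (INR (2 * q + 2 * i).+1`!) (INR ((2 * q + 2 * i).+1 - p)`!) => A B *; field; repeat split.
Qed.

End Conversion.

Unset Implicit Arguments.

Theorem theorem3p5 (nu m : nat) (hm : (1 <= m)%N) (a : R)
  (f : vec (2 * nu).+3 -> R -> R) (hf : smooth_half f)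
  (phi : nat -> vec (2 * nu).+3 -> R)
  (hphi : forall j, (j < 2 * m)%N -> smooth (phi j))
  (u : vec (2 * nu).+3 -> R -> R)
  (hu : forall x t, 0 <= t ->
    u x t =
      RInt (fun tau =>
        kernel_int m (fun sigma => sigma *
          iter nu Iop
            (fun s => iter nu (a2lap a) (Amean a s (fun y => f y tau)) x) sigma)
          (t - tau)) 0 t
    + / INR (dfact (2 * m - 2)) *
      (\sum_(r < nu)
         RInt (fun tau =>
           (t - tau) ^ (2 * m + 2 * r - 1)
             / (INR (dfact (2 * m + 2 * r - 1)) * INR (dfact (2 * r)))
             * iter r (a2lap a) (fun y => f y tau) x) 0 t)
    + (\sum_(k < m) ((- 1) ^ k * INR 'C(m, k) *
        iter (k + nu) (a2lap a)
          (fun y => \sum_(j < 2 * m - 2 * k)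
             derive_n_ge0 (2 * m - 1 - 2 * k - j)
               (fun T => kernel_int m
                  (fun tau => tau *
                     iter nu Iop (fun s => Amean a s (phi j) y) tau) T) t)
          x))
    + (\sum_(k < m) ((- 1) ^ k * INR 'C(m, k) *
        (\sum_(j < 2 * m - 2 * k) \sum_(i < nu)
           (INR 'C(m - 1 + i, i)
            * (t ^ (2 * k + 2 * i + j) / INR (2 * k + 2 * i + j)`!)
            * iter (k + i) (a2lap a) (phi j) x))))) :
  solves_cauchy a m f phi u.
Proof.
pose F := fun x t => f x (Rmax 0 t).
pose psi j : vec (2 * nu).+3 -> R -> R := fun x _ => phi j x.
have cF : xsmooth F by exact: xsmooth_half.
have cpsi : xsmooth_below m psi by move=> j jm; apply: xsmooth_smooth; exact: hphi.
have uU : forall x t, 0 <= t -> u x t = sol m a m F psi x t; last first.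
  have [c1 c2 c3] := sol_solves hm cF cpsi uU; split=> //.
  by move=> x t t0; rewrite c2; [rewrite /F Rmax_right //; lra|lra].
case: m hm hphi hu cpsi => [//|q] _ _ hu cpsi x t t0.
(* The first two lines of the formula are the Duhamel integral, the last two the part coming from
   the data. *)
rewrite hu // /sol Rplus_assoc; congr (_ + _).
- have cN := xsmooth_iter_lap2 a nu cF.
  have cK : cont3 (Kmean (nu := nu) a q (iter nu (lap2 a) F)) by apply: Cinf_cont; exact: Cinf_Kmean.
  pose c i := INR 'C(q + i, i) / INR (2 * q + 2 * i).+1`!.
  have cP i : contf (fun tau => c i * ((t - tau) ^ (2 * q + 2 * i).+1 * iter i (lap2 a) F x tau)).
    by cont; apply: (contf2_comp (xsmooth_cont (xsmooth_iter_lap2 a i cF))); cont.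
  rewrite /duhamel impulse_Kmean // RIntD; last 2 first.
  + by apply: (cont3_comp cK); cont.
  + by apply: contf_sum => i; exact: cP.
  (* The integrands are compared for 0 < tau < t, where freezing at negative times does not change
     f. *)
  have fF tau : 0 < tau -> (fun y => f y tau) = (fun y => F y tau).
    by move=> ?; apply: functional_extensionality => y; rewrite /F Rmax_right //; lra.
  congr (_ + _).
    apply: RInt_congr_in => // tau tau0 _; rewrite -kernel_int_Kmean //.
    congr (kernel_int _ _ _); apply: functional_extensionality => s.
    congr (_ * iter nu Iop _ s); apply: functional_extensionality => r.
    by rewrite fF // iter_a2lap_Amean.
  rewrite (@RInt_sum _ _ _ (fun (i : 'I_nu) tau => c i * ((t - tau) ^ (2 * q + 2 * i).+1 * iter i (lap2 a) F x tau))) //.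
  rewrite sumZ; apply: eq_bigr => i _.
  have -> : (2 * q.+1 - 2 = 2 * q)%N by lia.
  have -> : (2 * q.+1 + 2 * i - 1 = (2 * q + 2 * i).+1)%N by lia.
  (* The theorem divides the whole sum by (2 m - 2)!!, while [c i] already contains this factor;
     with m = q + 1 it is [dfact (2 * q)]. *)
  rewrite (RInt_congr_in (g := fun tau => INR (dfact (2 * q)) *
     (c i * ((t - tau) ^ (2 * q + 2 * i).+1 * iter i (lap2 a) F x tau)))) //; last first.
    move=> tau tau0 _; rewrite fF // iter_a2lap_slice2 /c binomial_dfact.
    move: (@dfact_neq0R (2 * q)) (@dfact_neq0R (2 * i)) (@dfact_neq0R (2 * q + 2 * i).+1).
    move: (INR (dfact (2 * q + 2 * i).+1)) (INR (dfact (2 * i))) (INR (dfact (2 * q))) => A B C *.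
    by field; repeat split.
  rewrite RIntZ //; field; exact: dfact_neq0R.
rewrite /data_sol -big_split; apply: eq_bigr => k _.
etransitivity; first exact: (esym (Rmult_plus_distr_l _ _ _)).
rewrite /data_term -sumZ; congr (_ * _).
have jlt (j : 'I_(2 * q.+1 - 2 * k)) : (j < 2 * q.+1)%N by exact: leq_trans (ltn_ord j) (leq_subr _ _).
have cj (j : 'I_(2 * q.+1 - 2 * k)) : xsmooth (psi j) by exact: cpsi.
pose p j := (2 * q.+1 - 1 - 2 * k - j)%N.
have -> : (fun y => \sum_(j < 2 * q.+1 - 2 * k) derive_n_ge0 (p j)
    (fun T => kernel_int q.+1 (fun tau => tau * iter nu Iop (fun s => Amean a s (phi j) y) tau) T) t)
  = (fun y => (fun y s tau => \sum_(j < 2 * q.+1 - 2 * k) Dn (p j) (Kmean (nu := nu) a q (psi j)) y s tau) y t 0).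
  apply: functional_extensionality => y; apply: eq_bigr => j _.
  apply: (derive_n_ge0E (H := fun r s => Dn r (Kmean (nu := nu) a q (psi j)) y s 0) (N := p j)) => //.
    by move=> s _; exact: (kernel_int_Kmean a q y s 0 (cj j)).
  by move=> r s _; have [d _] := Cinf_ds (Cinf_Dn r (Cinf_Kmean a q (cj j))); exact: d.
rewrite (iter_a2lap_slice _ _ (fun y s tau => \sum_(j < 2 * q.+1 - 2 * k) Dn (p j) (Kmean (nu := nu) a q (psi j)) y s tau)).
(* In the theorem the Laplacians stand outside the time derivatives and the kernel; they commute
   with both and are moved onto the data. *)
have -> : iter (k + nu) (lap3 a) (fun y s tau => \sum_(j < 2 * q.+1 - 2 * k) Dn (p j) (Kmean (nu := nu) a q (psi j)) y s tau)
  = fun y s tau => \sum_(j < 2 * q.+1 - 2 * k) Dn (p j) (Kmean (nu := nu) a q (iter (k + nu) (lap2 a) (psi j))) y s tau.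
  elim: (k + nu)%N => [//|l IH]; rewrite iterS IH.
  rewrite (@lap3_sum _ a _ _ _ (fun (j : 'I_(2 * q.+1 - 2 * k)) => Dn (p j) (Kmean (nu := nu) a q (iter l (lap2 a) (psi j))))); last first.
    by move=> j; apply: Cinf_Dn; apply: Cinf_Kmean; exact: xsmooth_iter_lap2.
  apply: ext3 => y s tau; apply: eq_bigr => j _.
  by rewrite lap3_Dn ?lap3_Kmean //; [exact: xsmooth_iter_lap2|apply: Cinf_Kmean; exact: xsmooth_iter_lap2].
rewrite -big_split; apply: eq_bigr => j _.
have hk := ltn_ord k; have hj := ltn_ord j.
rewrite [in RHS]Dn_impulse; [|exact: xsmooth_iter_lap2|by rewrite /p; lia].
rewrite -iterD [(nu + k)%N]addnC; apply: (congr2 Rplus) => //; apply: eq_bigr => i _.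
have -> : iter (k + i) (a2lap a) (phi j) = fun y => iter (k + i) (lap2 a) (psi j) y 0.
  exact: (iter_a2lap_slice2 a (k + i) (psi j) 0).
rewrite -iterD [(i + k)%N]addnC.
(* As p j = 2 q + 1 - 2 k - j, the exponent left after differentiation is that of the last line of
   the theorem. *)
have -> : ((2 * q + 2 * i).+1 - p j = 2 * k + 2 * i + j)%N by rewrite /p; lia.
by rewrite (_ : q.+1 - 1 = q)%N //; lia.
Qed.
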